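(* The spy and the $n$ prisoners have an efficient strategy such that for every initial permutation $\sigma\in S_n$ the spy makes a single swap and then all $n$ prisoners find their number, each prisoner opening $O\left(\frac{n\log\log n}{\log n}\right)$ drawers in the worst case. The time complexity of the strategy is $O(n^2)$ for each participant (the spy and each prisoner). Here the implied constants are absolute and the asymptotics are as $n\to\infty$.
   Context: Write $[n]=\{1,\dots,n\}$ and let $S_n$ be the set of permutations of $[n]$. There are $n$ drawers labeled $1,\dots,n$ and $n$ prisoners numbered $1,\dots,n$. An assignment of numbers to drawers is a permutation $\sigma\in S_n$, where $\sigma(j)$ is the number placed in drawer $j$. The game. A spy sees the whole initial assignment $\sigma$ and makes a single swap: the spy chooses $(a,b)\in[n]^2$ and exchanges the contents of drawers $a$ and $b$, so that the assignment becomes $\sigma'=\sigma\circ(a\ b)$ (when $a=b$ nothing changes). The spy does not otherwise communicate with the prisoners. Then each prisoner, separately and without any communication with the others, opens drawers one at a time in the assignment $\sigma'$. The choice of the next drawer may depend on the prisoner's own number and on the labels and contents of the drawers this prisoner has already opened. Drawers are closed again afterwards and contents are not changed. Prisoner $i$ finds their number if they open the drawer $j$ with $\sigma'(j)=i$. A strategy consists of a deterministic rule for the spy (a function $\sigma\mapsto(a,b)$) and, for each prisoner, a deterministic adaptive rule for opening drawers, all fixed in advance. Efficiency: the strategy is given by explicit deterministic algorithms, uniform in $n$. The time complexity for the spy is the total running time to compute the swap $(a,b)$ from $n$ and $\sigma$; the time complexity for a prisoner is the total running time to compute all the drawers this prisoner opens, from $n$, the prisoner's number and the contents seen. Time is counted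 in the usual way for algorithms (elementary operations on integers with $O(\log n)$ bits, with random access memory). *)

(* Defs.v *)
From HB Require Import structures.
From mathcomp Require Import all_boot all_order all_algebra all_fingroup.
From mathcomp Require Import reals exp.

Set Implicit Arguments.
Unset Strict Implicit.
Unset Printing Implicit Defensive.

(* Drawers and prisoners are numbered 0, ..., n-1 instead of 1, ..., n.
   A history lists the (drawer, content) pairs already seen, oldest first;
   [next i h = None] means that prisoner i stops after seeing h. *)
Record strategy (n : nat) := Strategy {
  spy : {perm 'I_n} -> 'I_n * 'I_n;
  next : 'I_n -> seq ('I_n * 'I_n) -> option 'I_n
}.

(* MathComp composes permutations from left to right: this maps j to
   sigma (tperm a b j). *)
Definition after_swap n (S : strategy n) (sigma : {perm 'I_n}) : {perm 'I_n} :=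
  (tperm (spy S sigma).1 (spy S sigma).2 * sigma)%g.

(* After the history h, the rule f opens exactly the drawers ds, in this
   order, in the assignment tau, and then stops. *)
Fixpoint opens_from n (f : seq ('I_n * 'I_n) -> option 'I_n)
    (tau : {perm 'I_n}) (h : seq ('I_n * 'I_n)) (ds : seq 'I_n) : Prop :=
  match ds with
  | [::] => f h = None
  | d :: ds' => f h = Some d /\ opens_from f tau (rcons h (d, tau d)) ds'
  end.

Definition opens n (S : strategy n) (i : 'I_n) (tau : {perm 'I_n})
    (ds : seq 'I_n) : Prop :=
  opens_from (next S i) tau [::] ds.

Definition finds n (i : 'I_n) (tau : {perm 'I_n}) (ds : seq 'I_n) : Prop :=
  exists2 j, j \in ds & tau j = i.

(* Word RAM programs: structured programs over registers (accessed by fixed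
   indices) and a random access memory (accessed by computed addresses).  Both
   hold natural numbers below 2 ^ w, where w is the word size: there is no rule,
   hence no run, for a program that evaluates an expression with a larger
   intermediate value.  Every node of an expression and every instruction costs
   one unit of time. *)

Inductive binop := Add | Sub | Mul | Div | Mod | Eq | Lt.

Inductive expr :=
  | ENum of nat
  | EReg of nat
  | EMem of expr
  | EBin of binop & expr & expr.

Inductive com :=
  | CSkip
  | CSet of nat & expr
  | CStore of expr & expr
  | COpen of nat & expr
  | CSeq of com & com
  | CIf of expr & com & com
  | CWhile of expr & com.

Record state := State { reg : nat -> nat; mem : nat -> nat }.

Definition upd (f : nat -> nat) (x v : nat) : nat -> nat :=
  fun y => if y == x then v else f y.

Definition set_reg (s : state) (x v : nat) : state :=
  State (upd (reg s) x v) (mem s).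

Definition set_mem (s : state) (p v : nat) : state :=
  State (reg s) (upd (mem s) p v).

Definition apply_op (o : binop) (u v : nat) : nat :=
  match o with
  | Add => u + v
  | Sub => u - v
  | Mul => u * v
  | Div => u %/ v
  | Mod => u %% v
  | Eq => u == v
  | Lt => u < v
  end.

Definition fit (w v : nat) : option nat := if v < 2 ^ w then Some v else None.

Fixpoint eval (w : nat) (s : state) (e : expr) : option nat :=
  match e with
  | ENum k => fit w k
  | EReg x => fit w (reg s x)
  | EMem a => if eval w s a is Some p then fit w (mem s p) else None
  | EBin o e1 e2 =>
      if eval w s e1 is Some u then
        if eval w s e2 is Some v then fit w (apply_op o u v) else None
      else None
  end.

Fixpoint ecost (e : expr) : nat :=
  match e with
  | ENum _ | EReg _ => 1
  | EMem a => (ecost a).+1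
  | EBin _ e1 e2 => (ecost e1 + ecost e2).+1
  end.

(* [exec w drawer c s t ds s']: with word size w and drawer contents given by
   [drawer] ([None] if there is no such drawer), the program c started in the
   state s halts in the state s' after t units of time, having opened the
   drawers ds in this order, with repetitions. *)
Inductive exec (w : nat) (drawer : nat -> option nat) :
    com -> state -> nat -> seq nat -> state -> Prop :=
  | ExSkip s : exec w drawer CSkip s 1 [::] s
  | ExSet x e s v :
      eval w s e = Some v ->
      exec w drawer (CSet x e) s (ecost e).+1 [::] (set_reg s x v)
  | ExStore a e s p v :
      eval w s a = Some p -> eval w s e = Some v ->
      exec w drawer (CStore a e) s (ecost a + ecost e).+1 [::] (set_mem s p v)
  | ExOpen x e s d v :
      eval w s e = Some d -> drawer d = Some v ->
      exec w drawer (COpen x e) s (ecost e).+1 [:: d] (set_reg s x v)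
  | ExSeq c1 c2 s1 s2 s3 t1 t2 ds1 ds2 :
      exec w drawer c1 s1 t1 ds1 s2 -> exec w drawer c2 s2 t2 ds2 s3 ->
      exec w drawer (CSeq c1 c2) s1 (t1 + t2).+1 (ds1 ++ ds2) s3
  | ExIf e c1 c2 s s' v t ds :
      eval w s e = Some v ->
      exec w drawer (if v != 0 then c1 else c2) s t ds s' ->
      exec w drawer (CIf e c1 c2) s (ecost e + t).+1 ds s'
  | ExWhileDone e c s :
      eval w s e = Some 0 ->
      exec w drawer (CWhile e c) s (ecost e).+1 [::] s
  | ExWhileStep e c s1 s2 s3 v t1 t2 ds1 ds2 :
      eval w s1 e = Some v.+1 ->
      exec w drawer c s1 t1 ds1 s2 ->
      exec w drawer (CWhile e c) s2 t2 ds2 s3 ->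
      exec w drawer (CWhile e c) s1 (ecost e + t1 + t2).+1 (ds1 ++ ds2) s3.

(* For constant k these are words of O(log n) bits. *)
Definition word_size (k n : nat) : nat := k * (trunc_log 2 n).+1.

Definition no_drawer (d : nat) : option nat := None.

Definition drawer_of n (tau : {perm 'I_n}) (d : nat) : option nat :=
  omap (fun j : 'I_n => val (tau j)) (insub d).

Definition spy_input n (sigma : {perm 'I_n}) : state :=
  State (fun x => if x == 0 then n else 0)
        (fun j => odflt 0 (drawer_of sigma j)).

Definition prisoner_input n (i : 'I_n) : state :=
  State (fun x => if x == 0 then n else if x == 1 then val i else 0)
        (fun _ => 0).

Definition spy_runs (k : nat) (c : com) n (sigma : {perm 'I_n})
    (ab : 'I_n * 'I_n) (t : nat) : Prop :=
  exists s' : state,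
    [/\ exec (word_size k n) no_drawer c (spy_input sigma) t [::] s',
        reg s' 0 = val ab.1 & reg s' 1 = val ab.2].

Definition prisoner_runs (k : nat) (c : com) n (i : 'I_n) (tau : {perm 'I_n})
    (ds : seq 'I_n) (t : nat) : Prop :=
  exists s' : state,
    exec (word_size k n) (drawer_of tau) c (prisoner_input i) t
         (map val ds) s'.

(* Main.v *)
(* Following the drawers z, tau z, tau (tau z), ... a prisoner opens as many drawers as the
   cycle is long, so it suffices to modify the permutation, in a way known to everybody,
   until all its cycles are short.  List the drawers cycle after cycle and divide the list
   into K ~ log n / log log n blocks.  Exchanging the successors of one drawer x near the
   beginning and one drawer y near the end of a block that lies inside a cycle cuts off a
   cycle of length at most n / K; after all blocks have been treated the remaining part of
   each cycle is short as well.

   The points x, y are communicated as follows.  Identify the drawers with points of a plane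
   over F_p, p = n^(1/2+o(1)).  A second moment estimate shows that for most pairs (u, lam) the
   polylogarithmically many points u + j (lam, lam^2) hit the beginning and the end of all
   blocks; the indices j that do so for the 2K sets are the digits of a number n^(small).
   Hence a message (u, (lam, indices)) ranges over n^(3/2+small) values.  It is
   the pair (sum v_j mod N1, sum j v_j mod s) computed from the contents v_j of the first
   s = 2^r drawers, where N1 is the multiple of s below n.  Moving the value v into drawer
   a < s changes this pair by (delta, a delta), delta = v - v_a, and for odd delta the pair
   determines a and v.  So almost all messages are reachable by one swap, and a count shows
   that a good one is.  The swap itself at most doubles the lengths of the cycles. *)
Require Import Defs.
From HB Require Import structures.
From mathcomp Require Import all_boot all_order all_algebra all_fingroup.
From mathcomp Require Import reals sequences exp.
From mathcomp Require Import ring lra zify.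

Set Implicit Arguments.
Unset Strict Implicit.
Unset Printing Implicit Defensive.

(** * Primes between X and a multiple of X log X *)

(** There are only about [n ^ 2 / 2] swaps, far too few to name [2K] drawers separately. So all cut
    points come from one seed [(u, lam)], and each of them may cost only a polylogarithmic factor.
    Pairwise independence is enough for this, and the parabola supplies it: the difference of two
    distinct vectors [(lam, lam ^ 2)] determines both. The exponent 5/8 of [s] exceeds 1/2 + 1/16,
    so that [lam] and the digits fit into a residue modulo [s]. It is below 3/4, so that [s ^ 2] is
    small against the [n p] seeds. Since [s K <= n], the spy can afford to test every swap of a
    drawer below [s] with one above, at a cost proportional to [K] each. Odd numbers are invertible
    modulo a power of two, and [s] divides [N1], so both components can be compared modulo [s]. An
    odd [delta] fixes the parity of the first component, hence the count runs over half of all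
    pairs: at most [s ^ 2] of these are not reached, and more than [s ^ 2] are good. *)

Lemma leq_bin_double k : 2 ^ k <= 'C(k.*2, k).
Proof.
elim: k => // k IH; rewrite doubleS binS expnS mul2n -addnn.
apply: leq_add; apply: leq_trans IH _; first by rewrite binS leq_addl.
by case: k => // k; rewrite binS leq_addr.
Qed.

(** By Legendre's formula the exponent is the sum over [i] of [2k %/ q ^ i - 2 (k %/ q ^ i)]. Each
    term is at most 1, and it is 0 once [q ^ i > 2k]. *)
Lemma logn_bin_double q k : prime q -> logn q 'C(k.*2, k) <= trunc_log q k.*2.
Proof.
move=> qP; have q1 := prime_gt1 qP.
have [->|k0] := posnP k; first by rewrite bin0 logn1.
(* All factorials are expanded over one common range of [i], so that the sums can be compared term
   by term. *)
have ext m : m <= k.*2 -> logn q m`! = \sum_(1 <= i < k.*2.+1) m %/ q ^ i.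
  move=> mk; rewrite logn_fact // [RHS](big_cat_nat (n := m.+1)) //=.
  rewrite [X in _ + X]big_nat_cond [X in _ + X]big1 ?addn0 // => i /andP[/andP[mi _] _].
  by rewrite divn_small // (leq_trans mi) // ltnW // ltn_expl.
have kk : k <= k.*2 by rewrite -addnn leq_addr.
have := congr1 (logn q) (bin_fact kk).
rewrite -addnn addnK addnn !lognM ?muln_gt0 ?fact_gt0 ?bin_gt0 // !ext //.
set t := trunc_log q k.*2; rewrite -big_split /= => E.
suff : \sum_(1 <= i < k.*2.+1) k.*2 %/ q ^ i <=
    t + \sum_(1 <= i < k.*2.+1) (k %/ q ^ i + k %/ q ^ i).
  by rewrite -E leq_add2r.
have tk : t < k.*2.+1.
  rewrite ltnS; apply: leq_trans (trunc_logP q1 (_ : 0 < k.*2)); last by rewrite double_gt0.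
  by rewrite ltnW // ltn_expl.
have -> : t = \sum_(1 <= i < k.*2.+1) (i <= t).
  rewrite (big_cat_nat (n := t.+1)) //= [X in _ + X]big_nat_cond [X in _ + X]big1 ?addn0; last first.
    by move=> i /andP[/andP[ti _] _]; rewrite leqNgt ti.
  rewrite (eq_big_nat _ _ (F2 := fun=> 1)) => [|i /andP[_ it]]; last by rewrite -ltnS it.
  by rewrite sum_nat_const_nat muln1 subSS subn0.
rewrite -big_split /=; apply: leq_sum => i _.
have [it|ti] := leqP i t.
  by rewrite -[k.*2]addnn addnC; apply: leq_divDl.
rewrite divn_small // ltnNge; apply: contraTN ti => ti; rewrite -leqNgt.
by rewrite trunc_log_max.
Qed.

(* Chebyshev: the prime powers dividing 'C(2k, k) are at most 2k, so if all its
   prime divisors were below X then 2 ^ k <= 'C(2k, k) <= (2k) ^ X. *)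
Lemma prime_between X k : 0 < k -> k.*2 ^ X < 2 ^ k ->
  exists p, [/\ prime p, X <= p & p <= k.*2].
Proof.
move=> k0 H; have c0 : 0 < 'C(k.*2, k) by rewrite bin_gt0 -addnn leq_addr.
have pk q : prime q -> q ^ logn q 'C(k.*2, k) <= k.*2.
  move=> qP; apply: leq_trans (trunc_logP (prime_gt1 qP) (_ : 0 < k.*2)); last by rewrite double_gt0.
  by rewrite leq_exp2l ?prime_gt1 // logn_bin_double.
have [/allP small|/allPn[q]] := boolP (all (fun q => q < X) (primes 'C(k.*2, k))); last first.
  rewrite mem_primes -leqNgt => /and3P[qP _ qd] Xq; exists q; split => //.
  by apply: leq_trans (pk q qP); rewrite -{1}(expn1 q) leq_exp2l ?prime_gt1 // logn_gt0 mem_primes qP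
    c0.
suff : 'C(k.*2, k) <= k.*2 ^ X.
  by move=> /(leq_trans (leq_bin_double k)); rewrite leqNgt H.
rewrite {1}(prod_prime_decomp c0) prime_decompE big_map /=.
apply: (@leq_trans (\prod_(q <- primes 'C(k.*2, k)) k.*2)).
  rewrite big_seq [leqRHS]big_seq; apply: leq_prod => q.
  by rewrite mem_primes => /and3P[qP _ _]; apply: pk.
rewrite big_const_seq count_predT iter_muln_1; apply: leq_pexp2l; first by rewrite double_gt0.
rewrite -[X in _ <= X](size_iota 0); apply: uniq_leq_size; first exact: primes_uniq.
by move=> q /small; rewrite mem_iota add0n.
Qed.

(** * The parameters and the inequalities between them *)

Lemma modulus_exists n : exists p, [&& prime p, 2 < p & n <= p ^ 2].
Proof.
have [p np p_pr] := prime_above (n + 2); exists p; rewrite p_pr /=; nia.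
Qed.

(** Minimality lets any prime supplied by Chebyshev's argument bound it from above, and makes it the
    value found by trial division in increasing order. *)
Definition modulus n := ex_minn (modulus_exists n).
(** Write [b = trunc_log 2 n]. Then [d = 2 ^ delta n] exceeds [b ^ 8], which beats the loss [b ^ 7]
    in [room_for_swap]. The 32 in [blocks] gives [d ^ (2K) <= 2 ^ (b / 16)]. *)
Definition delta n := 8 * (trunc_log 2 (trunc_log 2 n)).+1.
Definition blocks n := trunc_log 2 n %/ (32 * delta n).
Definition reads_log n := (5 * trunc_log 2 n) %/ 8.

Lemma modulusP n : [/\ prime (modulus n), 2 < modulus n & n <= modulus n ^ 2].
Proof. by rewrite /modulus; case: ex_minnP => p /and3P[]. Qed.

Lemma modulus_min n p : prime p -> 2 < p -> n <= p ^ 2 -> modulus n <= p.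
Proof. by move=> p_pr p2 np; rewrite /modulus; case: ex_minnP => q _; apply; apply/and3P. Qed.

Lemma linear_exp m : 14 <= m -> 1000 * m.+1 <= 2 ^ m.
Proof.
move=> m14; rewrite -(subnKC m14); elim: (m - 14) => [|k IH]; first by rewrite addn0; lia.
by rewrite addnS expnS; lia.
Qed.

Section Large.
Variables n t : nat.
Let b := trunc_log 2 n.
Let lb := trunc_log 2 b.
Hypothesis (t22 : 22 <= t) (n_large : 2 ^ (2 ^ t) <= n).

Let d := 2 ^ delta n.
Let K := blocks n.
Let r := reads_log n.
Let s := 2 ^ r.
Let p := modulus n.
Let h := n %/ K.
Let l := h %/ K.

Lemma n_gt0 : 0 < n.
Proof. by apply: leq_trans n_large; rewrite expn_gt0. Qed.

Lemma n_bounds : 2 ^ b <= n < 2 ^ b.+1.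
Proof. by apply: trunc_log_bounds => //; exact: n_gt0. Qed.

Lemma b_large : 2 ^ t <= b.
Proof. exact: trunc_log_max. Qed.

Lemma b_bounds : 2 ^ lb <= b < 2 ^ lb.+1.
Proof. by apply: trunc_log_bounds => //; apply: leq_trans b_large; rewrite expn_gt0. Qed.

Lemma lb_b : 1000 * lb.+1 <= b.
Proof.
have [bl _] := andP b_bounds; apply: leq_trans bl; apply: linear_exp.
apply: (@leq_trans 22) => //; apply: (leq_trans t22).
exact: trunc_log_max b_large.
Qed.

Lemma b_lt_n m : m <= b -> 2 ^ m <= n.
Proof. by move=> mb; have [bn _] := andP n_bounds; apply: leq_trans bn; rewrite leq_exp2l. Qed.

Lemma modulus_le : p ^ 2 <= 256 * (n * b ^ 2).
Proof.
have [bn nb] := andP n_bounds; have [bl lbb] := andP b_bounds; have lbb' := lb_b.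
(* [X ^ 2] lies between [n] and [4n]. In [k = X * 2 ^ lb.+2] the second factor exceeds [2b], hence
   also the binary logarithm of [2k], as [prime_between] requires. *)
set X := 2 ^ b./2.+1; have X0 : 0 < X by rewrite expn_gt0.
have XE : X ^ 2 = 2 ^ (b./2.+1).*2 by rewrite -expnM muln2.
have nX : n <= X ^ 2.
  by rewrite ltnW // (leq_trans nb) // XE leq_exp2l // doubleS; lia.
have Xn : X ^ 2 <= 4 * n.
  rewrite XE; apply: (@leq_trans (2 ^ b.+2)); first by rewrite leq_exp2l // doubleS; lia.
  by rewrite !expnS; lia.
have k0 : 0 < X * 2 ^ lb.+2 by rewrite muln_gt0 X0 expn_gt0.
have [|q [q_pr Xq qk]] := @prime_between X (X * 2 ^ lb.+2) k0.
  have -> : (X * 2 ^ lb.+2).*2 = 2 ^ (b./2.+1 + lb.+2 + 1) by rewrite !expnD muln2.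
  by rewrite -expnM ltn_exp2l // (mulnC X) ltn_pmul2r // expnS; lia.
have pq : p <= q.
  apply: modulus_min => //; last by apply: leq_trans nX _; rewrite leq_exp2r.
  by apply: leq_trans Xq; apply: (@leq_trans (2 ^ 2)) => //; rewrite leq_exp2l //; lia.
have {}qk : q <= 8 * (X * b).
  apply: leq_trans qk _; rewrite 2!expnS -muln2.
  by have := leq_mul (leqnn X) bl; set y := 2 ^ lb; lia.
apply: (@leq_trans ((8 * (X * b)) ^ 2)); first by rewrite leq_exp2r // (leq_trans pq).
rewrite !expnMn; have := leq_mul Xn (leqnn (b ^ 2)).
by move: (X ^ 2) (b ^ 2) => x y; lia.
Qed.

Lemma blocks_delta : 32 * (K * delta n) <= b.
Proof. by rewrite mulnA (mulnC 32) -mulnA leq_divM. Qed.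

Lemma blocks_gt1 : 1 < K.
Proof.
by have lbb := lb_b; rewrite /K /blocks leq_divRL ?muln_gt0 // /delta -/b -/lb; lia.
Qed.

Lemma blocks_le : K <= b.
Proof. exact: leq_div. Qed.

Lemma b_pow : b ^ 2 <= 2 ^ (lb.*2.+2).
Proof.
have [_ lbb] := andP b_bounds; apply: (@leq_trans ((2 ^ lb.+1) ^ 2)).
  by rewrite leq_exp2r // ltnW.
by rewrite -expnM leq_exp2l //; lia.
Qed.

Lemma reads_blocks : s * K <= n.
Proof.
have lbb := lb_b; have [_ bl] := andP b_bounds.
apply: (@leq_trans (2 ^ r * 2 ^ lb.+1)); first by rewrite leq_mul // (leq_trans blocks_le) // ltnW.
rewrite -expnD; apply: b_lt_n; rewrite /r /reads_log -/b.
have := leq_divM (5 * b) 8; lia.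
Qed.

Lemma sqr_blocks : K ^ 2 <= n.
Proof.
have lbb := lb_b; apply: leq_trans (b_lt_n (_ : lb.*2.+2 <= b)); last by lia.
by apply: leq_trans b_pow; rewrite leq_exp2r // blocks_le.
Qed.

Lemma sqr_modulus : p ^ 2 <= n ^ 2.
Proof.
apply: leq_trans modulus_le _; have lbb := lb_b; have bp := b_pow.
have : 256 * b ^ 2 <= n.
  apply: (@leq_trans (2 ^ (8 + lb.*2.+2))); first by rewrite expnD; apply: leq_mul.
  by apply: b_lt_n; lia.
by move: (b ^ 2) => y yn; rewrite -mulnn mulnCA leq_mul.
Qed.

Lemma blocks_h : [/\ K * h <= n, n < K.+1 * h & K <= h].
Proof.
have K1 := blocks_gt1; have K0 : 0 < K by exact: ltnW.
have Kh : K <= h by rewrite leq_divRL //; exact: sqr_blocks.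
split=> //; first by rewrite mulnC leq_divM.
have := divn_eq n K; have := ltn_pmod n K0; rewrite -/h; nia.
Qed.

Lemma blocks_l : [/\ K * l <= h, l.*2 <= h & n <= 2 * K ^ 2 * l].
Proof.
have K1 := blocks_gt1; have [_ _ Kh] := blocks_h.
have Kl : K * l <= h by rewrite mulnC leq_divM.
have l0 : 0 < l by rewrite divn_gt0 // ltnW.
split=> //; first by nia.
have : n < K ^ 2 * l.+1; last by nia.
have E : l = n %/ K ^ 2 by rewrite /l /h -divnMA.
by rewrite E mulnC -ltn_divLR // expn_gt0 ltnW.
Qed.

Lemma base_le : d ^ 2 <= p.
Proof.
have [_ _ np] := modulusP n; have lbb := lb_b.
rewrite -leq_sqr; apply: leq_trans np; rewrite /d -!expnM; apply: b_lt_n.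
by rewrite /delta -/b -/lb; lia.
Qed.

(** This lets [lam] and all [2K] digits fit into one residue modulo [s]: up to powers of [b] the
    left side is at most [n ^ (1/2 + 1/16)], against [n ^ (5/8)]. The comparison is made between
    squares because the available bound is on [p ^ 2]. *)
Lemma messages_le : p * d ^ K.*2 <= s.
Proof.
have lbb := lb_b; have bp := b_pow; have [bn nb] := andP n_bounds.
rewrite -leq_sqr expnMn; apply: (@leq_trans (256 * (n * b ^ 2) * (d ^ K.*2) ^ 2)).
  by rewrite leq_mul2r modulus_le orbT.
have bd := blocks_delta; rewrite /d; move: (delta n) bd => D bd; rewrite /s -!expnM.
apply: (@leq_trans (2 ^ (8 + (b.+1 + lb.*2.+2) + D * (K.*2 * 2)))).
  rewrite !expnD; apply: leq_mul => //; apply: leq_mul => //; apply: leq_mul => //; exact: ltnW.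
rewrite leq_exp2l // /r /reads_log -/b.
have -> : D * (K.*2 * 2) = 4 * (K * D) by lia.
lia.
Qed.

Lemma reads_le : s <= n.
Proof. by have := reads_blocks; have := blocks_gt1; nia. Qed.

(** After division by [d * l], the right side counts the seeds of the prescribed parity, [2 * p ^ 5]
    bounds those missing one of the [2K] sets, and more than [s ^ 2] have to remain. Each summand on
    the left is at most half of the right side. *)
Lemma room_for_swap : s ^ 2 * (d * l) + K.*2 * (2 * p ^ 5) < (n - n %% s)./2 * p * (d * l).
Proof.
have lbb := lb_b; have [bn nb] := andP n_bounds; have [_ _ np] := modulusP n.
have [_ p2 _] := modulusP n; have K1 := blocks_gt1; have sn := reads_blocks; have pn := modulus_le.
have [Kl _ nl] := blocks_l; have b22 := b_large; have n0 := n_gt0.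
have s0 : 0 < s by rewrite expn_gt0.
have N1 : n <= 4 * (n - n %% s)./2.
  have s2 : 2 * s <= n by nia.
  have := ltn_pmod n s0; lia.
set M := (n - n %% s)./2 in N1 *.
(* The constant is [2 ^ 22], which accounts for the 22 in [22 <= t]. The two factors 256 come from
   squaring the bound on [p ^ 2]. *)
have d_big : 64 * (256 * 256) * b ^ 7 < d.
  have b22' : 64 * (256 * 256) <= b.
    apply: leq_trans b22; rewrite -[64]/(2 ^ 6) -[256]/(2 ^ 8) -!expnD.
    by rewrite leq_exp2l.
  have [_ bl] := andP b_bounds; rewrite /d /delta -/b -/lb [8 * _]mulnC expnM.
  apply: (@leq_ltn_trans (b ^ 8)); first exact: (leq_mul b22' (leqnn (b ^ 7))).
  by rewrite ltn_exp2r.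
(* Compared after squaring: [p ^ 2 >= n], so [4 r <= 5 b / 2] stands against an exponent [3 b]. *)
have s_small : 2 * s ^ 2 <= M * p.
  suff : 8 * s ^ 2 <= n * p.
    by have := leq_mul N1 (leqnn p); move: (s ^ 2) => x; lia.
  rewrite -leq_sqr !expnMn; apply: (@leq_trans (2 ^ (6 + (r * 2 + r * 2)))).
    by rewrite !expnD /s -!expnM; apply: leq_mul.
  apply: (@leq_trans (2 ^ (b + b + b))).
    rewrite leq_exp2l // /r /reads_log -/b; have := leq_divM (5 * b) 8; lia.
  by rewrite !expnD expnS expn1 !leq_mul // (leq_trans bn).
have p_small : 2 * (K.*2 * (2 * p ^ 5)) < M * p * (d * l).
  have -> : 2 * (K.*2 * (2 * p ^ 5)) = p * (8 * K * (p ^ 2) ^ 2).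
    by rewrite -expnM (expnS p 4); lia.
  have -> : M * p * (d * l) = p * (M * (d * l)) by rewrite (mulnC M) -mulnA.
  rewrite ltn_pmul2l; last by lia.
  have Kb := blocks_le.
  apply: (@leq_ltn_trans (8 * b * (256 * (n * b ^ 2)) ^ 2)); first by apply: leq_mul;
    [apply: leq_mul|rewrite leq_sqr].
  rewrite -(ltn_pmul2l (isT : 0 < 4)).
  apply: (@leq_trans (n * (d * l))); last by have := leq_mul N1 (leqnn (d * l)); rewrite -mulnA.
  have {}nl : n <= 2 * b ^ 2 * l.
    apply: leq_trans nl _; apply: leq_mul => //.
    by apply: leq_mul => //; rewrite leq_sqr.
  have b0 : 0 < 2 * b ^ 2 by rewrite muln_gt0 expn_gt0 (leq_trans _ b22) // expn_gt0.
  rewrite -(ltn_pmul2l b0); apply: (@leq_trans (n * d * n)); last first.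
    by apply: (@leq_trans (n * d * (2 * b ^ 2 * l))); [rewrite leq_mul|lia].
  have -> : 2 * b ^ 2 * (4 * (8 * b * (256 * (n * b ^ 2)) ^ 2)) =
      n * n * (64 * (256 * 256) * b ^ 7).
    by rewrite -!mulnn !expnSr expn0; lia.
  by rewrite (mulnAC n d) ltn_pmul2l // muln_gt0 n0.
have : 2 * (s ^ 2 * (d * l)) <= M * p * (d * l) by rewrite mulnA leq_mul.
move: p_small; move: (s ^ 2 * _) (K.*2 * _) (M * p * _) => x y z; clear; lia.
Qed.

(** 512 is 32 times 8, from [blocks] and [delta], times 2 for [K + 1 <= 2K]. *)
Lemma block_size : h * b <= 512 * (n * lb.+1).
Proof.
have [Kh _ _] := blocks_h; have K1 := blocks_gt1.
have : b < K.+1 * (32 * delta n) by rewrite -ltn_divLR // muln_gt0.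
rewrite /delta -/b -/lb => bK.
have bK' : b <= 512 * (K * lb.+1) by nia.
by apply: leq_trans (leq_mul (leqnn h) bK') _; nia.
Qed.
End Large.

(** * Sampling by arithmetic progressions in a plane over a finite field *)

Section Sampler.
Import Order.TTheory GRing.Theory Num.Theory.
Local Open Scope ring_scope.
Variables (F : finFieldType) (A : {set F * F}).
Local Notation p := (#|F|%:R : rat).
Local Notation mA := (#|A|%:R : rat).

Definition ind (u : F * F) : rat := (u \in A)%:R.

(** For fixed [lam] an arithmetic progression in [k]. Over varying [lam] its directions
    [(lam, lam ^ 2)] form a parabola. *)
Definition curve (y : F * F) (k lam : F) : F * F := (y.1 + k * lam, y.2 + k * lam ^+ 2).

Lemma p_gt0 : 0 < p.
Proof. by rewrite ltr0n; apply/card_gt0P; exists 0. Qed.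

Lemma sum_ind : \sum_u ind u = mA.
Proof.
rewrite -sumr_const [RHS]big_mkcond /=.
by apply: eq_bigr => u _; rewrite /ind; case: (u \in A).
Qed.

Lemma ind_idem u : ind u * ind u = ind u.
Proof. by rewrite /ind; case: (u \in A); rewrite ?mul1r ?mul0r. Qed.

Lemma curve_bij k lam : bijective (fun y => curve y k lam).
Proof.
exists (fun y => (y.1 - k * lam, y.2 - k * lam ^+ 2)) => [[y1 y2]|[y1 y2]];
by rewrite /curve /= ?addrK ?subrK.
Qed.

Lemma sum_curve (f : F * F -> rat) k lam : \sum_y f (curve y k lam) = \sum_y f y.
Proof. by rewrite [RHS](reindex _ (onW_bij _ (curve_bij k lam))). Qed.

Definition hits k z : rat := \sum_lam ind (curve z k lam).

Lemma sum_hits k : \sum_z hits k z = p * mA.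
Proof.
rewrite /hits exchange_big /= (eq_bigr (fun=> mA)) => [|lam _].
  by rewrite sumr_const mulr_natl.
by rewrite (sum_curve ind) sum_ind.
Qed.

(* For distinct w, w' at most one pair (lam, lam') has
   w' = w + k (lam' - lam, lam' ^ 2 - lam ^ 2). *)
Lemma sum_hits_sqr k : (2%:R : F) != 0 -> k != 0 -> \sum_z hits k z ^+ 2 <= p * mA + mA ^+ 2.
Proof.
move=> two k0.
have -> : \sum_z hits k z ^+ 2 =
    \sum_w ind w * \sum_(l : F * F) ind (w.1 + k * (l.2 - l.1), w.2 + k * (l.2 ^+ 2 - l.1 ^+ 2)).
  transitivity (\sum_z \sum_(l : F * F) ind (curve z k l.1) * ind (curve z k l.2)).
    apply: eq_bigr => z _; rewrite expr2 /hits big_distrl /=.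
    rewrite -(pair_bigA _ (fun l1 l2 => ind (curve z k l1) * ind (curve z k l2))) /=.
    by apply: eq_bigr => l _; rewrite big_distrr.
  rewrite exchange_big /=.
  under [in RHS]eq_bigr do rewrite big_distrr /=.
  rewrite [RHS]exchange_big /=; apply: eq_bigr => l _.
  rewrite -[RHS](sum_curve _ k l.1); apply: eq_bigr => z _; congr (_ * ind _).
  by rewrite /curve /=; congr (_, _); ring.
rewrite -sum_ind expr2 !big_distrr /= -big_split /=; apply: ler_sum => w _.
rewrite mulrC -mulrDl; apply: ler_wpM2r; first by rewrite ler0n.
rewrite (bigID (fun l : F * F => l.1 == l.2)) /=; apply: lerD.
  apply: (@le_trans _ _ (\sum_(l : F * F | l.1 == l.2) 1)).
    by apply: ler_sum => l _; rewrite lern1 leq_b1.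
  rewrite sumr_const ler_nat.
  rewrite -(card_codom (f := fun x : F => (x, x))); last by move=> x y [].
  apply/subset_leq_card/subsetP => -[x y]; rewrite unfold_in /= => /eqP ->.
  exact: codom_f.
pose f (l : F * F) := (w.1 + k * (l.2 - l.1), w.2 + k * (l.2 ^+ 2 - l.1 ^+ 2)).
(* Since [b - a] is not 0, it determines [b + a] together with [b ^ 2 - a ^ 2]; this gives [2 b],
   and [b] because 2 is invertible. *)
have f_inj : {in [pred l : F * F | l.1 != l.2] &, injective f}.
  move=> [a b] [c e]; rewrite !inE /= => ab ce [/addrI /(mulfI k0) E1 /addrI /(mulfI k0)].
  rewrite !subr_sqr E1 => /mulfI; rewrite subr_eq0 eq_sym => /(_ ce) E2.
  have Eb : b = e.
    by apply: (mulfI two); transitivity ((b - a) + (b + a)); [ring|rewrite E1 E2; ring].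
  by move: E1; rewrite Eb => /addrI/oppr_inj ->.
apply: (@le_trans _ _ (\sum_(l : F * F | l.1 != l.2) ind (f l))).
  by apply: ler_sum => l _.
rewrite (eq_bigr (fun l => \sum_u (f l == u)%:R * ind u)) => [|l _]; last first.
  rewrite (bigD1 (f l)) //= eqxx mul1r big1 ?addr0 // => u; rewrite eq_sym => /negbTE ->.
  by rewrite mul0r.
rewrite exchange_big /=; apply: ler_sum => u _; rewrite -mulr_suml.
rewrite -[leRHS]mul1r ler_wpM2r ?ler0n // -natr_sum lern1.
have [l0 /andP[l0n /eqP l0u]|none] := pickP (fun l : F * F => (l.1 != l.2) && (f l == u)); last first.
  by rewrite big1 // => l l12; move: (none l); rewrite l12 /= => ->.
rewrite (bigD1 l0) //= l0u eqxx big1 // => l /andP[l12 ll0]; apply/eqP; rewrite eqb0.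
apply: contra ll0 => /eqP lu; apply/eqP/f_inj; rewrite ?inE //; congruence.
Qed.

(** The left side counts the pairs of points of [A] that differ by some [k (lam, lam ^ 2)]; the
    first term on the right is the expected number. The number of hits has mean [c = mA / p], and
    its squared deviations add up to at most [p * mA]. A weighted inequality of arithmetic and
    geometric means replaces Cauchy-Schwarz, so that no square root leaves the rationals. *)
Lemma sum_hits_in k (th : rat) : (2%:R : F) != 0 -> k != 0 -> 0 < th ->
  \sum_z ind z * hits k z <= mA ^+ 2 / p + (p * mA / th + th * mA) / 2%:R.
Proof.
move=> two k0 th0; pose c := mA / p.
have p0 := p_gt0; have pn0 : p != 0 by rewrite gt_eqF.
(* The difference of the two sides is [(g - c - th * ind z) ^ 2 / (2 th)], because [ind z] is
   idempotent. *)
have key z : ind z * hits k z <=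
    c * ind z + ((hits k z ^+ 2 - 2%:R * c * hits k z + c ^+ 2) / th + th * ind z) / 2%:R.
  set g := hits k z; rewrite -subr_ge0.
  have -> : c * ind z + ((g ^+ 2 - 2%:R * c * g + c ^+ 2) / th + th * ind z) / 2%:R - ind z * g
     = ((g - c - th * ind z) ^+ 2 + th ^+ 2 * (ind z - ind z * ind z)) / (2%:R * th).
    by field; rewrite gt_eqF.
  by rewrite ind_idem subrr mulr0 addr0 divr_ge0 ?sqr_ge0 // mulr_ge0 ?ler0n // ltW.
apply: le_trans (ler_sum _ (fun z _ => key z)) _.
rewrite big_split /= -mulr_sumr sum_ind -mulr_suml big_split /= -mulr_suml -mulr_sumr sum_ind.
rewrite big_split /= sumrB -mulr_sumr sum_hits sumr_const card_prod -[_ ^+ 2 *+ _]mulr_natl natrM.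
rewrite /c expr2 mulrAC lerD2l // ler_pM2r ?invr_gt0 ?ltr0n // lerD2r ler_pM2r ?invr_gt0 //.
have := sum_hits_sqr two k0; set Q := \sum_z _ => HQ.
have -> : 2%:R * (mA / p) * (p * mA) = 2%:R * mA ^+ 2 by field.
have -> : p * p * (mA / p) ^+ 2 = mA ^+ 2 by field.
by rewrite mulr_natl mulr2n opprD !addrA subrK lerBlDr.
Qed.

Definition missed (J : {set F}) :=
  [set yl : (F * F) * F | [forall j in J, curve yl.1 j yl.2 \notin A]].

(** Chebyshev's inequality for the number [Z] of hits among the indices in [J]. Its mean is
    [m = |J| |A| / p ^ 2], and on [missed] it deviates by the whole mean. The squared deviations add
    up to at most [2 |J| p |A|]: one half comes from equal indices, the other from the error terms
    of distinct ones. *)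
Lemma card_missed (J : {set F}) : (2%:R : F) != 0 -> (0 < #|J|)%N -> (#|J| ^ 2 <= #|F|)%N ->
  (#|missed J| * (#|J| * #|A|) <= 2 * #|F| ^ 5)%N.
Proof.
move=> two J0 Jp; have [A0|A0] := posnP #|A|; first by rewrite A0 !muln0.
have p0 := p_gt0; have pn0 : p != 0 by rewrite gt_eqF.
set dd := (#|J|%:R : rat); have d0 : 0 < dd by rewrite ltr0n.
have a0 : 0 < mA by rewrite ltr0n.
have d2p : dd ^+ 2 <= p by rewrite -natrX ler_nat.
(* With the weight [p / |J|] and [|J| ^ 2 <= p] the error is at most [p |A| / |J|], so the [|J| ^ 2]
   pairs of indices together cost no more than the diagonal. *)
have hit k : k != 0 -> \sum_z ind z * hits k z <= mA ^+ 2 / p + p * mA / dd.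
  move=> k0; apply: le_trans (sum_hits_in two k0 (_ : 0 < p / dd)) _; first by rewrite divr_gt0.
  rewrite lerD2l -subr_ge0.
  have -> : p * mA / dd - (p * mA / (p / dd) + p / dd * mA) / 2%:R = mA * (p - dd ^+ 2) / (2%:R * dd).
    by field; rewrite pn0 gt_eqF.
  by rewrite divr_ge0 ?mulr_ge0 ?ler0n ?subr_ge0 // ltW.
pose Z (yl : (F * F) * F) := \sum_(j in J) ind (curve yl.1 j yl.2).
pose m := dd * mA / p ^+ 2.
have m0 : 0 < m by rewrite divr_gt0 ?exprn_gt0 ?mulr_gt0.
have sZ : \sum_yl Z yl = dd * (p * mA).
  rewrite /Z exchange_big /= (eq_bigr (fun=> p * mA)) => [|j _].
    by rewrite sumr_const -[LHS]mulr_natl.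
  rewrite -(pair_bigA _ (fun y l => ind (curve y j l))) /= exchange_big /=.
  rewrite (eq_bigr (fun=> mA)) => [|l _]; first by rewrite sumr_const mulr_natl.
  by rewrite (sum_curve ind) sum_ind.
have sZ2 : \sum_yl Z yl ^+ 2 <= dd * (p * mA) + dd ^+ 2 * (mA ^+ 2 / p + p * mA / dd).
  have -> : \sum_yl Z yl ^+ 2 = \sum_(j in J) \sum_(j' in J) \sum_z ind z * hits (j' - j) z.
    rewrite (eq_bigr (fun yl => \sum_(j in J) \sum_(j' in J)
       ind (curve yl.1 j yl.2) * ind (curve yl.1 j' yl.2))); last first.
      move=> yl _; rewrite expr2 {1}/Z big_distrl /=.
      by apply: eq_bigr => j _; rewrite big_distrr.
    rewrite exchange_big /=; apply: eq_bigr => j _.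
    rewrite exchange_big /=; apply: eq_bigr => j' _.
    rewrite -(pair_bigA _ (fun y l => ind (curve y j l) * ind (curve y j' l))) /= exchange_big /=.
    under [RHS]eq_bigr do rewrite big_distrr /=.
    rewrite [RHS]exchange_big /=; apply: eq_bigr => l _.
    rewrite -[RHS](sum_curve _ j l); apply: eq_bigr => y _; congr (_ * ind _).
    by rewrite /curve /=; congr (_, _); ring.
  have -> : dd * (p * mA) + dd ^+ 2 * (mA ^+ 2 / p + p * mA / dd) =
      \sum_(j in J) (p * mA + \sum_(j' in J) (mA ^+ 2 / p + p * mA / dd)).
    by rewrite !sumr_const -[RHS]mulr_natl -[_ *+ #|J|]mulr_natl -/dd; ring.
  apply: ler_sum => j jJ; rewrite (bigD1 j) //= subrr; apply: lerD.
    rewrite -(sum_hits 0); apply: ler_sum => z _; rewrite -[leRHS]mul1r ler_wpM2r //.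
      by apply: sumr_ge0 => l _; rewrite ler0n.
    by rewrite lern1 leq_b1.
  rewrite [leRHS](bigD1 j) //= -[leLHS]add0r lerD //.
    by rewrite addr_ge0 ?divr_ge0 ?mulr_ge0 ?exprn_ge0 ?ler0n.
  by apply: ler_sum => j' /andP[_ jj']; apply: hit; rewrite subr_eq0.
have var : #|missed J|%:R * m ^+ 2 <= \sum_yl (Z yl - m) ^+ 2.
  rewrite mulr_natl -sumr_const big_mkcond /=; apply: ler_sum => yl _.
  case: ifP => [|_]; last exact: sqr_ge0.
  rewrite inE => /forall_inP none; rewrite /Z big1 ?sub0r ?sqrrN // => j jJ.
  by rewrite /ind (negbTE (none j jJ)).
have EV : \sum_yl (Z yl - m) ^+ 2 = \sum_yl Z yl ^+ 2 - 2%:R * m * (dd * (p * mA)) + p ^+ 3 * m ^+ 2.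
  rewrite -sZ mulr_sumr -sumrB.
  have -> : p ^+ 3 * m ^+ 2 = \sum_(yl : (F * F) * F) m ^+ 2.
    by rewrite sumr_const -[RHS]mulr_natl !card_prod !natrM; ring.
  by rewrite -big_split /=; apply: eq_bigr => yl _; ring.
move: var; rewrite EV => var.
have : #|missed J|%:R * m ^+ 2 <= 2%:R * dd * p * mA.
  apply: le_trans var _.
  apply: (@le_trans _ _ (dd * (p * mA) + dd ^+ 2 * (mA ^+ 2 / p + p * mA / dd)
      - 2%:R * m * (dd * (p * mA)) + p ^+ 3 * m ^+ 2)); first by rewrite !lerD2r.
  rewrite le_eqVlt; apply/orP; left; apply/eqP; rewrite /m; field.
  by rewrite pn0 gt_eqF.
move=> fin; rewrite -(ler_nat rat) 3!natrM natrX -/dd.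
have -> : #|missed J|%:R * (dd * mA) = #|missed J|%:R * m ^+ 2 * (p ^+ 4 / (dd * mA)).
  by rewrite /m; field; rewrite pn0 !gt_eqF.
apply: le_trans (ler_wpM2r _ fin) _; first by rewrite divr_ge0 ?mulr_ge0 ?exprn_ge0 ?ler0n.
by rewrite le_eqVlt; apply/orP; left; apply/eqP; field; rewrite !gt_eqF.
Qed.
End Sampler.

(** * Cutting long cycles *)

Section Orbits.
Variable T : finType.
Implicit Types (f g : T -> T) (S : {set T}).

Lemma order_le_closed f S x : {in S, forall z, f z \in S} -> x \in S -> fingraph.order f x <= #|S|.
Proof.
move=> fS xS; apply/subset_leq_card/subsetP => y.
rewrite unfold_in /= => /iter_findex <-; elim: (findex f x y) => //= m; exact: fS.
Qed.

(** An injective map that sends a finite set into itself permutes it, so no outside point can be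
    mapped into it. *)
Lemma setC_closed f S : injective f -> {in S, forall z, f z \in S} ->
  {in ~: S, forall z, f z \in ~: S}.
Proof.
move=> f_inj fS z; rewrite !inE; apply: contra => fzS.
have E : f @: S = S.
  by apply/eqP; rewrite eqEcard card_imset // leqnn andbT; apply/subsetP => _ /imsetP[y /fS yS ->].
by move: fzS; rewrite -{1}E => /imsetP[y yS /f_inj ->].
Qed.

(** The union of the cycles of [f] through [u] and [v] is closed under [g], and all other cycles are
    unchanged. *)
Lemma order_transpose f g u v B : injective f -> (forall z, fingraph.order f z <= B) ->
  g u = f v -> g v = f u -> (forall z, z != u -> z != v -> g z = f z) ->
  forall z, fingraph.order g z <= B.*2.
Proof.
move=> f_inj fB gu gv gz z.
pose S w := [set y | fconnect f w y].
have cS w : #|S w| = fingraph.order f w by rewrite cardsE.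
have fS w : {in S w, forall y, f y \in S w}.
  by move=> y; rewrite !inE => /connect_trans; apply; exact: fconnect1.
case: (boolP (z \in S u :|: S v)) => zuv.
  apply: (@leq_trans #|S u :|: S v|); last first.
    by rewrite -addnn (leq_trans (leq_card_setU _ _)) // !cS leq_add.
  apply: order_le_closed zuv => y yS.
  have [->|yu] := eqVneq y u; first by rewrite gu inE orbC fS // inE connect0.
  have [->|yv] := eqVneq y v; first by rewrite gv inE fS // inE connect0.
  by rewrite gz //; case/setUP: yS => /fS yS; rewrite inE yS ?orbT.
apply: (@leq_trans #|S z|); last by rewrite cS (leq_trans (fB z)) // -addnn leq_addr.
apply: order_le_closed; last by rewrite inE connect0.
move=> y yS; have sym := fconnect_sym f_inj.
have ne w : z \notin S w -> y != w.
  rewrite inE sym; apply: contraNneq => <-; by move: yS; rewrite inE.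
by move: zuv; rewrite inE negb_or => /andP[/ne yu /ne yv]; rewrite gz // fS.
Qed.
End Orbits.

Definition swp (x y z : nat) := if z == x then y else if z == y then x else z.

Lemma swp_same x z : swp x x z = z.
Proof. by rewrite /swp; case: eqP. Qed.

Lemma swp_inj x y : injective (swp x y).
Proof. by apply: (can_inj (g := swp x y)) => z; rewrite /swp; do ![case: eqP => //=;
  try congruence]. Qed.

Definition swaps K (px py : nat -> nat) z := foldl (fun z q => swp (px q) (py q) z) z (iota 0 K).

Lemma swaps_inj K px py : injective (swaps K px py).
Proof.
rewrite /swaps; elim: (iota 0 K) => [|q s IH] //= z z' /IH; exact: swp_inj.
Qed.

(* [pos] numbers the drawers so that every cycle of [sg] occupies consecutive positions, in
   the order of the cycle, [e] is its inverse, and [cs z] is the first position of the cycle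
   of [z]. *)
Record cycle_order n (sg pos cs e : nat -> nat) : Prop := CycleOrder {
  pos_lt : forall z, z < n -> pos z < n;
  posK : forall z, z < n -> e (pos z) = z;
  e_lt : forall i, i < n -> e i < n;
  eK : forall i, i < n -> pos (e i) = i;
  sg_lt : forall z, z < n -> sg z < n;
  cs_sg : forall z, z < n -> cs (sg z) = cs z;
  pos_sg : forall z, z < n -> pos (sg z) = (pos z).+1 \/
    pos (sg z) = cs z /\ forall v, v < n -> cs v = cs z -> pos v <= pos z;
  cs_between : forall u v, u < n -> v < n -> cs v <= pos u -> pos u <= pos v -> cs u = cs v;
  cs_pos : forall z, z < n -> cs z <= pos z
}.

(** Block [q] consists of the positions from [q * h] to [q * h + h.-1]. As every cycle occupies an
    interval of positions, equal starts at the two ends mean that the block lies inside one cycle.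
    In the other case [x == y] makes the exchange trivial. *)
Definition cut_ok n h l (pos cs e : nat -> nat) q x y :=
  if cs (e (q * h)) == cs (e (q * h + h.-1)) then
    [&& x < n, y < n, pos x %/ h == q, pos x %% h < l, pos y %/ h == q & h - l <= pos y %% h]
  else x == y.

Section Cuts.
Variables (n h l K : nat) (sg pos cs e px py : nat -> nat).
Hypothesis (ord : cycle_order n sg pos cs e).
Hypothesis (sg_inj : forall y z, y < n -> z < n -> sg y = sg z -> y = z).
Hypothesis (h0 : 0 < h) (hl : l.*2 <= h) (Kn : K * h <= n) (nK : n < K.+1 * h).
Hypothesis ok : forall q, q < K -> cut_ok n h l pos cs e q (px q) (py q).

Let pi := swaps K px py.
Let inner q := (q < K) && (cs (e (q * h)) == cs (e (q * h + h.-1))).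

Lemma pos_inj y z : y < n -> z < n -> pos y = pos z -> y = z.
Proof. by move=> yn zn E; rewrite -(posK ord yn) E (posK ord zn). Qed.

Lemma cut_inner q : inner q -> [/\ px q < n, py q < n, pos (px q) %/ h = q, pos (py q) %/ h = q &
   pos (px q) %% h < l /\ h - l <= pos (py q) %% h].
Proof.
by case/andP=> qK cq; move: (ok qK); rewrite /cut_ok cq =>
  /and5P[? ? /eqP ? ? /andP[/eqP ? ?]].
Qed.

Lemma cut_outer q : q < K -> ~~ inner q -> px q = py q.
Proof. by rewrite /inner => qK; rewrite qK /= => nq; move: (ok qK); rewrite /cut_ok (negbTE nq) =>
  /eqP. Qed.

(** The two points of a nontrivial cut lie in its own block, so the transpositions are disjoint and
    a drawer can only be moved by that of its own block. *)
Lemma swaps_block z : z < n -> pi z = if inner (pos z %/ h)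
  then swp (px (pos z %/ h)) (py (pos z %/ h)) z else z.
Proof.
move=> zn; set q0 := pos z %/ h.
have step q y : q < K -> y < n -> pos y %/ h = q0 -> q != q0 -> swp (px q) (py q) y = y.
  move=> qK yn yq qq0; case: (boolP (inner q)) => [/cut_inner[xn yn' xq yq' _]|/(cut_outer qK)->].
    rewrite /swp; case: eqP => [E|_]; first by rewrite -xq -E yq eqxx in qq0.
    by case: eqP => [E|_] //; rewrite -yq' -E yq eqxx in qq0.
  by rewrite swp_same.
have fold s y : all (fun q => q < K) s -> uniq s -> y < n -> pos y %/ h = q0 ->
    foldl (fun z q => swp (px q) (py q) z) y s =
    if (q0 \in s) && inner q0 then swp (px q0) (py q0) y else y.
  elim: s y => //= q s IH y /andP[qK sK] /andP[qs us] yn yq.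
  rewrite inE; have [E|qq0] := eqVneq q q0; last first.
    by rewrite step // IH //.
  rewrite /= E; rewrite E in qs qK; case: (boolP (inner q0)) => /= [i0|/(cut_outer qK)->]; last first.
    by rewrite swp_same IH // (negbTE qs).
  have [xn yn' xq yq' _] := cut_inner i0.
  rewrite IH // ?(negbTE qs) //; rewrite /swp; do 2?[case: ifP => //].
rewrite /pi /swaps fold //; first by rewrite mem_iota /= add0n /inner; case: (q0 < K).
  by apply/allP => q; rewrite mem_iota add0n.
exact: iota_uniq.
Qed.

Lemma swaps_lt z : z < n -> pi z < n.
Proof.
move=> zn; rewrite swaps_block //; case: ifP => // /cut_inner[xn yn _ _ _].
by rewrite /swp; do 2?[case: ifP].
Qed.

Lemma inner_cs q v w : inner q -> v < n -> w < n ->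
  pos v %/ h = q -> pos w %/ h = q -> cs v = cs w.
Proof.
case/andP=> qK /eqP cq vn wn vq wq.
have n1 : q * h < n by nia.
have n2 : q * h + h.-1 < n by nia.
have e1 := e_lt ord n1; have e2 := e_lt ord n2.
have p1 := eK ord n1; have p2 := eK ord n2.
have le0 := cs_pos ord e1.
suff key u : u < n -> pos u %/ h = q -> cs u = cs (e (q * h + h.-1)) by rewrite !key.
move=> un uq; apply: (cs_between ord) => //; rewrite ?p2.
  by rewrite -cq; apply: leq_trans le0 _; rewrite p1 -uq leq_divM.
by rewrite {1}(divn_eq (pos u) h) uq leq_add2l -ltnS prednK // ltn_pmod.
Qed.

Let g z := sg (pi z).

(** [g] sends [x] to the successor of [y] and [y] to the successor of [x], so the part cut off
    contains [y] but not [x]. *)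
Definition piece q := fun z => (pos (px q) < pos z) && (pos z <= pos (py q)).

Lemma piece_block q z : inner q -> z < n -> piece q z -> pos z %/ h = q.
Proof.
move=> /cut_inner[xn yn xq yq _] zn /andP[xz zy].
apply/eqP; rewrite eqn_leq -{1}yq -{2}xq !leq_div2r //; exact: ltnW.
Qed.

Lemma pos_sg_lt y z : y < n -> z < n -> cs y = cs z -> pos y < pos z -> pos (sg y) = (pos y).+1.
Proof.
move=> yn zn cyz yz; case: (pos_sg ord yn) => // -[_ /(_ z zn)].
by rewrite cyz leqNgt yz => /(_ erefl).
Qed.

Lemma piece_lt q : inner q -> pos (px q) < pos (py q).
Proof.
move=> /cut_inner[xn yn xq yq [xl yl]].
rewrite (divn_eq (pos (px q)) h) (divn_eq (pos (py q)) h) xq yq ltn_add2l.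
apply: leq_trans xl (leq_trans _ yl); lia.
Qed.

Lemma piece_closed q z : inner q -> z < n -> piece q z -> piece q (g z).
Proof.
move=> iq zn zp; have zq := piece_block iq zn zp; have [xn yn xq yq [xl yl]] := cut_inner iq.
have xy := piece_lt iq.
rewrite /g swaps_block // zq iq /swp; case: eqP => [E|_].
  by move: zp; rewrite /piece E ltnn.
case: eqP => [E|/eqP zy].
  by rewrite /piece (pos_sg_lt xn yn) // ?ltnSn ?xy //; apply: inner_cs iq _ _ _ _.
case/andP: zp => xz; rewrite leq_eqVlt => /orP[/eqP/(pos_inj zn yn) E|zly];
  first by rewrite E eqxx in zy.
rewrite /piece (pos_sg_lt zn yn) //; last exact: inner_cs iq _ _ _ _.
by rewrite zly ltnW // ltnS.
Qed.

Lemma cs_swaps z : z < n -> cs (g z) = cs z.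
Proof.
move=> zn; rewrite /g (cs_sg ord) ?swaps_lt // swaps_block //; case: ifP => // iq.
move: iq; set q := _ %/ _ => iq.
have [xn yn xq yq _] := cut_inner iq; have xy := inner_cs iq xn yn xq yq.
by rewrite /swp; case: eqP => [->|_]; [|case: eqP => [->|_]].
Qed.

(** Inside a block that is cut, a remaining drawer stands at or before [x] or after [y], hence in
    one of the margins of length [l]. A block that is not cut but meets the cycle contains the start
    [c0] or the last drawer [pe]. *)
Lemma rest_positions c0 pe v : v < n -> pe < n -> cs v = c0 -> cs pe = c0 ->
  (forall u, u < n -> cs u = c0 -> pos u <= pos pe) ->
  (forall q, inner q -> ~~ piece q v) ->
  pos v \in iota (c0 %/ h * h) h ++ iota (pos pe %/ h * h) h ++
     [seq q * h + r | q <- iota 0 K, r <- iota 0 l] ++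
     [seq q * h + (h - l + r) | q <- iota 0 K, r <- iota 0 l].
Proof.
move=> vn pn cv cp pmax notin; set q := pos v %/ h.
have vm : pos v %% h < h by rewrite ltn_pmod.
have vE := divn_eq (pos v) h; rewrite -/q in vE.
have blk i : i %/ h = q -> pos v \in iota (i %/ h * h) h.
  by move=> ->; rewrite mem_iota; apply/andP; lia.
rewrite !mem_cat; case: (boolP (inner q)) => [iq|].
  have [xn yn xq yq [xl yl]] := cut_inner iq; have qK : q < K by case/andP: iq.
  have xE := divn_eq (pos (px q)) h; have yE := divn_eq (pos (py q)) h; rewrite xq in xE;
    rewrite yq in yE.
  have ym : pos (py q) %% h < h by rewrite ltn_pmod.
  have := notin q iq; rewrite /piece negb_and -leqNgt -ltnNge => /orP[vx|yv].
    apply/or4P/Or43/allpairsP; exists (q, pos v %% h); split=> //=; rewrite mem_iota /=; lia.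
  apply/or4P/Or44/allpairsP; exists (q, pos v %% h - (h - l)); split=> //=; rewrite ?mem_iota /=; lia.
have csv := cs_pos ord vn; have vp := pmax v vn cv.
have divE i : q * h <= i -> i < q * h + h -> i %/ h = q.
  by move=> qi iq; rewrite -(subnKC qi) divnMDl // divn_small ?addn0 // ltn_subLR.
(* Beyond the [K] blocks fewer than [h] positions remain, so [pe], which does not precede [v], lies
   in the same incomplete block. *)
case: (ltnP q K) => [qK|Kq _]; last first.
  apply/or4P/Or42/blk/divE; first by lia.
  by apply: leq_trans (pos_lt ord pn) _; nia.
rewrite /inner qK /= => ne.
have n1 : q * h < n by nia.
have n2 : q * h + h.-1 < n by nia.
have e1 := e_lt ord n1; have e2 := e_lt ord n2.
have p1 := eK ord n1; have p2 := eK ord n2.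
(* If the cycle begins at or before this block and its last drawer lay behind it, the whole block
   would be inside the cycle. *)
case: (leqP c0 (q * h)) => [c0q|qc0]; last by apply/or4P/Or41/blk/divE; lia.
apply/or4P/Or42/blk/divE; first by lia.
rewrite ltnNge; apply: contra ne => lt; apply/eqP.
rewrite (cs_between ord e1 pn) ?p1 ?cp //; last by lia.
by rewrite (cs_between ord e2 pn) ?p2 ?cp //; lia.
Qed.

(** An orbit inside a piece has at most [h] elements. Any other orbit stays in its old cycle and
    outside all pieces, which leaves two blocks at the ends of the cycle and [2K] margins of length
    [l], at most [2h + 2Kl <= 4h] positions. *)
Lemma order_cuts (f : 'I_n -> 'I_n) z : (forall y, val (f y) = g y) ->
  injective f -> K * l <= h -> fingraph.order f z <= 4 * h.
Proof.
move=> fg f_inj Kl.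
case: (boolP [exists q : 'I_K, inner q && piece q z]) => [/existsP[q /andP[iq zq]]|].
  pose S := [set y : 'I_n | piece q y].
  apply: (@leq_trans #|S|).
    by apply: order_le_closed; rewrite ?inE // => y; rewrite !inE fg; apply: piece_closed.
  have [xn yn xq yq [xl yl]] := cut_inner iq.
  apply: (@leq_trans h); last by lia.
  rewrite cardE -(size_map (fun y : 'I_n => pos y)) -[X in _ <= X](size_iota (q * h)).
  apply: uniq_leq_size.
    by rewrite map_inj_in_uniq ?enum_uniq // => y y' _ _ /pos_inj /val_inj; apply.
  move=> _ /mapP[y + ->]; rewrite mem_enum inE => /(piece_block iq (ltn_ord y)) yb.
  have := divn_eq (pos y) h; have := ltn_pmod (pos y) h0; rewrite yb mem_iota; lia.
rewrite negb_exists => /forallP none.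
pose C := [set y : 'I_n | cs y == cs z].
pose P := [set y : 'I_n | [exists q : 'I_K, inner q && piece q y]].
have Pc : {in P, forall y, f y \in P}.
  move=> y; rewrite !inE => /existsP[q /andP[iq yq]]; apply/existsP; exists q.
  by rewrite iq fg piece_closed.
have Cc : {in C, forall y, f y \in C}.
  by move=> y; rewrite !inE fg cs_swaps.
apply: (@leq_trans #|C :&: ~: P|).
  apply: order_le_closed => [y|].
    by move=> /setIP[yC yP]; apply/setIP; split; [apply: Cc|apply: (setC_closed f_inj Pc)].
  by rewrite !inE eqxx; apply/existsP => -[q]; rewrite (negbTE (none q)).
have zC : z \in C by rewrite inE.
case: (@arg_maxnP _ z (mem C) (fun y : 'I_n => pos y) zC) => pe /=; rewrite !inE => /eqP peC pmax.
pose L := iota (cs z %/ h * h) h ++ iota (pos pe %/ h * h) h ++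
     [seq q * h + r | q <- iota 0 K, r <- iota 0 l] ++
     [seq q * h + (h - l + r) | q <- iota 0 K, r <- iota 0 l].
have sL : size L <= 4 * h by rewrite !size_cat !size_allpairs !size_iota; lia.
apply: leq_trans sL; rewrite cardE -(size_map (fun y : 'I_n => pos y)); apply: uniq_leq_size.
  by rewrite map_inj_in_uniq ?enum_uniq // => y y' _ _ /pos_inj /val_inj; apply.
move=> _ /mapP[v + ->]; rewrite mem_enum !inE => /andP[/eqP vC vP].
apply: rest_positions => // [u un uz|q iq].
  by apply: (pmax (Ordinal un)); rewrite inE uz.
apply: contra vP => qv; apply/existsP; have [qK _] := andP iq.
by exists (Ordinal qK); rewrite iq.
Qed.
End Cuts.

(** * Encoding a message by one swap *)

Section SwapCode.
Import Order.TTheory GRing.Theory Num.Theory.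

Definition msg1 s N1 (c : nat -> nat) := (\sum_(0 <= j < s) c j) %% N1.
Definition msg2 s (c : nat -> nat) := (\sum_(0 <= j < s) j * c j) %% s.

(** The message after exchanging drawers [a < s <= b], computed from the old sums in constant time.
    The subtraction comes last: what is removed is a summand of the old sum, so it is never
    truncated. *)
Definition swapped1 s N1 c a b := (\sum_(0 <= j < s) c j + c b - c a) %% N1.
Definition swapped2 s c a b := (\sum_(0 <= j < s) j * c j + a * c b - a * c a) %% s.

Lemma sum_swapped s w (c : nat -> nat) a b : a < s -> s <= b ->
  \sum_(0 <= j < s) w j * c (swp a b j) = \sum_(0 <= j < s) w j * c j + w a * c b - w a * c a.
Proof.
move=> As sb; rewrite !big_mkord (bigD1 (Ordinal As)) //= [in RHS](bigD1 (Ordinal As)) //=.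
rewrite {1}/swp eqxx -[in RHS]addnA addKn [RHS]addnC; congr (_ + _).
by apply: eq_bigr => j /eqP/val_eqP /= ja;
  rewrite /swp (negbTE ja) (ltn_eqF (leq_trans (ltn_ord j) sb)).
Qed.

Lemma int_modn m x y : x %% m = y %% m -> exists k : int, (x%:Z - y%:Z = k * m%:Z)%R.
Proof.
move=> E; exists ((x %/ m)%:Z - (y %/ m)%:Z)%R.
rewrite {1}(divn_eq x m) {1}(divn_eq y m) E !PoszD !PoszM; ring.
Qed.

(** Put [delta = c b - c a]. Equality of the first components modulo [N1], hence modulo [s], and of
    the second components gives [s %| (a - a') * delta]. As [delta] is odd and [s] is a power of
    two, [a = a']. Then [c b] and [c b'] agree modulo [N1], and both are smaller than [N1]. *)
Lemma swapped_inj r N1 c a a' b b' : let s := 2 ^ r in s %| N1 -> a < s -> a' < s ->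
  c b < N1 -> c b' < N1 -> odd (c b) != odd (c a) ->
  swapped1 s N1 c a b = swapped1 s N1 c a' b' -> swapped2 s c a b = swapped2 s c a' b' ->
  a = a' /\ c b = c b'.
Proof.
move=> s /dvdnP[m Em] As As' bN bN' par.
have le1 i : i < s -> c i <= \sum_(0 <= j < s) c j.
  by move=> i_s; rewrite big_mkord (bigD1 (Ordinal i_s)) //= leq_addr.
have le2 i : i < s -> i * c i <= \sum_(0 <= j < s) j * c j.
  by move=> i_s; rewrite big_mkord (bigD1 (Ordinal i_s)) //= leq_addr.
move=> E0; have /int_modn[k1 E1] := E0; move=> /int_modn[k2 E2].
have := le1 _ As; have := le1 _ As'; have := le2 _ As; have := le2 _ As'.
move: E1 E2; set S1 := \sum_(_ <= j < _) c j; set S2 := \sum_(_ <= j < _) j * c j.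
move=> E1 E2 h1 h2 h3 h4.
have {}E1 : ((c b)%:Z - (c a)%:Z = (c b')%:Z - (c a')%:Z + k1 * m%:Z * s%:Z)%R by rewrite -mulrA
  -PoszM -Em -E1; lia.
have {}E2 : (a%:Z * (c b)%:Z - a%:Z * (c a)%:Z = a'%:Z * (c b')%:Z - a'%:Z * (c a')%:Z + k2 * s%:Z)%R.
  by rewrite -E2 -!PoszM; lia.
have dv : (s%:Z %| ((a%:Z - a'%:Z) * ((c b)%:Z - (c a)%:Z))%R)%Z.
  apply/dvdzP; exists (k2 - a'%:Z * k1 * m%:Z)%R.
  rewrite mulrBl [X in (_ - _ * X)%R]E1 mulrBr E2; ring.
have cop : coprimez s%:Z ((c b)%:Z - (c a)%:Z)%R.
  rewrite coprimezE absz_nat /s; case: (r) => [|r']; first by rewrite coprime1n.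
  rewrite coprime_pexpl // coprime2n.
  by move: par; lia.
move: dv; rewrite Gauss_dvdzl // => dv.
have aa : a = a'.
  move: dv; rewrite /dvdz absz_nat => dv; apply/eqP; apply: contraTT dv => aa.
  by apply: contraL (aa) => /dvdn_leq; lia.
split=> //; move: E0; rewrite -aa /swapped1 -!(addnBAC _ h4) => /eqP.
by rewrite eqn_modDl !modn_small // => /eqP.
Qed.
End SwapCode.

(** * Decoding a message into cut points *)

Section Decoding.
Import Order.TTheory GRing.Theory Num.Theory.

(** The number [x * p + y] stands for the point [(x, y)] of the plane; this is the number of the
    point [u + i (lam, lam ^ 2)]. It may be [n] or more and then names no drawer, which [cut_ok]
    rules out for a nontrivial cut. *)
Definition point p m1 lam i :=
  ((m1 %/ p + i * lam) %% p) * p + (m1 %% p + i * lam * lam) %% p.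
Definition digit d m k := (m %/ d ^ k) %% d.
Definition left_cut p d m1 m2 q := point p m1 (m2 %% p) (digit d (m2 %/ p) q.*2).
Definition right_cut p d m1 m2 q := point p m1 (m2 %% p) (digit d (m2 %/ p) q.*2.+1).

Lemma digits_exist d (f : nat -> nat) k : (forall i, f i < d) ->
  exists2 m, m < d ^ k & forall i, i < k -> digit d m i = f i.
Proof.
elim: k f => [|k IH] f fd; first by exists 0.
have [m mk md] := IH (fun i => f i.+1) (fun i => fd i.+1); have := fd 0 => f0.
exists (f 0 + d * m) => [|[|i] ik]; first by rewrite expnS; nia.
  by rewrite /digit expn0 divn1 addnC mulnC modnMDl modn_small.
have d0 : 0 < d by apply: leq_ltn_trans f0.
by rewrite /digit expnS divnMA addnC mulnC divnMDl // (divn_small f0) addn0 -/(digit d m i) md.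
Qed.

Section Missed.
Variables (p d l N1 : nat) (P : pred nat) (f : 'I_l -> nat).
Hypothesis (p_pr : prime p) (p2 : 2 < p) (d0 : 0 < d) (dp : d ^ 2 <= p) (N1p : N1 <= p ^ 2).
Hypothesis (f_inj : injective f) (fP : forall r, P (f r)) (fp : forall r, f r < p ^ 2).

Definition hit (u : 'I_N1 * 'I_p) := [exists i : 'I_d, P (point p u.1 u.2 i)].

(** Transfer of [card_missed] to numbers. The values of [f] give at least [l] points of [A], the
    indices below [d <= p] are distinct in the field, and the seeds with first component below
    [N1 <= p ^ 2] embed into all pairs of a point and a slope. *)
Lemma card_unhit : #|[set u | ~~ hit u]| * (d * l) <= 2 * p ^ 5.
Proof.
have pF := card_Fp p_pr; have p0 := prime_gt0 p_pr.
pose A : {set 'F_p * 'F_p} := [set u : 'F_p * 'F_p | P (u.1 * p + u.2)].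
pose J : {set 'F_p} := [set (val i)%:R%R | i : 'I_d].
have natF_inj a b : a < p -> b < p -> (a%:R = b%:R :> 'F_p)%R -> a = b.
  by move=> ap bp /(congr1 val) /=; rewrite !val_Fp_nat // !modn_small.
have dp' : d <= p by nia.
have cJ : #|J| = d.
  rewrite card_imset ?card_ord // => i j /natF_inj E; apply/val_inj/E; exact: leq_trans (ltn_ord _) dp'.
have cA : l <= #|A|.
  pose g (r : 'I_l) : 'F_p * 'F_p := ((f r %/ p)%:R, (f r %% p)%:R)%R.
  have gv r : (g r).1 = f r %/ p :> nat /\ (g r).2 = f r %% p :> nat.
    by rewrite /= !val_Fp_nat // modn_mod modn_small // ltn_divLR // -expnSr.
  rewrite -{1}(card_ord l) -(card_codom (f := g)); last first.
    move=> r r' E; apply: f_inj; rewrite (divn_eq (f r) p) (divn_eq (f r') p).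
    by have [<- <-] := gv r; have [<- <-] := gv r'; rewrite E.
  apply/subset_leq_card/subsetP => _ /codomP[r ->].
  by rewrite inE; have [-> ->] := gv r; rewrite -divn_eq.
have two : (2%:R != 0 :> 'F_p)%R.
  by apply/negP => /eqP/(natF_inj 2 0 p2 p0).
have := @card_missed _ A J two; rewrite pF cJ => /(_ d0 dp) miss.
suff : #|[set u | ~~ hit u]| <= #|missed A J| by move=> le; apply: leq_trans miss; rewrite !leq_mul.
pose g (u : 'I_N1 * 'I_p) : ('F_p * 'F_p) * 'F_p :=
  (((u.1 %/ p)%:R, (u.1 %% p)%:R), (val u.2)%:R)%R.
have divp (m : 'I_N1) : m %/ p < p by rewrite ltn_divLR // (leq_trans (ltn_ord m)) //.
rewrite -(card_imset _ (f := g)); last first.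
  move=> [m a] [m' a'] [/natF_inj E1 /natF_inj E2 /natF_inj E3]; congr (_, _); apply/val_inj => /=.
    by rewrite (divn_eq m p) E1 // E2 ?ltn_pmod // -divn_eq.
  by apply: E3.
apply/subset_leq_card/subsetP => _ /imsetP[[m a] + ->]; rewrite !inE.
move=> nh; apply/forall_inP => _ /imsetP[i _ ->]; apply: contra nh.
have -> : curve (g (m, a)).1 (val i)%:R%R (g (m, a)).2 =
    ((m %/ p + i * a)%:R, (m %% p + i * a * a)%:R)%R.
  by rewrite /curve /g expr2 !natrD !natrM mulrA.
rewrite inE => hA; apply/existsP; exists i.
by move: hA; rewrite [(_, _).1]/= [(_, _).2]/= !val_Fp_nat.
Qed.
End Missed.
End Decoding.

Lemma card_parity N b : ~~ odd N -> #|[set m : 'I_N | odd m != b]| = N./2.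
Proof.
move=> evN; rewrite -sum1dep_card big_mkcond /= -(big_mkord xpredT (fun m =>
  if odd m != b then 1 else 0)).
rewrite -[in LHS](even_halfK evN); elim: N./2 => [|k IH]; first by rewrite big_geq.
by rewrite doubleS !big_nat_recr //= IH odd_double; case: b {IH} => /=; lia.
Qed.

(** * Counting: some swap produces a good message *)

Section ExistsSwap.
Variables (n p d r K h l : nat) (c cinv pos cs e : nat -> nat).
Let s := 2 ^ r.
Let N1 := n - n %% s.
Hypothesis (p_pr : prime p) (p2 : 2 < p) (d0 : 0 < d) (dp : d ^ 2 <= p) (np : n <= p ^ 2).
Hypothesis (r0 : 0 < r) (sn : s <= n) (Kn : K * h <= n) (lh : l <= h) (ps : p * d ^ K.*2 <= s).
Hypothesis room : s ^ 2 * (d * l) + K.*2 * (2 * p ^ 5) < N1./2 * p * (d * l).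
Hypothesis (ord : cycle_order n c pos cs e).
Hypothesis cinvP : forall v, v < n -> cinv v < n /\ c (cinv v) = v.

Let s0 : 0 < s. Proof. by rewrite expn_gt0. Qed.
Let sN1 : s %| N1. Proof. by rewrite /N1 {1}(divn_eq n s) addnK dvdn_mull. Qed.
Let N1n : N1 <= n. Proof. exact: leq_subr. Qed.
Let N1_gt0 : 0 < N1.
Proof. by rewrite subn_gt0; apply: leq_trans sn; rewrite ltn_pmod. Qed.
Let N1_even : ~~ odd N1.
Proof. by rewrite -dvdn2; apply: dvdn_trans sN1; rewrite /s -(prednK r0) expnS dvdn_mulr. Qed.

Let S1 := \sum_(0 <= j < s) c j.
(** [N1] is even, so an odd change of the sum flips the parity of its residue: the first component
    of every message counted below lies in [E]. *)
Let E := [set m : 'I_N1 | odd m != odd S1].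
Let cE : #|E| = N1./2. Proof. exact: card_parity. Qed.

Let lo q z := [&& z < n, pos z %/ h == q & pos z %% h < l].
Let hi q z := [&& z < n, pos z %/ h == q & h - l <= pos z %% h].

Let at_lo q (i : 'I_l) := e (q * h + i).
Let at_hi q (i : 'I_l) := e (q * h + (h - l + i)).

Let posE q i : q < K -> i < h ->
  [/\ e (q * h + i) < n, pos (e (q * h + i)) = q * h + i, (q * h + i) %/ h = q & (q * h + i) %% h = i].
Proof.
move=> qK ih; have lt : q * h + i < n by nia.
rewrite (e_lt ord lt) (eK ord lt) modnMDl divnMDl ?(leq_ltn_trans _ ih) //.
by rewrite divn_small // modn_small // addn0.
Qed.

Let e_inj q i j : q < K -> i < h -> j < h -> e (q * h + i) = e (q * h + j) -> i = j.
Proof.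
move=> qK ih jh /(congr1 pos); have [_ -> _ _] := posE qK ih; have [_ -> _ _] := posE qK jh.
exact: addnI.
Qed.

(** Good seeds, before the indices are chosen. A union bound over [2K] sets shows that they are
    many. *)
Let H := [set u : 'I_N1 * 'I_p | (u.1 \in E) &&
  [forall q : 'I_K, hit d (lo q) u && hit d (hi q) u]].

Let H_big : s ^ 2 < #|H|.
Proof.
have bound (q : 'I_K) : #|[set u : 'I_N1 * 'I_p | ~~ hit d (lo q) u]| * (d * l) <= 2 * p ^ 5 /\
    #|[set u : 'I_N1 * 'I_p | ~~ hit d (hi q) u]| * (d * l) <= 2 * p ^ 5.
  have lt (i : 'I_l) : i < h := leq_trans (ltn_ord i) lh.
  have lt' (i : 'I_l) : h - l + i < h by have := ltn_ord i; lia.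
  split; [apply: (card_unhit (f := at_lo q))|apply: (card_unhit (f := at_hi q))] => //.
  - exact: leq_trans N1n np.
  - by move=> i j /e_inj E0; apply/val_inj/E0.
  - by move=> i; rewrite /lo /at_lo; have [-> -> -> ->] := posE (ltn_ord q) (lt i); rewrite eqxx /=.
  - by move=> i; have [lt1 _ _ _] := posE (ltn_ord q) (lt i); apply: leq_trans np.
  - exact: leq_trans N1n np.
  - by move=> i j /e_inj E0; apply/val_inj/(@addnI (h - l))/E0.
  - by move=> i; rewrite /hi /at_hi; have [-> -> -> ->] := posE (ltn_ord q) (lt' i);
    rewrite eqxx leq_addr.
  - by move=> i; have [lt1 _ _ _] := posE (ltn_ord q) (lt' i); apply: leq_trans np.
have cover : #|setX E [set: 'I_p]| <= #|H| + \sum_(q < K)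
   (#|[set u : 'I_N1 * 'I_p | ~~ hit d (lo q) u]| + #|[set u : 'I_N1 * 'I_p | ~~ hit d (hi q) u]|).
  apply: (@leq_trans #|H :|: \bigcup_(q < K) ([set u : 'I_N1 * 'I_p | ~~ hit d (lo q) u] :|:
     [set u : 'I_N1 * 'I_p | ~~ hit d (hi q) u])|).
    apply/subset_leq_card/subsetP => -[m a]; rewrite in_setX in_setT andbT => mE;
      rewrite in_setU in_set mE /=.
    case: (boolP [forall q, _]) => //= /forallPn[q]; rewrite negb_and => nq.
    by apply/bigcupP; exists q => //; rewrite !inE.
  apply: leq_trans (leq_card_setU _ _) _; rewrite leq_add2l.
  apply: (big_ind2 (fun (A : {set 'I_N1 * 'I_p}) m => #|A| <= m)) => [|A a B b Aa Bb|q _].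
  - by rewrite cards0.
  - by apply: leq_trans (leq_card_setU _ _) _; apply: leq_add.
  - exact: leq_card_setU.
move: cover; rewrite cardsX cE cardsT card_ord.
set Sg := \sum_(q < K) _ => cover.
have : Sg * (d * l) <= K.*2 * (2 * p ^ 5).
  rewrite big_distrl /=; apply: (@leq_trans (\sum_(q < K) 2 * (2 * p ^ 5))).
    by apply: leq_sum => q _; have [b1 b2] := bound q; rewrite mulnDl [leqRHS]mul2n -addnn leq_add.
  by rewrite sum_nat_const card_ord mulnA muln2.
move=> Sgle; rewrite ltnNge; apply: contraL room => Hs; rewrite -leqNgt.
apply: leq_trans (leq_mul cover (leqnn _)) _; rewrite mulnDl leq_add //.
by rewrite leq_mul.
Qed.

Let G := [set u : 'I_N1 * 'I_s | (u.1 \in E) && [forall q : 'I_K,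
  cut_ok n h l pos cs e q (left_cut p d u.1 u.2 q) (right_cut p d u.1 u.2 q)]].

(** Every good seed is the image of a good message under the map [psi] that reduces the second
    component modulo [p]: the hitting indices are written as digits above [lam]. *)
Let G_big : s ^ 2 < #|G|.
Proof.
have p0 := prime_gt0 p_pr.
apply: leq_trans H_big _; pose psi (u : 'I_N1 * 'I_s) : 'I_N1 * 'I_p := (u.1, Ordinal (ltn_pmod u.2
  p0)).
apply: leq_trans (leq_imset_card psi _); apply/subset_leq_card/subsetP => -[m1 lam].
rewrite inE /= => /andP[mE /forallP hits].
pose ix (P : pred nat) := if [pick i : 'I_d | P (point p m1 lam i)] is Some i then val i else 0.
have ixP P : hit d P (m1, lam) -> P (point p m1 lam (ix P)).
  by move=> /existsP[i Pi]; rewrite /ix; case: pickP => //= /(_ i); rewrite Pi.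
have ixd P : ix P < d by rewrite /ix; case: pickP => //= i _.
(* A block that is not to be cut gets the digit 0 twice, so its two points coincide as [cut_ok]
   demands. *)
pose dig k := if cs (e (k./2 * h)) == cs (e (k./2 * h + h.-1)) then
  ix (if odd k then hi k./2 else lo k./2) else 0.
have [|m mK md] := @digits_exist d dig K.*2; first by move=> i; rewrite /dig; case: ifP.
have ms : lam + p * m < s.
  apply: leq_trans ps; have := ltn_ord lam; nia.
apply/imsetP; exists (m1, Ordinal ms); last first.
  by congr (_, _); apply/val_inj; rewrite /= addnC mulnC modnMDl modn_small.
rewrite inE /= mE; apply/forallP => q; rewrite /left_cut /right_cut /=.
have -> : (lam + p * m) %% p = lam by rewrite addnC mulnC modnMDl modn_small.
have -> : (lam + p * m) %/ p = m by rewrite addnC mulnC divnMDl // divn_small ?addn0.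
have qK := ltn_ord q.
rewrite !md; [|lia|lia]; rewrite /dig /= uphalf_double doubleK odd_double /cut_ok.
case: (cs _ == cs _); last by rewrite eqxx.
have /andP[/ixP /and3P[-> -> ->] /ixP /and3P[-> -> ->]] := hits q.
by [].
Qed.

Let par_swapped1 a b : a < s -> odd (c b) != odd (c a) ->
  odd (swapped1 s N1 c a b) != odd S1.
Proof.
move=> As par; have le1 : c a <= S1 by rewrite /S1 big_mkord (bigD1 (Ordinal As)) //= leq_addr.
rewrite /swapped1 -/S1; have /dvdnP[m Em] : 2 %| N1 by rewrite dvdn2.
have := divn_eq (S1 + c b - c a) N1; move: par le1; set x := _ %% N1; set y := _ %/ N1.
rewrite Em; move=> par le1 /(congr1 odd).
rewrite oddB ?(leq_trans le1) ?leq_addr // !oddD !oddM /= !andbF; move: par.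
by case: (odd (c a)); case: (odd (c b)); case: (odd S1); case: (odd x).
Qed.

Lemma exists_swap : exists a b, [/\ a < s, s <= b, b < n & forall q, q < K ->
  cut_ok n h l pos cs e q (left_cut p d (swapped1 s N1 c a b) (swapped2 s c a b) q)
    (right_cut p d (swapped1 s N1 c a b) (swapped2 s c a b) q)].
Proof.
(* A swap is described by [a] and the value [v] moved there; [v < N1] makes [v] recoverable from its
   residue. The pairs in [bad], where [v] already sits in one of the first [s] drawers, number at
   most [s ^ 2]. *)
pose D' := [set u : 'I_s * 'I_N1 | odd u.2 != odd (c u.1)].
pose bad := [set u : 'I_s * 'I_N1 | cinv u.2 < s].
have vn (v : 'I_N1) : v < n := leq_trans (ltn_ord v) N1n.
have cD' : #|D'| = s * N1./2.
  rewrite -sum1dep_card big_mkcond /= -(pair_bigA _ (fun (a : 'I_s) (v : 'I_N1) =>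
    if odd v != odd (c a) then 1 else 0)) /=.
  rewrite -[s in RHS]card_ord -sum_nat_const; apply: eq_bigr => a _.
  by rewrite -big_mkcond sum1dep_card card_parity.
have cbad : #|bad| <= s ^ 2.
  pose f (u : 'I_s * 'I_N1) : 'I_s * 'I_s := (u.1, insubd (Ordinal s0) (cinv u.2)).
  have f_inj : {in bad &, injective f}.
    move=> [a v] [a' v']; rewrite !inE /= => b1 b2 [-> /(congr1 val)]; rewrite !val_insubd b1 b2 => E0.
    congr (_, _); apply/val_inj; have [_ /= <-] := cinvP (vn v); have [_ /= <-] := cinvP (vn v').
    by rewrite E0.
  rewrite -(card_in_imset f_inj); apply: leq_trans (max_card _) _.
  by rewrite card_prod card_ord.
pose phi (u : 'I_s * 'I_N1) : 'I_N1 * 'I_s :=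
  (Ordinal (ltn_pmod (\sum_(0 <= j < s) c j + c (cinv u.2) - c u.1) N1_gt0),
   Ordinal (ltn_pmod (\sum_(0 <= j < s) j * c j + u.1 * c (cinv u.2) - u.1 * c u.1) s0)).
pose D := D' :\: bad.
have cD : s * N1./2 <= #|D| + s ^ 2.
  rewrite -cD' -(cardsID bad D') addnC leq_add2l.
  by apply: leq_trans cbad; apply/subset_leq_card/subsetIr.
have phi_inj : {in D &, injective phi}.
  move=> [a v] [a' v']; rewrite !inE /= => /andP[b1 p1] /andP[b2 p2'] [E1 E2].
  have [_ c1] := cinvP (vn v); have [_ c2] := cinvP (vn v').
  have [] := @swapped_inj r N1 c a a' (cinv v) (cinv v') sN1 (ltn_ord a) (ltn_ord a');
    rewrite ?c1 ?c2 //.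
  by move=> /val_inj -> /val_inj ->.
have sub : (phi @: D) :|: G \subset setX E [set: 'I_s].
  rewrite subUset; apply/andP; split; apply/subsetP => u; last first.
    by rewrite !inE /= => /andP[-> _].
  case/imsetP => -[a v]; rewrite !inE /= => /andP[_ par] ->; rewrite andbT /=.
  by apply: par_swapped1 => //=; have [_ ->] := cinvP (vn v).
(* Both sets lie in a set of size [s * N1./2]. The first misses at most [s ^ 2] of it and the second
   has more than [s ^ 2] elements. *)
have : 0 < #|(phi @: D) :&: G|.
  have := subset_leq_card sub; rewrite cardsX cE cardsT card_ord cardsU card_in_imset //.
  move: cD G_big; rewrite (mulnC s); have := subset_leq_card (subsetIl (phi @: D) G).
  lia.
case/card_gt0P => u /setIP[/imsetP[[a v] avD ->]]; rewrite inE => /andP[_ /forallP ok].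
have [b1 _] := cinvP (vn v).
exists a, (cinv v); split => //; first by move: avD; rewrite !inE /= -leqNgt => /andP[].
by move=> q qK; have := ok (Ordinal qK).
Qed.
End ExistsSwap.

(* [Defs.mem] is hidden by [ssrbool.mem]. *)
Import Defs.

(** * Total correctness of word RAM programs *)

(** Evaluation is split into the plain value and the bounds collected by [fits], so that overflow
    becomes a separate arithmetic goal. *)
Fixpoint value (s : state) (e : expr) : nat :=
  match e with
  | ENum k => k
  | EReg x => reg s x
  | EMem a => mem s (value s a)
  | EBin o e1 e2 => apply_op o (value s e1) (value s e2)
  end.

Fixpoint fits (W : nat) (s : state) (e : expr) : Prop :=
  match e with
  | ENum k => k < W
  | EReg x => reg s x < W
  | EMem a => fits W s a /\ mem s (value s a) < W
  | EBin o e1 e2 => [/\ fits W s e1, fits W s e2 & apply_op o (value s e1) (value s e2) < W]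
  end.

Definition keep (l : seq nat) (s s' : state) := forall x, x \notin l -> reg s' x = reg s x.

Section Run.
Variables (w W : nat) (dr : nat -> option nat).
Hypothesis W_le : W <= 2 ^ w.

Lemma fit_lt v : v < W -> fit w v = Some v.
Proof. by move=> vW; rewrite /fit (leq_trans vW). Qed.

Lemma eval_value s e : fits W s e -> eval w s e = Some (value s e).
Proof.
elim: e => [k|x|a IH|o e1 IH1 e2 IH2] /=; try exact: fit_lt.
  by case=> /IH -> /fit_lt.
by case=> /IH1 -> /IH2 -> /fit_lt.
Qed.

Definition hoare (c : com) (s : state) (T : nat) (ds : seq nat) (Q : state -> Prop) : Prop :=
  exists t s', [/\ exec w dr c s t ds s', t <= T & Q s'].

Lemma hoare_weaken c s T T' ds (Q Q' : state -> Prop) : hoare c s T ds Q -> T <= T' ->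
  (forall s', Q s' -> Q' s') -> hoare c s T' ds Q'.
Proof.
move=> [t [s' [ex tT q]]] TT QQ; exists t, s'; split=> //; last exact: QQ.
exact: leq_trans tT TT.
Qed.

Lemma hoare_skip s (Q : state -> Prop) : Q s -> hoare CSkip s 1 [::] Q.
Proof. by move=> q; exists 1, s; split=> //; constructor. Qed.

Lemma hoare_set x e s (Q : state -> Prop) : fits W s e -> Q (set_reg s x (value s e)) ->
  hoare (CSet x e) s (ecost e).+1 [::] Q.
Proof. by move=> /eval_value E q; exists (ecost e).+1, (set_reg s x (value s e)); split=> //;
  constructor. Qed.

Lemma hoare_store a e s (Q : state -> Prop) : fits W s a -> fits W s e ->
  Q (set_mem s (value s a) (value s e)) -> hoare (CStore a e) s (ecost a + ecost e).+1 [::] Q.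
Proof. by move=> /eval_value Ea /eval_value Ee q;
  exists (ecost a + ecost e).+1, (set_mem s (value s a) (value s e)); split=> //; constructor. Qed.

Lemma hoare_open x e s v (Q : state -> Prop) : fits W s e -> dr (value s e) = Some v ->
  Q (set_reg s x v) -> hoare (COpen x e) s (ecost e).+1 [:: value s e] Q.
Proof. by move=> /eval_value E dv q; exists (ecost e).+1, (set_reg s x v); split=> //; constructor. Qed.

Lemma hoare_seq c1 c2 s T1 T2 ds1 ds2 (Q1 Q2 : state -> Prop) : hoare c1 s T1 ds1 Q1 ->
  (forall s1, Q1 s1 -> hoare c2 s1 T2 ds2 Q2) -> hoare (CSeq c1 c2) s (T1 + T2).+1 (ds1 ++ ds2) Q2.
Proof.
move=> [t1 [s1 [ex1 tT1 q1]]] /(_ s1 q1) [t2 [s2 [ex2 tT2 q2]]].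
exists (t1 + t2).+1, s2; split=> //; first exact: ExSeq ex1 ex2.
by rewrite ltnS leq_add.
Qed.

Lemma hoare_seq0 c1 c2 s T1 T2 ds (Q1 Q2 : state -> Prop) : hoare c1 s T1 [::] Q1 ->
  (forall s1, Q1 s1 -> hoare c2 s1 T2 ds Q2) -> hoare (CSeq c1 c2) s (T1 + T2).+1 ds Q2.
Proof. exact: (@hoare_seq c1 c2 s T1 T2 [::] ds). Qed.

Lemma hoare_if e c1 c2 s T ds (Q : state -> Prop) : fits W s e ->
  hoare (if value s e != 0 then c1 else c2) s T ds Q -> hoare (CIf e c1 c2) s (ecost e + T).+1 ds Q.
Proof.
move=> /eval_value E [t [s' [ex tT q]]]; exists (ecost e + t).+1, s'; split=> //.
  exact: ExIf E ex.
by rewrite ltnS leq_add2l.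
Qed.

(** The number [m] of rounds is fixed in advance and the invariant is indexed by the round, so
    termination, running time and the drawers opened come out of one induction. *)
Lemma hoare_while e c s T m (D : nat -> seq nat) (I : nat -> state -> Prop) :
  I 0 s ->
  (forall k s1, k <= m -> I k s1 -> fits W s1 e /\ (value s1 e != 0) = (k < m)) ->
  (forall k s1, k < m -> I k s1 -> hoare c s1 T (D k) (I k.+1)) ->
  hoare (CWhile e c) s ((ecost e + T).+1 * m + (ecost e).+1) (flatten (mkseq D m)) (I m).
Proof.
move=> I0 test body.
suff key j k s1 : k + j = m -> I k s1 -> hoare (CWhile e c) s1 ((ecost e + T).+1 * j + (ecost e).+1)
    (flatten [seq D i | i <- iota k j]) (I m) by exact: key.
elim: j k s1 => [|j IH] k s1 kj Ik; have [|ft te] := test k s1 _ Ik; first by lia.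
- move/eval_value: ft te; rewrite -kj addn0 ltnn => E /negbFE/eqP z.
  rewrite z in E; exists (ecost e).+1, s1; split; [exact: ExWhileDone|lia|].
  by rewrite -[k in I k]addn0 kj in Ik *.
- lia.
move: te; have km : k < m by lia.
move/eval_value: ft; rewrite km => E nz.
have [t1 [s2 [ex1 tT1 q1]]] := body k s1 km Ik.
have [t2 [s3 [ex2 tT2 q2]]] := IH k.+1 s2 (etrans (addSnnS k j) kj) q1.
exists (ecost e + t1 + t2).+1, s3; split=> //; last by nia.
by case: (value s1 e) nz E => // v _ E; exact: ExWhileStep E ex1 ex2.
Qed.

Lemma hoare_while0 e c s T m (I : nat -> state -> Prop) :
  I 0 s ->
  (forall k s1, k <= m -> I k s1 -> fits W s1 e /\ (value s1 e != 0) = (k < m)) ->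
  (forall k s1, k < m -> I k s1 -> hoare c s1 T [::] (I k.+1)) ->
  hoare (CWhile e c) s ((ecost e + T).+1 * m + (ecost e).+1) [::] (I m).
Proof.
move=> I0 test body; have := hoare_while (D := fun=> [::]) I0 test body.
by rewrite (_ : flatten _ = [::]) // /mkseq; elim: (iota 0 m).
Qed.

(** The state after an assignment is kept as a term instead of a postcondition, so straight-line
    code is executed symbolically. *)
Lemma hoare_set_seq x e c s T ds (Q : state -> Prop) : fits W s e ->
  hoare c (set_reg s x (value s e)) T ds Q -> hoare (CSeq (CSet x e) c) s ((ecost e).+1 + T).+1 ds Q.
Proof. by move=> ft q; apply: hoare_seq0 (hoare_set ft (erefl _)) _ => _ <-. Qed.

Lemma hoare_store_seq a e c s T ds (Q : state -> Prop) : fits W s a -> fits W s e ->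
  hoare c (set_mem s (value s a) (value s e)) T ds Q ->
  hoare (CSeq (CStore a e) c) s ((ecost a + ecost e).+1 + T).+1 ds Q.
Proof. by move=> fa fe q; apply: hoare_seq0 (hoare_store fa fe (erefl _)) _ => _ <-. Qed.

Lemma hoare_open_seq x e v c s T ds (Q : state -> Prop) : fits W s e -> dr (value s e) = Some v ->
  hoare c (set_reg s x v) T ds Q -> hoare (CSeq (COpen x e) c) s ((ecost e).+1 + T).+1 (value s e ::
    ds) Q.
Proof. by move=> ft dv q; apply: (hoare_seq (ds1 := [:: _])) (hoare_open ft dv (erefl _)) _ =>
  _ <-. Qed.

End Run.
Arguments hoare_skip {w dr} [s Q].
Arguments hoare_set {w W dr} _ [x e s Q].
Arguments hoare_store {w W dr} _ [a e s Q].

Lemma keep_set l s s' x v : keep l s s' -> x \in l -> keep l s (set_reg s' x v).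
Proof.
move=> k xl y yl /=; rewrite /upd; case: eqP => [E|_]; last exact: k.
by rewrite E xl in yl.
Qed.

Lemma keep_trans l l' s s' s'' : all (fun x => x \in l') l ->
  keep l' s s' -> keep l s' s'' -> keep l' s s''.
Proof. by move=> /allP ll k k' x xl; rewrite k' ?k //; apply: contra xl => /ll. Qed.

(** * Computing the parameters *)

Declare Scope prog_scope.
Delimit Scope prog_scope with prog.
Notation "$ x" := (EReg x) (at level 8, x at level 0, format "$ x") : prog_scope.
Notation "# k" := (ENum k) (at level 8, k at level 0, format "# k") : prog_scope.
Notation "'M' [ a ]" := (EMem a) (at level 8, format "'M' [ a ]") : prog_scope.
Notation "a + b" := (EBin Add a b) : prog_scope.
Notation "a - b" := (EBin Sub a b) : prog_scope.
Notation "a * b" := (EBin Mul a b) : prog_scope.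
Notation "a / b" := (EBin Div a b) : prog_scope.
Notation "a 'mod' b" := (EBin Mod a b) (at level 40, left associativity) : prog_scope.
Notation "a == b" := (EBin Eq a b) : prog_scope.
Notation "a < b" := (EBin Lt a b) : prog_scope.
Notation "x ::= e" := (CSet x e) (at level 75) : prog_scope.
Notation "c ;; c'" := (CSeq c c') (at level 80, right associativity) : prog_scope.
Notation "'WHILE' e 'DO' c 'END'" := (CWhile e c) (at level 70, e at level 60) : prog_scope.
Notation "'IF' e 'THEN' c 'ELSE' c' 'END'" := (CIf e c c') (at level 70, e at level 60) : prog_scope.

Definition log_prog : com := (
  11 ::= #0 ;; 12 ::= #1 ;;
  WHILE ($10 < #2 * $12) == #0 DO 12 ::= #2 * $12 ;; 11 ::= $11 + #1 END)%prog.

Definition pow_prog : com := (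
  11 ::= #0 ;; 12 ::= #1 ;;
  WHILE $11 < $10 DO 12 ::= #2 * $12 ;; 11 ::= $11 + #1 END)%prog.

Ltac sim := rewrite /= ?/upd /=.

Section Params.
Variables (w W n : nat) (dr : nat -> option nat).
Hypothesis W_le : W <= 2 ^ w.
Hypothesis W_big : 200 * n.+1 ^ 3 <= W.

(** The largest intermediate values are of order [n ^ 3], such as [\sum j * c j] and
    [i * lam * lam]. This form of the bound is linear in the products that [lia] treats as atoms. *)
Lemma W_lin : 100 + 10 * n + 10 * (n * n) + 10 * (n * n * n) < W.
Proof. by apply: leq_trans W_big; rewrite !expnS expn0; clear; lia. Qed.

Lemma run_log s v : reg s 10 = v -> 0 < v <= n ->
  hoare w dr log_prog s (50 * n.+1) [::] (fun s' =>
    [/\ reg s' 11 = trunc_log 2 v, keep [:: 11; 12] s s' & mem s' = mem s]).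
Proof.
move=> s10 /andP[v0 vn]; have Wl := W_lin.
have [tl tr] := andP (trunc_log_bounds (isT : 1 < 2) v0).
pose I k s' := [/\ reg s' 11 = k, reg s' 12 = 2 ^ k, keep [:: 11; 12] s s' & mem s' = mem s].
have tn : trunc_log 2 v <= n by apply: leq_trans vn; apply: leq_trans tl; rewrite ltnW // ltn_expl.
apply: hoare_weaken.
  apply: (hoare_set_seq W_le); first by sim; lia.
  apply: (hoare_set_seq W_le); first by sim; lia.
  apply: (hoare_while0 W_le (m := trunc_log 2 v) (I := I)).
  - by split=> //; do 2?[apply: keep_set].
  - move=> k s1 km [a1 a2 a3 a4]; sim; rewrite a2 (a3 10) // s10.
    have le : 2 ^ k <= v by apply: leq_trans tl; rewrite leq_exp2l.
    split; first by repeat split; lia.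
    have [kt|tk] := ltnP k (trunc_log 2 v).
      by rewrite ltnNge -expnS (leq_trans _ tl) // leq_exp2l.
    have -> : k = trunc_log 2 v by lia.
    by rewrite -expnS tr.
  - move=> k s1 km [a1 a2 a3 a4].
    have le : 2 ^ k <= v by apply: leq_trans tl; rewrite leq_exp2l // ltnW.
    apply: (hoare_set_seq W_le); first by sim; repeat split; lia.
    apply: (hoare_set W_le); first by sim; repeat split; lia.
    by split; sim=> //; [lia|rewrite a2 expnS|do 2?[apply: keep_set]].
- by sim; lia.
- by move=> s' [a1 a2 a3 a4].
Qed.

Lemma run_pow s v : reg s 10 = v -> v <= n -> 2 ^ v <= n ->
  hoare w dr pow_prog s (50 * n.+1) [::] (fun s' =>
    [/\ reg s' 12 = 2 ^ v, keep [:: 11; 12] s s' & mem s' = mem s]).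
Proof.
move=> s10 vn pn; have Wl := W_lin.
pose I k s' := [/\ reg s' 11 = k, reg s' 12 = 2 ^ k, keep [:: 11; 12] s s' & mem s' = mem s].
apply: hoare_weaken.
  apply: (hoare_set_seq W_le); first by sim; lia.
  apply: (hoare_set_seq W_le); first by sim; lia.
  apply: (hoare_while0 W_le (m := v) (I := I)).
  - by split=> //; do 2?[apply: keep_set].
  - move=> k s1 km [a1 a2 a3 a4]; sim; rewrite a1 (a3 10) // s10.
    by split; [repeat split; lia|case: (k < v)].
  - move=> k s1 km [a1 a2 a3 a4].
    have le : 2 ^ k.+1 <= n by apply: leq_trans pn; rewrite leq_exp2l.
    rewrite expnS in le.
    apply: (hoare_set_seq W_le); first by sim; repeat split; lia.
    apply: (hoare_set W_le); first by sim; repeat split; lia.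
    by split; sim=> //; [lia|rewrite a2 expnS|do 2?[apply: keep_set]].
- by sim; lia.
- by move=> s' [a1 a2 a3 a4].
Qed.

(** Register 9 is the flag that the candidate in register 4 succeeds. The inner loop tries all
    smaller divisors without early exit, which is affordable because [modulus n <= n]. *)
Definition prime_prog : com := (
  4 ::= #2 ;; 9 ::= #0 ;;
  WHILE $9 == #0 DO
    4 ::= $4 + #1 ;; 9 ::= ($4 * $4 < $0) == #0 ;; 10 ::= #2 ;;
    WHILE $10 < $4 DO
      IF ($4 mod $10) == #0 THEN 9 ::= #0 ELSE CSkip END ;; 10 ::= $10 + #1
    END
  END)%prog.

Lemma prime_sieve m : 1 < m -> prime m = all (fun k => m %% k != 0) (iota 2 (m - 2)).
Proof.
move=> m1; apply/idP/allP => [m_pr k|all_m].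
  rewrite mem_iota => /andP[k1 km]; apply: contraTneq m_pr => mk; apply/primePn; right.
  by exists k; rewrite ?k1 /dvdn ?mk //=; lia.
apply/primeP; split=> // k km; have k0 : 0 < k by apply: dvdn_gt0 km; lia.
have kle : k <= m by apply: dvdn_leq km; lia.
apply: contraT; rewrite negb_or => /andP[k1 k2].
have /all_m : k \in iota 2 (m - 2) by rewrite mem_iota; lia.
by rewrite (eqP km).
Qed.

Lemma run_prime s : reg s 0 = n -> modulus n <= n ->
  hoare w dr prime_prog s (100 * (n.+1 * n.+1)) [::] (fun s' =>
    [/\ reg s' 4 = modulus n, keep [:: 4; 9; 10] s s' & mem s' = mem s]).
Proof.
move=> s0 pn; have Wl := W_lin; have [p_pr p2 np] := modulusP n.
pose I k s' := [/\ reg s' 4 = k + 2, reg s' 9 = (k + 2 == modulus n), keep [:: 4; 9;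
  10] s s' & mem s' = mem s].
pose J a k s' := [/\ reg s' 4 = a, reg s' 10 = k + 2,
  reg s' 9 = (n <= a * a) && all (fun k => a %% k != 0) (iota 2 k), keep [:: 4; 9;
    10] s s' & mem s' = mem s].
apply: hoare_weaken.
  apply: (hoare_set_seq W_le); first by sim; lia.
  apply: (hoare_set_seq W_le); first by sim; lia.
  apply: (hoare_while0 W_le (m := modulus n - 2) (I := I)).
  - by split=> //; [sim; case: eqP p2 => // <-|do 2?[apply: keep_set]].
  - move=> k s1 km [a1 a2 a3 a4]; sim; rewrite a2; split; first by repeat split; lia.
    by case: eqP; lia.
  - move=> k s1 km [a1 a2 a3 a4].
    have a_le : k.+1 + 2 <= modulus n by lia.
    have aa : (k.+1 + 2) * (k.+1 + 2) <= n * n by apply: leq_mul; lia.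
    have s1k : reg s1 4 + 1 = k.+1 + 2 by lia.
    apply: (hoare_set_seq W_le); first by sim; repeat split; lia.
    apply: (hoare_set_seq W_le).
      by sim; rewrite s1k (a3 0) // s0; repeat split; lia.
    apply: (hoare_set_seq W_le); first by sim; lia.
    sim; rewrite s1k (a3 0) // s0.
    apply: (hoare_weaken (T' := 60 * n.+1)).
      apply: (hoare_while0 W_le (m := k.+1) (I := J (k.+1 + 2))).
      + by split; sim=> //; [rewrite andbT; case: leqP|do 3?[apply: keep_set]].
      + move=> j s2 jm [b1 b2 b3 b4 b5]; sim; rewrite b1 b2; split; first by repeat split; lia.
        by case: leqP; lia.
      + move=> j s2 jm [b1 b2 b3 b4 b5].
        pose Q s' := [/\ reg s' 4 = k.+1 + 2, reg s' 10 = j + 2,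
          reg s' 9 = (n <= (k.+1 + 2) * (k.+1 + 2)) && all (fun i =>
            (k.+1 + 2) %% i != 0) (iota 2 j.+1),
          keep [:: 4; 9; 10] s s' & mem s' = mem s].
        apply: (hoare_seq0 (T1 := 20) (Q1 := Q)).
          have md : (k.+1 + 2) %% (j + 2) < k.+1 + 2 by apply: leq_trans (ltn_pmod _ _) _; lia.
          apply: hoare_weaken.
            apply: (hoare_if W_le (T := 5) (Q := Q)); first by sim; rewrite b1 b2; repeat split; lia.
            have E : all (fun i => (k.+1 + 2) %% i != 0) (iota 2 j.+1) =
               all (fun i => (k.+1 + 2) %% i != 0) (iota 2 j) && ((k.+1 + 2) %% (j + 2) != 0).
              by rewrite -[j.+1]addn1 iotaD all_cat /= andbT (addnC 2).
            sim; rewrite b1 b2; case Em: (_ %% (j + 2) == 0) => /=; last first.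
              apply: hoare_weaken; first by apply: hoare_skip; exact: erefl.
              - by [].
              - by move=> s3 <-; rewrite /Q E Em andbT.
            apply: hoare_weaken; first by apply: (hoare_set W_le); [sim; lia|exact: erefl].
            - by [].
            - by move=> s3 <-; rewrite /Q E Em !andbF; split; sim=> //; apply: keep_set.
          - by [].
          - by [].
        move=> s3 [c1 c2 c3 c4 c5]; apply: (hoare_set W_le); first by sim; repeat split; lia.
        by split; sim=> //; [lia|apply: keep_set].
    - by sim; lia.
    - move=> s2 [b1 b2 b3 b4 b5]; split=> //; rewrite b3 mulnn.
      congr (nat_of_bool _); have -> : iota 2 k.+1 = iota 2 (k.+1 + 2 - 2) by rewrite addnK.
      rewrite -prime_sieve; last by lia.
      (* A candidate not above [modulus n] that passes both tests equals it by minimality. *)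
      apply/idP/eqP => [/andP[na a_pr]|->]; last by rewrite np p_pr.
      by apply/eqP; rewrite eqn_leq a_le modulus_min //; lia.
- sim; nia.
- by move=> s' [a1 a2 a3 a4]; split=> //; lia.
Qed.

Variables t N : nat.
Hypothesis (t22 : 22 <= t) (tN : 2 ^ (2 ^ t) <= N) (N_lt : N < W).

(** Below the threshold [N] there are no blocks and no reads, so nothing is cut and a prisoner
    simply follows a cycle of the assignment. The moduli and bases 1 keep the decoding meaningful in
    that case. *)
Definition params_prog : com := (
  IF $0 < #N THEN
    2 ::= #0 ;; 3 ::= #0 ;; 4 ::= #1 ;; 5 ::= #1 ;; 6 ::= #0 ;; 7 ::= #0 ;; 8 ::= #1
  ELSE
    10 ::= $0 ;; log_prog ;; 13 ::= $11 ;;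
    10 ::= $13 ;; log_prog ;; 14 ::= #8 * ($11 + #1) ;; 2 ::= $13 / (#32 * $14) ;;
    10 ::= $14 ;; pow_prog ;; 5 ::= $12 ;;
    10 ::= (#5 * $13) / #8 ;; pow_prog ;; 3 ::= $12 ;;
    6 ::= $0 / $2 ;; 7 ::= $6 / $2 ;; 8 ::= $0 - $0 mod $3 ;; prime_prog
  END)%prog.

Definition num_blocks := if n < N then 0 else blocks n.
Definition num_reads := if n < N then 0 else 2 ^ reads_log n.
Definition field_size := if n < N then 1 else modulus n.
Definition digit_base := if n < N then 1 else 2 ^ delta n.
Definition block_len := if n < N then 0 else n %/ blocks n.
Definition side_len := if n < N then 0 else n %/ blocks n %/ blocks n.
Definition num_vals := if n < N then 1 else n - n %% 2 ^ reads_log n.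

Definition params_regs := [:: 2; 3; 4; 5; 6; 7; 8; 9; 10; 11; 12; 13; 14].

Definition has_params s := [/\ reg s 2 = num_blocks, reg s 3 = num_reads, reg s 4 = field_size,
  reg s 5 = digit_base & [/\ reg s 6 = block_len, reg s 7 = side_len & reg s 8 = num_vals]].

Lemma run_params s : reg s 0 = n ->
  hoare w dr params_prog s (1000 * (n.+1 * n.+1)) [::] (fun s' =>
    [/\ has_params s', keep params_regs s s' & mem s' = mem s]).
Proof.
move=> s0; have Wl := W_lin.
set Q := fun _ : state => _.
apply: (hoare_weaken (T := (ecost ($0 < #N)%prog + 900 * (n.+1 * n.+1)).+1) (Q := Q)); [|by sim;
  nia|by []].
apply: (hoare_if W_le); first by sim; rewrite s0; repeat split; lia.
rewrite /= s0; case nN : (n < N) => /=.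
  apply: (hoare_weaken (Q := Q)); do 6?[apply: (hoare_set_seq W_le); first by sim; lia]; last by [].
    apply: (hoare_set W_le); first by sim; lia.
    rewrite /Q /has_params /num_blocks /num_reads /field_size /digit_base /block_len /side_len
      /num_vals nN.
    by split; sim=> //; do 7?[apply: keep_set].
  by sim; nia.
have nl : 2 ^ (2 ^ t) <= n by apply: leq_trans tN _; rewrite leqNgt nN.
have n0 := n_gt0 nl; have lb := lb_b t22 nl; have [bn _] := andP (n_bounds nl).
have K1 := blocks_gt1 t22 nl; have dp := base_le t22 nl; have pn := sqr_modulus t22 nl.
have {}pn : modulus n <= n by rewrite leq_sqr in pn.
have sn := reads_le t22 nl.
have tb : trunc_log 2 n <= n by rewrite (leq_trans _ bn) // ltnW // ltn_expl.
have dn : 2 ^ delta n <= n by rewrite (leq_trans _ pn) // (leq_trans _ dp) // -mulnn leq_pmull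
  ?expn_gt0.
have dn' : delta n <= n by rewrite (leq_trans _ dn) // ltnW // ltn_expl.
apply: (hoare_weaken (Q := Q)); last by [].
  apply: (hoare_set_seq W_le); first by sim; rewrite s0; lia.
  sim; rewrite s0.
  apply: hoare_seq0; first by apply: (run_log (v := n)); rewrite ?n0 ?leqnn.
  move=> s1 [a1 a2 a3].
  set b := trunc_log 2 n in lb tb a1 *; set l := trunc_log 2 b in lb *.
  apply: (hoare_set_seq W_le); first by sim; rewrite a1; lia.
  apply: (hoare_set_seq W_le); first by sim; rewrite a1; lia.
  sim; rewrite a1.
  apply: hoare_seq0; first by apply: (run_log (v := b)); [|lia].
  move=> s2 [b1 b2 b3].
  have dE : delta n = 8 * (l + 1) by rewrite /delta addn1.
  apply: (hoare_set_seq W_le); first by sim; rewrite b1; repeat split; lia.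
  have E13 : reg s2 13 = b by rewrite b2.
  have KE : blocks n = b %/ (32 * delta n) by [].
  have Kb : blocks n <= b by rewrite KE leq_div.
  have lbE : 32 * delta n <= b by rewrite dE; lia.
  apply: (hoare_set_seq W_le); first by sim; rewrite b1 E13 -dE -KE; repeat split; lia.
  apply: (hoare_set_seq W_le); first by sim; rewrite b1 -dE; lia.
  sim; rewrite b1 E13 -dE -KE.
  apply: hoare_seq0; first by apply: (run_pow (v := delta n)).
  move=> s3 [c1 c2 c3].
  apply: (hoare_set_seq W_le); first by sim; rewrite c1; lia.
  have F13 : reg s3 13 = b by rewrite c2 // -E13.
  have rE : (5 * b) %/ 8 = reads_log n by [].
  have rb : reads_log n <= b by rewrite -rE; lia.
  have sn' : 2 ^ reads_log n <= n by [].
  apply: (hoare_set_seq W_le); first by sim; rewrite F13 rE; repeat split; lia.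
  sim; rewrite F13 rE c1.
  apply: hoare_seq0; first by apply: (run_pow (v := reads_log n)) => //; lia.
  move=> s4 [d1 d2 d3].
  apply: (hoare_set_seq W_le); first by sim; rewrite d1; lia.
  have G0 : reg s4 0 = n by rewrite d2 //; sim; rewrite c2 //; sim; rewrite b2 //; sim; rewrite a2.
  have G2 : reg s4 2 = blocks n by rewrite d2 //; sim; rewrite c2.
  have le1 : n %/ blocks n <= n by apply: leq_div.
  have le2 : n %/ blocks n %/ blocks n <= n by apply: leq_trans le1; apply: leq_div.
  have le3 : n %% 2 ^ reads_log n <= n by apply: leq_mod.
  apply: (hoare_set_seq W_le); first by sim; rewrite G0 G2; repeat split;
    clear -Wl le1 le2 le3 Kb tb sn'; move: (2 ^ _) sn' le3 => *; lia.
  apply: (hoare_set_seq W_le); first by sim; rewrite G0 G2; repeat split;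
    clear -Wl le1 le2 le3 Kb tb sn'; move: (2 ^ _) sn' le3 => *; lia.
  apply: (hoare_set_seq W_le); first by sim; rewrite G0 d1; repeat split;
    clear -Wl le1 le2 le3 Kb tb sn'; move: (2 ^ _) sn' le3 => *; lia.
  sim; rewrite G0 G2 d1.
  apply: hoare_weaken; first by apply: run_prime.
  - exact: leqnn.
  move=> s5 [e1 e2 e3]; rewrite /Q /has_params /num_blocks /num_reads /field_size /digit_base
    /block_len /side_len /num_vals nN.
  split; last by rewrite e3 /= d3 c3 b3 a3.
    do ![split]; rewrite ?e1 ?e2 //; sim => //; rewrite ?d2 //; sim => //.
  move=> x; rewrite /params_regs !inE !negb_or => nx; move/and5P: nx =>
    [x2 x3 x4 x5 /and5P[x6 x7 x8 x9 /and5P[x10 x11 x12 x13 x14]]].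
  have ifN y (u v : nat) : x != y -> (if x == y then u else v) = v by move/negbTE => ->.
  rewrite e2 ?inE ?negb_or ?x4 ?x9 ?x10 //; sim; rewrite !ifN //.
  rewrite d2 ?inE ?negb_or ?x11 ?x12 //; sim; rewrite !ifN //.
  rewrite c2 ?inE ?negb_or ?x11 ?x12 //; sim; rewrite !ifN //.
  rewrite b2 ?inE ?negb_or ?x11 ?x12 //; sim; rewrite !ifN //.
  by rewrite a2 ?inE ?negb_or ?x11 ?x12 //; sim; rewrite !ifN.
by sim; nia.
Qed.
End Params.

(** * The program of a prisoner *)

Definition point_expr : expr :=
  ((($13 + $17 * $15) mod $4) * $4 + ($14 + $17 * $15 * $15) mod $4)%prog.

(* Registers 13 and 14 hold the coordinates of the base point, 15 the slope lam, and 16 the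
   digits that have not been read yet. *)
Definition decode_prog : com :=
  (13 ::= $10 / $4 ;; 14 ::= $10 mod $4 ;; 15 ::= $11 mod $4 ;; 16 ::= $11 / $4)%prog.

Definition pair_prog : com := (
  17 ::= $16 mod $5 ;; 16 ::= $16 / $5 ;; 18 ::= point_expr ;;
  17 ::= $16 mod $5 ;; 16 ::= $16 / $5 ;; 19 ::= point_expr)%prog.

Section Bounds.
Variables n t N : nat.
Hypothesis (n_pos : 0 < n) (t22 : 22 <= t) (tN : 2 ^ (2 ^ t) <= N).

Let K := num_blocks n N.
Let s := num_reads n N.
Let p := field_size n N.
Let d := digit_base n N.
Let h := block_len n N.
Let N1 := num_vals n N.

Lemma params_bounds : [/\ 0 < p <= n, 0 < d <= n, s <= n, K <= n &
  [/\ h <= n, 0 < N1 <= n, K * h <= n & side_len n N <= n]].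
Proof.
rewrite /p /d /s /K /h /N1 /field_size /digit_base /num_reads /num_blocks /block_len /num_vals
  /side_len.
case nN : (n < N); first by repeat split; rewrite ?n_pos.
have nl : 2 ^ (2 ^ t) <= n by apply: leq_trans tN _; rewrite leqNgt nN.
have [bn _] := andP (n_bounds nl); have dp := base_le t22 nl; have pn := sqr_modulus t22 nl.
have {}pn : modulus n <= n by rewrite leq_sqr in pn.
have [_ p2 _] := modulusP n; have sn := reads_le t22 nl.
have tb : trunc_log 2 n <= n by rewrite (leq_trans _ bn) // ltnW // ltn_expl.
have dn : 2 ^ delta n <= n by rewrite (leq_trans _ pn) // (leq_trans _ dp) // -mulnn leq_pmull
  ?expn_gt0.
split; rewrite ?expn_gt0 //; first by rewrite pn andbT; lia.
  by apply: leq_trans (blocks_le _) _.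
have h1 : n %/ blocks n <= n by apply: leq_div.
split => //; last by apply: leq_trans h1; apply: leq_div.
  rewrite leq_subr andbT subn_gt0; apply: leq_trans sn; apply: ltn_pmod; exact: expn_gt0.
by rewrite mulnC leq_divM.
Qed.

Lemma point_le m1 lam i : m1 <= n -> point p m1 lam i <= n * n.
Proof.
move=> m1n; have [/andP[p0 pn] _ _ _ _] := params_bounds.
rewrite /point; have := ltn_pmod (m1 %/ p + i * lam) p0; have := ltn_pmod (m1 %% p + i * lam * lam) p0.
set x := _ %% p; set y := _ %% p => yp xp; have := leq_mul pn pn.
by have := leq_mul xp (leqnn p); clear -yp; rewrite mulSn; lia.
Qed.

End Bounds.

Section Decode.
Variables (w W n t N : nat) (dr : nat -> option nat).
Hypothesis (W_le : W <= 2 ^ w) (W_big : 200 * n.+1 ^ 3 <= W) (n_pos : 0 < n).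
Hypothesis (t22 : 22 <= t) (tN : 2 ^ (2 ^ t) <= N).

Let K := num_blocks n N.
Let s := num_reads n N.
Let p := field_size n N.
Let d := digit_base n N.
Let h := block_len n N.
Let N1 := num_vals n N.

Let params_bounds := params_bounds n_pos t22 tN.
Let point_le := point_le n_pos t22 tN.

Lemma run_decode s0 m1 m2 : has_params n N s0 -> reg s0 10 = m1 -> reg s0 11 = m2 ->
  m1 <= n -> m2 <= n -> hoare w dr decode_prog s0 30 [::] (fun s' =>
  [/\ reg s' 13 = m1 %/ p, reg s' 14 = m1 %% p, reg s' 15 = m2 %% p, reg s' 16 = m2 %/ p &
    keep [:: 13; 14; 15; 16] s0 s' /\ mem s' = mem s0]).
Proof.
move=> [_ _ s4 _ _] s10 s11 m1n m2n; rewrite -/p in s4; have Wl := W_lin W_big.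
have [/andP[p0 pn] _ _ _ _] := params_bounds.
have := leq_div m1 p; have := leq_div m2 p; have := leq_mod m1 p; have := leq_mod m2 p.
move=> h1 h2 h3 h4.
apply: hoare_weaken.
  apply: (hoare_set_seq W_le); first by sim; rewrite s10 s4; repeat split; lia.
  apply: (hoare_set_seq W_le); first by sim; rewrite s10 s4; repeat split; lia.
  apply: (hoare_set_seq W_le); first by sim; rewrite s11 s4; repeat split; lia.
  apply: (hoare_set W_le); first by sim; rewrite s11 s4; repeat split; lia.
  exact: erefl.
- by [].
- by move=> s' <-; sim; rewrite s10 s11 s4; do !split => //; do 4?[apply: keep_set].
Qed.

Lemma run_pair s0 m1 m2 q : has_params n N s0 -> m1 <= n -> m2 <= n ->
  reg s0 13 = m1 %/ p -> reg s0 14 = m1 %% p -> reg s0 15 = m2 %% p ->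
  reg s0 16 = m2 %/ p %/ d ^ q.*2 -> hoare w dr pair_prog s0 100 [::] (fun s' =>
  [/\ reg s' 18 = left_cut p d m1 m2 q, reg s' 19 = right_cut p d m1 m2 q,
    reg s' 16 = m2 %/ p %/ d ^ q.+1.*2, keep [:: 16; 17; 18; 19] s0 s' & mem s' = mem s0]).
Proof.
move=> [_ _ s4 s5 _] m1n m2n s13 s14 s15 s16; rewrite -/p -/d in s4 s5; have Wl := W_lin W_big.
have ltW x : x <= n -> x < W by clear -Wl; lia.
have [/andP[p0 pn] /andP[d0 dn] _ _ _] := params_bounds.
have r0 : m2 %/ p %/ d ^ q.*2 <= n by rewrite (leq_trans (leq_div _ _)) // (leq_trans (leq_div _ _)).
have r1 : m2 %/ p %/ d ^ q.*2 %/ d = m2 %/ p %/ d ^ q.*2.+1 by rewrite expnSr divnMA.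
have r2 : m2 %/ p %/ d ^ q.*2.+1 %/ d = m2 %/ p %/ d ^ q.+1.*2 by rewrite doubleS [in RHS]expnSr divnMA.
have r1n : m2 %/ p %/ d ^ q.*2.+1 <= n by rewrite -r1 (leq_trans (leq_div _ _)).
have r2n : m2 %/ p %/ d ^ q.+1.*2 <= n by rewrite -r2 (leq_trans (leq_div _ _)).
have lam := ltn_pmod m2 p0.
have y1 := leq_trans (leq_div m1 p) m1n; have y2 := leq_trans (leq_mod m1 p) m1n.
have pt_fits i s1 : i <= n -> reg s1 17 = i -> reg s1 4 = p -> reg s1 13 = m1 %/ p ->
    reg s1 14 = m1 %% p -> reg s1 15 = m2 %% p -> fits W s1 point_expr /\
    value s1 point_expr = point p m1 (m2 %% p) i.
  move=> i_n e17 e4 e13 e14 e15; split; last by rewrite /= e17 e4 e13 e14 e15.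
  have := point_le (m2 %% p) i m1n; rewrite /point.
  rewrite /= e17 e4 e13 e14 e15; set a := m1 %/ p in y1 *; set b := m1 %% p in y2 *;
    set l := m2 %% p in lam *.
  move=> ptn; have ln : l <= n by apply: leq_trans pn; apply: ltnW.
  have il : i * l <= n * n by apply: leq_mul.
  have ill : i * l * l <= n * n * n by apply: leq_mul.
  have := ltn_pmod (a + i * l) p0; have := ltn_pmod (b + i * l * l) p0.
  move: ptn; set x := _ %% p; set y := _ %% p => ptn yp xp.
  have xp2 : x * p <= n * n by apply: leq_mul => //; apply: leq_trans pn; apply: ltnW.
  move: il ill ptn yp xp xp2 Wl; rewrite {}/x {}/y.
  move: (i * l) => u; move: (u * l) (n * n) => v n2;
    move: ((a + u) %% p) ((b + v) %% p) (n2 * n) => x y n3.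
  move: (x * p) => z; clear -y1 y2 pn ln i_n => il ill ptn yp xp xp2 Wl.
  by repeat split; lia.
have dig k : digit d (m2 %/ p) k <= n by rewrite (leq_trans _ dn) // ltnW // ltn_pmod.
have dig0 := dig q.*2; have dig1 := dig q.*2.+1.
apply: hoare_weaken.
  apply: (hoare_set_seq W_le); first by sim; rewrite s16 s5 -/(digit d (m2 %/ p) q.*2); do !split;
    apply: ltW.
  apply: (hoare_set_seq W_le); first by sim; rewrite s16 s5 r1; do !split; apply: ltW.
  sim; rewrite s16 s5 r1 -/(digit d (m2 %/ p) q.*2).
  have [||||||ft dt] := pt_fits (digit d (m2 %/ p) q.*2) (set_reg (set_reg s0 17 (digit d (m2 %/ p)
    q.*2)) 16 (m2 %/ p %/ d ^ q.*2.+1)) => //.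
  apply: (hoare_set_seq W_le); first exact: ft.
  rewrite dt.
  apply: (hoare_set_seq W_le); first by sim; rewrite s5 -/(digit d (m2 %/ p) q.*2.+1); do !split;
    apply: ltW.
  apply: (hoare_set_seq W_le); first by sim; rewrite s5 r2; do !split; apply: ltW.
  sim; rewrite s5 r2 -/(digit d (m2 %/ p) q.*2.+1).
  apply: (hoare_set W_le); last exact: erefl.
  by apply: (proj1 (pt_fits (digit d (m2 %/ p) q.*2.+1) _ _ _ _ _ _ _)).
- by [].
- move=> s' <-; split; [by []| |by []| |by []]; last by do 6?[apply: keep_set].
  by sim; rewrite s4 s13 s14 s15.
Qed.
End Decode.

Definition read_prog : com := (
  9 ::= #0 ;; 10 ::= #0 ;; 11 ::= #0 ;;
  WHILE $9 < $3 DO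
    COpen 12 $9 ;; 10 ::= $10 + $12 ;; 11 ::= $11 + $9 * $12 ;; 9 ::= $9 + #1
  END)%prog.

(** The cut points are decoded once, into the cells [2q] and [2q + 1], so that a step of the walk
    costs time proportional to [K]. *)
Definition store_prog : com := (
  9 ::= #0 ;;
  WHILE $9 < $2 DO
    pair_prog ;; CStore (#2 * $9) $18 ;; CStore (#2 * $9 + #1) $19 ;; 9 ::= $9 + #1
  END)%prog.

Definition swaps_prog : com := (
  9 ::= #0 ;;
  WHILE $9 < $2 DO
    19 ::= M[#2 * $9] ;; 20 ::= M[#2 * $9 + #1] ;;
    IF $17 == $19 THEN 17 ::= $20 ELSE
      IF $17 == $20 THEN 17 ::= $19 ELSE CSkip END
    END ;;
    9 ::= $9 + #1
  END)%prog.

(** Register 18 starts at 1, since register 17 initially holds the prisoner's own number, the very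
    value that later ends the walk. *)
Definition follow_prog : com := (
  17 ::= $1 ;; 18 ::= #1 ;;
  WHILE $18 DO
    swaps_prog ;; COpen 17 $17 ;; 18 ::= ($17 == $1) == #0
  END)%prog.

Definition prisoner_prog N : com := (
  params_prog N ;; read_prog ;; 10 ::= $10 mod $8 ;; 11 ::= $11 mod $3 ;;
  decode_prog ;; store_prog ;; follow_prog)%prog.

Lemma sums_le n (c : nat -> nat) k : (forall j, j < n -> c j < n) -> k <= n ->
  \sum_(0 <= j < k) c j <= n * n /\ \sum_(0 <= j < k) j * c j <= n * n * n.
Proof.
move=> c_lt kn; have term j : 0 <= j < k -> c j <= n /\ j * c j <= n * n.
  by move=> /andP[_ jk]; have := c_lt _ (leq_trans jk kn); split; [lia|apply: leq_mul; lia].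
have sumc m : \sum_(0 <= j < k) m <= n * m by rewrite sum_nat_const_nat subn0 leq_mul2r kn orbT.
split; [apply: leq_trans (sumc n)|rewrite -mulnA; apply: leq_trans (sumc (n * n))];
by rewrite big_nat [leqRHS]big_nat; apply: leq_sum => j /term[].
Qed.

Section Prisoner.
Variables (w W n t N : nat) (dr : nat -> option nat) (c : nat -> nat).
Hypothesis (W_le : W <= 2 ^ w) (W_big : 200 * n.+1 ^ 3 <= W) (n_pos : 0 < n).
Hypothesis (t22 : 22 <= t) (tN : 2 ^ (2 ^ t) <= N) (N_lt : N < W).
Hypothesis (drE : forall j, j < n -> dr j = Some (c j)) (c_lt : forall j, j < n -> c j < n).

Let K := num_blocks n N.
Let s := num_reads n N.
Let p := field_size n N.
Let d := digit_base n N.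
Let N1 := num_vals n N.
Let bounds := params_bounds n_pos t22 tN.

Lemma run_read s0 : reg s0 3 = s ->
  hoare w dr read_prog s0 (50 * n.+1) (iota 0 s) (fun s' =>
    [/\ reg s' 10 = \sum_(0 <= j < s) c j, reg s' 11 = \sum_(0 <= j < s) j * c j,
      keep [:: 9; 10; 11; 12] s0 s' & mem s' = mem s0]).
Proof.
move=> s3; have Wl := W_lin W_big; have [_ _ sn _ _] := bounds; rewrite -/s in sn.
pose I k s' := [/\ reg s' 9 = k, reg s' 10 = \sum_(0 <= j < k) c j,
  reg s' 11 = \sum_(0 <= j < k) j * c j, keep [:: 9; 10; 11; 12] s0 s' & mem s' = mem s0].
have -> : iota 0 s = flatten (mkseq (fun k => [:: k]) s).
  by rewrite /mkseq; elim: (iota 0 s) => //= a l <-.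
apply: hoare_weaken.
  apply: (hoare_set_seq W_le); first by sim; lia.
  apply: (hoare_set_seq W_le); first by sim; lia.
  apply: (hoare_set_seq W_le); first by sim; lia.
  apply: (hoare_while W_le (m := s) (I := I)).
  - by split=> //; sim; rewrite ?big_geq //; do 3?[apply: keep_set].
  - move=> k s1 ks [a1 a2 a3 a4 a5]; sim; rewrite a1 (a4 3) // s3.
    by split; [repeat split; lia|case: (k < s)].
  - move=> k s1 ks [a1 a2 a3 a4 a5]; have kn : k < n by apply: leq_trans sn.
    have ck := c_lt kn; have [b1 b2] := sums_le c_lt (ltnW kn); have [b3 b4] := sums_le c_lt kn.
    rewrite -{1}a1; apply: (hoare_open_seq W_le); first by sim; lia.
      by rewrite /= a1; apply: drE.
    have kc : k * c k <= n * n by apply: leq_mul; lia.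
    have cW : c k < W by lia.
    apply: (hoare_set_seq W_le); first by sim; rewrite a2; do !split => //;
      rewrite ?big_nat_recr //= in b3 *; lia.
    apply: (hoare_set_seq W_le).
      by sim; rewrite a1 a3; rewrite big_nat_recr //= in b4; repeat split; lia.
    apply: (hoare_set W_le); first by sim; rewrite a1; repeat split; lia.
    split; sim; rewrite ?a1 ?a2 ?a3 ?addn1 ?big_nat_recr //=.
    by do 4?[apply: keep_set].
- by sim; lia.
- by move=> s' [a1 a2 a3 a4 a5].
Qed.

Lemma run_store s0 m1 m2 : has_params n N s0 -> m1 <= n -> m2 <= n ->
  reg s0 13 = m1 %/ p -> reg s0 14 = m1 %% p -> reg s0 15 = m2 %% p ->
  reg s0 16 = m2 %/ p -> hoare w dr store_prog s0 (200 * n.+1) [::] (fun s' =>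
  [/\ forall q, q < K -> mem s' (2 * q) = left_cut p d m1 m2 q /\
        mem s' (2 * q + 1) = right_cut p d m1 m2 q &
    keep [:: 9; 16; 17; 18; 19] s0 s']).
Proof.
move=> hp m1n m2n s13 s14 s15 s16; have Wl := W_lin W_big; have [_ _ _ Kn _] := bounds.
rewrite -/K in Kn; have s2 : reg s0 2 = K by case: hp.
pose I k s' := [/\ reg s' 9 = k, reg s' 16 = m2 %/ p %/ d ^ k.*2,
  forall q, q < k -> mem s' (2 * q) = left_cut p d m1 m2 q /\ mem s' (2 * q + 1) = right_cut p d m1 m2
    q &
  keep [:: 9; 16; 17; 18; 19] s0 s'].
apply: hoare_weaken.
  apply: (hoare_set_seq W_le); first by sim; lia.
  apply: (hoare_while0 W_le (m := K) (I := I)).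
  - by split=> //; sim; rewrite ?divn1 //; apply: keep_set.
  - move=> k s1 ks [a1 a2 a3 a4]; sim; rewrite a1 (a4 2) // s2.
    by split; [clear -Wl ks Kn; repeat split; lia|case: (k < K)].
  - move=> k s1 ks [a1 a2 a3 a4].
    have hp1 : has_params n N s1.
      by move: hp; rewrite /has_params !a4.
    apply: hoare_seq0.
      by apply: (run_pair dr W_le W_big n_pos t22 tN (q := k) (m1 := m1) (m2 := m2)) => //; rewrite a4.
    move=> s3 [b1 b2 b3 b4 b5]; have e9 : reg s3 9 = k by rewrite b4.
    have l1 : left_cut p d m1 m2 k <= n * n by apply: (point_le n_pos t22 tN).
    have l2 : right_cut p d m1 m2 k <= n * n by apply: (point_le n_pos t22 tN).
    have kn : k < n by apply: leq_trans Kn.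
    have lW : n * n < W by clear -Wl; lia.
    apply: (hoare_store_seq W_le).
    + by sim; rewrite e9; clear -Wl kn; repeat split; lia.
    + by sim; rewrite b1; apply: leq_ltn_trans lW.
    apply: (hoare_store_seq W_le).
    + by sim; rewrite e9; clear -Wl kn; repeat split; lia.
    + by sim; rewrite b2; apply: leq_ltn_trans lW.
    apply: (hoare_set W_le); first by sim; rewrite e9; clear -Wl kn; repeat split; lia.
    split; sim; rewrite ?e9 ?addn1 //; last first.
      by apply: keep_set => //; apply: (keep_trans _ a4 b4).
    move=> q; rewrite ltnS leq_eqVlt => /orP[/eqP ->|qk].
      by rewrite addn1 b1 b2 !eqxx (ltn_eqF (ltnSn _)).
    by rewrite !ifN ?b5; [apply: a3|..]; clear -qk; lia.
- by sim; clear -Kn; lia.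
- by move=> s' [a1 a2 a3 a4].
Qed.

Lemma swaps_recr k px py z : swaps k.+1 px py z = swp (px k) (py k) (swaps k px py z).
Proof. by rewrite /swaps -[k.+1]addn1 iotaD foldl_cat. Qed.

Lemma run_swaps s0 px py z : reg s0 2 = K -> reg s0 17 = z -> z <= n * n ->
  (forall q, q < K -> px q <= n * n /\ py q <= n * n) ->
  (forall q, q < K -> mem s0 (2 * q) = px q /\ mem s0 (2 * q + 1) = py q) ->
  hoare w dr swaps_prog s0 (50 * n.+1) [::] (fun s' =>
  [/\ reg s' 17 = swaps K px py z, keep [:: 9; 17; 19; 20] s0 s' & mem s' = mem s0]).
Proof.
move=> s2 s17 zn pn mp; have Wl := W_lin W_big; have [_ _ _ Kn _] := bounds; rewrite -/K in Kn.
have lW x : x <= n * n -> x < W by clear -Wl; lia.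
pose I k s' := [/\ reg s' 9 = k, reg s' 17 = swaps k px py z, swaps k px py z <= n * n,
  keep [:: 9; 17; 19; 20] s0 s' & mem s' = mem s0].
apply: hoare_weaken.
  apply: (hoare_set_seq W_le); first by sim; clear -Wl; lia.
  apply: (hoare_while0 W_le (m := K) (I := I)).
  - by split=> //; sim=> //; apply: keep_set.
  - move=> k s1 ks [a1 a2 a3 a4 a5]; sim; rewrite a1 (a4 2) // s2.
    by split; [clear -Wl ks Kn; repeat split; lia|case: (k < K)].
  - move=> k s1 ks [a1 a2 a3 a4 a5]; have kn : k < n by apply: leq_trans Kn.
    have [px_le py_le] := pn k ks; have [mx my] := mp k ks.
    apply: (hoare_set_seq W_le); first by sim; rewrite a1 a5 mx; move/lW: px_le; clear -Wl kn =>
      px_le; repeat split; lia.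
    apply: (hoare_set_seq W_le); first by sim; rewrite a1 a5 my; move/lW: py_le; clear -Wl kn =>
      px_le; repeat split; lia.
    sim; rewrite a1 a5 mx my.
    pose Q s' := [/\ reg s' 9 = k, reg s' 17 = swaps k.+1 px py z, swaps k.+1 px py z <= n * n,
      keep [:: 9; 17; 19; 20] s0 s' & mem s' = mem s0].
    have fq (v : nat) : v <= n * n -> v = swaps k.+1 px py z ->
        Q (set_reg (set_reg (set_reg s1 19 (px k)) 20 (py k)) 17 v).
      by move=> vn Ev; split; sim=> //; [rewrite -Ev|do 3?[apply: keep_set]].
    apply: (hoare_seq0 (T1 := 20) (Q1 := Q)).
      apply: (hoare_weaken (T := (ecost ($17 == $19)%prog + 15).+1) (Q := Q)); [|by []|by []].
      apply: (hoare_if W_le).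
        by sim; rewrite a2; do !split; first [by apply: lW|by case: eqP => _; clear -Wl; lia].
      rewrite [value _ _]/= /upd /= a2; have := swaps_recr k px py z; rewrite /swp.
      case: eqP => [_|ne] E /=.
        apply: (hoare_weaken (T := 2)); [|by []|by move=> s'; exact: id].
        by apply: (hoare_set W_le); sim; [apply: lW|apply: fq].
      apply: (hoare_weaken (T := (ecost ($17 == $20)%prog + 5).+1) (Q := Q)); [|by []|by []].
      apply: (hoare_if W_le).
        by sim; rewrite a2; do !split; first [by apply: lW|by case: eqP => _; clear -Wl; lia].
      rewrite [value _ _]/= /upd /= a2; move: E; case: eqP => [_|ne'] E /=.
        apply: (hoare_weaken (T := 2)); [|by []|by move=> s'; exact: id].
        by apply: (hoare_set W_le); sim; [apply: lW|apply: fq].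
      apply: (hoare_weaken (T := 1)); [|by []|by move=> s'; exact: id].
      apply: hoare_skip; split; sim=> //; rewrite ?E //.
      by do 2?[apply: keep_set].
    move=> s3 [b1 b2 b3 b4 b5]; apply: (hoare_set W_le).
      by sim; rewrite b1; clear -Wl kn; repeat split; lia.
    by split; sim=> //; [rewrite b1 addn1|apply: keep_set].
- by sim; clear -Kn; lia.
- by move=> s' [a1 a2 a3 a4 a5].
Qed.

(** [m] is the first return time of [i] under [g], so the loop stops exactly when the content just
    seen is [i]. *)
Lemma run_follow s0 px py i m : let g z := c (swaps K px py z) in
  reg s0 2 = K -> reg s0 1 = i -> i < n ->
  (forall q, q < K -> px q <= n * n /\ py q <= n * n) ->
  (forall q, q < K -> mem s0 (2 * q) = px q /\ mem s0 (2 * q + 1) = py q) ->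
  (forall z, z < n -> swaps K px py z < n) ->
  0 < m <= n -> iter m g i = i -> (forall k, 0 < k < m -> iter k g i <> i) ->
  hoare w dr follow_prog s0 (200 * (n.+1 * n.+1)) [seq swaps K px py (iter k g i) | k <- iota 0 m]
    (fun _ => True).
Proof.
move=> g s2 s1 i_n pn mp pi_lt /andP[m0 mn] gm gk; have Wl := W_lin W_big.
have gn k : iter k g i < n by elim: k => //= k IH; apply: c_lt; apply: pi_lt.
pose I k s' := [/\ reg s' 17 = iter k g i, reg s' 18 = (k < m), keep [:: 9; 17; 18; 19; 20] s0 s' &
  mem s' = mem s0].
have -> : [seq swaps K px py (iter k g i) | k <- iota 0 m] =
    flatten (mkseq (fun k => [:: swaps K px py (iter k g i)]) m).
  by rewrite /mkseq; elim: (iota 0 m) => //= a l <-.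
apply: hoare_weaken.
  apply: (hoare_set_seq W_le); first by sim; rewrite s1; clear -Wl i_n; lia.
  apply: (hoare_set_seq W_le); first by sim; clear -Wl; lia.
  apply: (hoare_while W_le (m := m) (I := I)).
  - by split; sim=> //; [rewrite m0|do 2?[apply: keep_set]].
  - move=> k s3 ks [a1 a2 a3 a4]; sim; rewrite a2.
    by split; [case: (k < m); clear -Wl; lia|case: (k < m)].
  - move=> k s3 ks [a1 a2 a3 a4].
    have zn := gn k; have zn2 : iter k g i <= n * n.
      by clear -zn; move: (iter _ _ _) zn => x; nia.
    rewrite -[[:: _]]cat0s; apply: hoare_seq.
      apply: (run_swaps (px := px) (py := py)) a1 zn2 pn _; first by rewrite a3.
      by move=> q qK; rewrite a4; apply: mp.
    move=> s4 [b1 b2 b3]; rewrite -{1}b1.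
    have lt : swaps K px py (iter k g i) < n by apply: pi_lt.
    have E : c (swaps K px py (iter k g i)) = iter k.+1 g i by [].
    apply: (hoare_open_seq W_le); first by sim; rewrite b1; clear -Wl lt; lia.
      by rewrite /= b1; apply: drE.
    have r1 : reg s4 1 = i by rewrite b2 // a3.
    rewrite E; have zn' := gn k.+1.
    apply: (hoare_set W_le).
      have bW (b : bool) : b < W by case: b; clear -Wl; lia.
      have iW x : x < n -> x < W by clear -Wl; lia.
      by sim; rewrite r1 /=; do !split; first [exact: iW|exact: bW|clear -Wl; lia].
    split; sim=> //; [|by do 2?[apply: keep_set => //]; apply: (keep_trans _ a3 b2)|by rewrite b3].
    rewrite r1; have [km|mk] := ltnP k.+1 m.
      by have /eqP/negbTE /= -> := gk k.+1 km.
    have mE : m = k.+1 by apply/eqP; rewrite eqn_leq mk ks.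
    have -> : g (iter k g i) = i by rewrite -[RHS]gm mE.
    by rewrite eqxx.
- by sim; clear -mn; nia.
- by [].
Qed.

Lemma run_prisoner s0 i m : let m1 := msg1 s N1 c in let m2 := msg2 s c in
  let pi := swaps K (left_cut p d m1 m2) (right_cut p d m1 m2) in let g z := c (pi z) in
  reg s0 0 = n -> reg s0 1 = i -> i < n -> (forall z, z < n -> pi z < n) ->
  0 < m <= n -> iter m g i = i -> (forall k, 0 < k < m -> iter k g i <> i) ->
  hoare w dr (prisoner_prog N) s0 (2000 * (n.+1 * n.+1)) (iota 0 s ++ [seq pi (iter k g i) | k <- iota
    0 m])
    (fun _ => True).
Proof.
move=> m1 m2 pi g r0 r1 i_n pi_lt mn gm gk; have Wl := W_lin W_big.
have [/andP[p0 pn] /andP[d0 dn] sn Kn [_ /andP[N1_0 N1n] _ _]] := bounds.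
have [S1n S2n] := sums_le c_lt sn.
have W1 x : x <= n -> x < W by clear -Wl; lia.
have W2 x : x <= n * n -> x < W by clear -Wl; lia.
have W3 x : x <= n * n * n -> x < W by clear -Wl; lia.
have m1n : m1 <= n by apply: leq_trans N1n; apply/ltnW/ltn_pmod.
have m2n : m2 <= n.
  (* For [s = 0] the modulus is 0 and reduction does nothing, but the sum is empty. *)
  rewrite /m2 /msg2; case: (posnP s) => [->|s_pos]; first by rewrite big_geq // mod0n.
  by apply: leq_trans sn; apply/ltnW/ltn_pmod.
apply: hoare_weaken.
  apply: hoare_seq0; first by apply: (run_params dr W_le W_big t22 tN N_lt r0).
  move=> s1 [hp1 k1 e1].
  apply: hoare_seq; first by apply: run_read; case: hp1.
  move=> s2 [a1 a2 a3 a4].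
  have hp2 : has_params n N s2 by move: hp1; rewrite /has_params !a3.
  have [h2 h3 h4 h5 [h6 h7 h8]] := hp2.
  apply: (hoare_set_seq W_le).
    by sim; rewrite a1 h8 -/N1 -/(msg1 s N1 c) -/m1; do !split; [apply: W2|apply: W1|apply: W1].
  sim; rewrite a1 h8 -/N1 -/(msg1 s N1 c) -/m1.
  apply: (hoare_set_seq W_le).
    by sim; rewrite a2 h3 -/s -/(msg2 s c) -/m2; do !split; [apply: W3|apply: W1|apply: W1].
  sim; rewrite a2 h3 -/s -/(msg2 s c) -/m2.
  apply: hoare_seq0; first by apply: (run_decode dr W_le W_big n_pos t22 tN (m1 := m1) (m2 := m2)).
  move=> s3 [b1 b2 b3 b4 [b5 b6]].
  have hp3 : has_params n N s3 by move: hp2; rewrite /has_params !b5.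
  apply: hoare_seq0; first by apply: (run_store (m1 := m1) (m2 := m2)).
  move=> s4 [c1 c2].
  apply: (run_follow (px := left_cut p d m1 m2) (py := right_cut p d m1 m2) (i := i) (m := m)) => //.
  - by rewrite c2 // b5 //; sim.
  - by rewrite c2 // b5 //; sim; rewrite a3 // k1.
  - by move=> q _; split; apply: (point_le n_pos t22 tN).
- by sim; clear; lia.
- by [].
Qed.

End Prisoner.

(** * The program of the spy *)

Section Listing.
Variables (n : nat) (c : nat -> nat) (f : 'I_n -> 'I_n).
Hypothesis (fE : forall z, val (f z) = c (val z)) (f_inj : injective f).

Definition start (L S : seq nat) z := nth 0 S (index z L).

(* [L] lists complete cycles one after the other, [S] records for each entry where its
   cycle starts. *)
Record cycle_list (L S : seq nat) : Prop := CycleList {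
  cl_uniq : uniq L;
  cl_lt : forall z, z \in L -> z < n;
  cl_size : size S = size L;
  cl_closed : forall z, z \in L -> c z \in L;
  cl_start : forall z, z \in L -> start L S (c z) = start L S z;
  cl_next : forall z, z \in L -> index (c z) L = (index z L).+1 \/
    index (c z) L = start L S z /\
    forall v, v \in L -> start L S v = start L S z -> index v L <= index z L;
  cl_between : forall u v, u \in L -> v \in L -> start L S v <= index u L ->
    index u L <= index v L -> start L S u = start L S v;
  cl_le : forall z, z \in L -> start L S z <= index z L
}.

Lemma iter_f k (x : 'I_n) : val (iter k f x) = iter k c x.
Proof. by elim: k => // k IH; rewrite !iterS fE IH. Qed.

Lemma cycle_exists j : j < n -> exists m, [/\ 0 < m <= n, iter m c j = j,
  uniq (traject c j m) & forall z, z \in traject c j m -> z < n].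
Proof.
move=> jn; pose x := Ordinal jn; exists (fingraph.order f x).
have E k : traject c j k = map val (traject f x k).
  by elim: k (x) (j) (erefl : val x = j) => // k IH y i <-; rewrite !trajectS map_cons;
    congr (_ :: _); apply: IH; exact: fE.
split.
- by rewrite fingraph.order_gt0 /=; have := max_card (fconnect f x); rewrite card_ord.
- by rewrite -(iter_f _ x) iter_order.
- by rewrite E map_inj_uniq; [exact: orbit_uniq|exact: val_inj].
- by rewrite E => _ /mapP[y _ ->]; apply: ltn_ord.
Qed.

Lemma closed_iter (L : seq nat) k z : (forall y, y \in L -> c y \in L) -> z \in L -> iter k c z \in L.
Proof. by move=> cl zL; elim: k => //= k; apply: cl. Qed.

(** The list is closed under [c], so from a listed iterate one would come back to [j] inside the
    list. *)
Lemma traject_notin L S j m k : cycle_list L S -> j \notin L -> iter m c j = j -> k <= m ->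
  iter k c j \notin L.
Proof.
move=> cl jL jm km; apply: contra jL => kL.
by rewrite -jm -(subnK km) iterD; apply: closed_iter (cl_closed cl) kL.
Qed.

(** The appended cycle is disjoint from [L] and begins at position [size L], which is recorded as
    its start. Old starts are smaller than [size L], so the two kinds of entries are never
    confused. *)
Lemma cycle_list_cat L S j m : cycle_list L S -> j \notin L -> 0 < m -> iter m c j = j ->
  uniq (traject c j m) -> (forall z, z \in traject c j m -> z < n) ->
  cycle_list (L ++ traject c j m) (S ++ nseq m (size L)).
Proof.
move=> cl jL m0 jm Tu Tn; set T := traject c j m.
have TL z : z \in T -> z \notin L.
  by case/trajectP => k km ->; apply: traject_notin cl jL jm (ltnW km).
have sT : size T = m by rewrite size_traject.
have iL z : z \in L -> index z (L ++ T) = index z L by rewrite index_cat => ->.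
have iT z : z \in T -> index z (L ++ T) = size L + index z T by rewrite index_cat => /TL/negbTE ->.
have sL z : z \in L -> start (L ++ T) (S ++ nseq m (size L)) z = start L S z.
  by move=> zL; rewrite /start iL // nth_cat (cl_size cl) index_mem zL.
have sTE z : z \in T -> start (L ++ T) (S ++ nseq m (size L)) z = size L.
  move=> zT; rewrite /start iT // nth_cat (cl_size cl) ltnNge leq_addr /= addKn nth_nseq.
  by rewrite -sT index_mem zT.
have ltL z : z \in L -> index z L < size L by rewrite index_mem.
have sltL z : z \in L -> start L S z < size L.
  by move=> zL; apply: leq_ltn_trans (cl_le cl zL) _; apply: ltL.
have cT z : z \in T -> c z \in T /\ (index (c z) T = (index z T).+1 \/ index (c z) T = 0 /\ (index z
  T).+1 = m).
  case/trajectP => k km ->; have ik i : i < m -> index (iter i c j) T = i.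
    by move=> im; rewrite -(nth_traject c im) index_uniq // sT.
  rewrite ik // -[c _]/(iter k.+1 c j).
  move: km; rewrite leq_eqVlt => /orP[/eqP E|km].
    have j0 : iter k.+1 c j = iter 0 c j by rewrite E jm.
    by rewrite j0 ik //; split; [apply/trajectP; exists 0|right].
  by rewrite ik //; split; [apply/trajectP; exists k.+1|left].
split.
- rewrite cat_uniq (cl_uniq cl) Tu andbT /=; apply/hasPn => z; exact: TL.
- by move=> z; rewrite mem_cat => /orP[/(cl_lt cl)|/Tn].
- by rewrite !size_cat (cl_size cl) size_nseq sT.
- by move=> z; rewrite !mem_cat => /orP[/(cl_closed cl) ->|/cT[-> _]]; rewrite ?orbT.
- move=> z; rewrite mem_cat => /orP[zL|zT].
    by rewrite !sL ?(cl_start cl) // (cl_closed cl).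
  by have [czT _] := cT z zT; rewrite !sTE.
- move=> z; rewrite mem_cat => /orP[zL|zT].
    have czL := cl_closed cl zL; rewrite !iL // sL //.
    case: (cl_next cl zL) => [->|[E lst]]; [by left|right; split=> // v].
    rewrite mem_cat => /orP[vL|vT]; first by rewrite sL // iL //; apply: lst.
    by rewrite sTE // => E'; have := sltL z zL; rewrite -E' ltnn.
  have [czT nx] := cT z zT; rewrite !iT // sTE //; case: nx => [->|[-> zm]]; first by left;
    rewrite addnS.
  right; rewrite addn0; split=> // v; rewrite mem_cat => /orP[vL|vT].
    by rewrite sL // => E'; have := sltL v vL; rewrite E' ltnn.
  by move=> _; rewrite iT // leq_add2l -ltnS zm -sT index_mem.
- move=> u v; rewrite !mem_cat => /orP[uL|uT] /orP[vL|vT].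
  + by rewrite !sL // !iL //; apply: (cl_between cl).
  + by rewrite sTE // iL // => h; have := ltL u uL; rewrite ltnNge h.
  + by rewrite iT // iL // => _ h; have := ltL v vL; rewrite ltnNge (leq_trans _ h) // leq_addr.
  + by rewrite !sTE.
- move=> z; rewrite mem_cat => /orP[zL|zT]; first by rewrite sL // iL // (cl_le cl).
  by rewrite sTE // iT // leq_addr.
Qed.

Lemma cycle_list_order L S pos cs e : cycle_list L S -> (forall z, z < n -> z \in L) ->
  (forall z, z < n -> pos z = index z L) -> (forall z, z < n -> cs z = start L S z) ->
  (forall i, i < n -> e i = nth 0 L i) -> cycle_order n c pos cs e.
Proof.
move=> cl Ln posE csE eE.
have sL : size L = n.
  apply/eqP; rewrite eqn_leq -{1}(size_iota 0 n) -{2}(size_iota 0 n).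
  rewrite !uniq_leq_size ?iota_uniq ?(cl_uniq cl) //= => z; rewrite mem_iota /= add0n.
    by apply: Ln.
  by apply: (cl_lt cl).
have c_lt z : z < n -> c z < n by move=> zn; have /= <- := fE (Ordinal zn); apply: ltn_ord.
have ilt z : z < n -> index z L < n by move=> zn; rewrite -[n in _ < n]sL index_mem Ln.
have nlt i : i < n -> nth 0 L i < n.
  by move=> i_n; apply: (cl_lt cl); rewrite mem_nth ?sL.
split=> [z zn|z zn|i i_n|i i_n|z zn|z zn|z zn|u v un vn|z zn].
- by rewrite posE ?ilt.
- by rewrite posE // eE ?ilt // nth_index ?Ln.
- by rewrite eE ?nlt.
- by rewrite eE // posE ?nlt // index_uniq ?sL ?(cl_uniq cl).
- exact: c_lt.
- by rewrite !csE ?c_lt // (cl_start cl) // Ln.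
- rewrite !posE ?c_lt // csE //; case: (cl_next cl (Ln z zn)) => [->|[-> lst]]; [by left|right].
  by split=> // v vn; rewrite csE // posE // => /lst; apply; apply: Ln.
- by rewrite !csE // !posE //; apply: (cl_between cl); apply: Ln.
- by rewrite csE // posE // (cl_le cl) // Ln.
Qed.
End Listing.

(* The memory cell [n + z] contains 1 + the position of [z], so 0 marks the drawers that
   are not listed yet. *)
Definition cycle_prog : com := (
  WHILE M[$0 + $12] == #0 DO
    CStore ($0 + $12) ($9 + #1) ;; CStore (#2 * $0 + $12) $11 ;;
    CStore (#3 * $0 + $9) $12 ;; 9 ::= $9 + #1 ;; 12 ::= M[$12]
  END)%prog.

Definition order_prog : com := (
  9 ::= #0 ;; 10 ::= #0 ;;
  WHILE $10 < $0 DO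
    11 ::= $9 ;; 12 ::= $10 ;; cycle_prog ;; 10 ::= $10 + #1
  END)%prog.

Section Order.
Variables (w W n : nat) (dr : nat -> option nat) (c : nat -> nat) (f : 'I_n -> 'I_n).
Hypothesis (W_le : W <= 2 ^ w) (W_big : 200 * n.+1 ^ 3 <= W).
Hypothesis (fE : forall z, val (f z) = c (val z)) (f_inj : injective f).

(** [li_le] covers every address, because the later check also reads cells addressed by points that
    are no drawers. *)
Record listed (L S : seq nat) (s : state) : Prop := Listed {
  li_c : forall z, z < n -> mem s z = c z;
  li_pos : forall z, z < n -> mem s (n + z) = if z \in L then (index z L).+1 else 0;
  li_cs : forall z, z \in L -> mem s (2 * n + z) = start L S z;
  li_e : forall i, i < size L -> mem s (3 * n + i) = nth 0 L i;
  li_le : forall a, mem s a <= n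
}.

Lemma listed_rcons L S s z st : listed L S s -> uniq L -> (forall y, y \in L -> y < n) ->
  size S = size L -> z \notin L -> z < n -> size L < n -> st <= n ->
  listed (rcons L z) (rcons S st)
    (set_mem (set_mem (set_mem s (n + z) (size L).+1) (2 * n + z) st) (3 * n + size L) z).
Proof.
move=> li uL Ln sSL zL zn sL stn.
have idx y : y \in L -> index y (rcons L z) = index y L by move=> yL; rewrite -cats1 index_cat yL.
have idz : index z (rcons L z) = size L by rewrite -cats1 index_cat (negbTE zL) /= eqxx addn0.
have no (a b : nat) : a <> b -> (a == b) = false by move/eqP/negbTE.
split=> /= [y yn|y yn|y yL|i iL|a]; rewrite /upd.
- by rewrite !no ?(li_c li) //; clear -yn zn sL; lia.
- rewrite (no (n + y) (3 * n + size L)) ?(no (n + y) (2 * n + z)); [|clear -yn; lia..].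
  rewrite eqn_add2l mem_rcons inE; case: eqP => [->|_] /=; first by rewrite idz.
  by rewrite (li_pos li) //; case: ifP => // yL; rewrite idx.
- have yn : y < n by move: yL; rewrite mem_rcons inE => /orP[/eqP ->|/Ln].
  rewrite (no (2 * n + y) (3 * n + size L)); last by clear -yn sL; lia.
  rewrite eqn_add2l; case: eqP yL => [->|/eqP yz]; rewrite /start.
    by rewrite idz nth_rcons sSL ltnn eqxx.
  rewrite mem_rcons inE (negbTE yz) /= => yL; rewrite idx // nth_rcons sSL index_mem yL.
  by rewrite no ?(li_cs li) //; clear -yn zn; lia.
- rewrite eqn_add2l; move: iL; rewrite size_rcons ltnS leq_eqVlt nth_rcons.
  case: eqP => [->|_] /= iL; first by rewrite ltnn.
  by rewrite iL !no ?(li_e li) //; clear -zn iL sL; lia.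
- by case: ifP => _; [exact: ltnW|do 2![case: ifP => // _]; exact: (li_le li)].
Qed.

Lemma run_cycle s0 L S j : cycle_list n c L S -> listed L S s0 -> j < n ->
  reg s0 0 = n -> reg s0 9 = size L -> reg s0 11 = size L -> reg s0 12 = j ->
  hoare w dr cycle_prog s0 (100 * n.+1) [::] (fun s' => exists L' S',
    [/\ cycle_list n c L' S', listed L' S' s', {subset j :: L <= L'}, reg s' 9 = size L' &
      keep [:: 9; 12] s0 s']).
Proof.
move=> cl li jn r0 r9 r11 r12; have Wl := W_lin W_big.
have iW x : x <= 5 * n + 1 -> x < W by clear -Wl; lia.
have bW (b : bool) : b < W by case: b; clear -Wl; lia.
have c_lt z : z < n -> c z < n by move=> zn; have /= <- := fE (Ordinal zn); apply: ltn_ord.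
have [m [/andP[m0 mn] jm Tu Tn]] := cycle_exists fE f_inj jn.
(* The loop makes no round if the cycle of [j] is already listed, and otherwise one round for each
   drawer of the cycle. *)
pose m' := if j \in L then 0 else m.
pose I k s' := [/\ listed (L ++ traject c j k) (S ++ nseq k (size L)) s', reg s' 9 = size L + k,
  reg s' 12 = iter k c j & keep [:: 9; 12] s0 s'].
have size_le k : k <= m' -> size (L ++ traject c j k) <= n /\ uniq (L ++ traject c j k) /\
    (forall z, z \in L ++ traject c j k -> z < n).
  rewrite /m' => km; have U : uniq (L ++ traject c j k) /\ (forall z, z \in L ++ traject c j k -> z <
    n).
    move: km; case: ifP => [_|/negbT jL km].
      by rewrite leqn0 => /eqP ->; rewrite cats0; split; [exact: cl_uniq cl|exact: cl_lt cl].
    have sub : {subset traject c j k <= traject c j m}.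
      by move=> z /trajectP[i ik ->]; apply/trajectP; exists i; rewrite ?(leq_trans ik).
    split=> [|z]; last by rewrite mem_cat => /orP[/(cl_lt cl)|/sub/Tn].
    rewrite cat_uniq (cl_uniq cl) /=; apply/andP; split.
      apply/hasPn => z /trajectP[i ik ->]; exact: (traject_notin cl jL jm (leq_trans (ltnW ik) km)).
    by rewrite -(subnKC km) trajectD cat_uniq in Tu; case/and3P: Tu.
  case: U => U lt; split=> //; rewrite -(size_iota 0 n); apply: uniq_leq_size => // z /lt.
  by rewrite mem_iota.
have notin k : k < m' -> iter k c j \notin L ++ traject c j k.
  rewrite /m'; case: ifP => // /negbT jL km; rewrite mem_cat negb_or.
  rewrite (traject_notin cl jL jm (ltnW km)) /=.
  rewrite -(subnKC km) addSnnS trajectD cat_uniq /= negb_or in Tu; case/and3P: Tu => _ /andP[h _] _.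
  exact: h.
have iter_lt k : iter k c j < n by elim: k => //= k; apply: c_lt.
apply: hoare_weaken.
  apply: (hoare_while0 W_le (m := m') (I := I)).
  - by split; rewrite ?cats0 ?addn0.
  - move=> k s1 km [a1 a2 a3 a4]; sim; rewrite a3 (a4 0) // r0.
    rewrite (li_pos a1) //; have [le _] := size_le k km.
    have lt := iter_lt k; split.
      have idx : (if iter k c j \in L ++ traject c j k then (index (iter k c j) (L ++ traject c j
        k)).+1 else 0) <= n.
        by rewrite -(li_pos a1) // (li_le a1).
      by do ?split; first [exact: bW|apply: iW; move: lt idx; clear; lia].
    have [km'|mk] := ltnP k m'; first by rewrite (negbTE (notin k km')).
    have -> : k = m' by apply/eqP; rewrite eqn_leq km.
    have -> : iter m' c j = j by rewrite /m'; case: ifP.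
    suff -> : j \in L ++ traject c j m' by [].
    rewrite mem_cat /m'; case: ifP => //= _; apply/trajectP; exists 0 => //.
  - move=> k s1 km [a1 a2 a3 a4]; have lt := iter_lt k.
    have [le [uL Ln]] := size_le k (ltnW km); have [le' _] := size_le k.+1 km.
    rewrite size_cat size_traject in le; rewrite size_cat size_traject in le'.
    have b0 : reg s1 0 = n by rewrite a4.
    have b11 : reg s1 11 = size L by rewrite a4.
    apply: (hoare_store_seq W_le).
    + by sim; rewrite b0 a3; do ?split; apply: iW; clear -lt; lia.
    + by sim; rewrite a2; do ?split; apply: iW; clear -le'; lia.
    apply: (hoare_store_seq W_le).
    + by sim; rewrite b0 a3; do ?split; apply: iW; clear -lt; lia.
    + by sim; rewrite b11; do ?split; apply: iW; clear -le'; lia.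
    apply: (hoare_store_seq W_le).
    + by sim; rewrite b0 a2; do ?split; apply: iW; clear -le'; lia.
    + by sim; rewrite a3; do ?split; apply: iW; clear -lt; lia.
    apply: (hoare_set_seq W_le); first by sim; rewrite a2; do ?split; apply: iW; clear -le'; lia.
    have sLn : size L <= n by clear -le; lia.
    have lik : size L + k < n by clear -le'; lia.
    have := listed_rcons (st := size L) a1 uL Ln _ (notin k km) lt _ _.
    rewrite !size_cat size_traject size_nseq (cl_size cl) => /(_ erefl lik sLn) li1.
    sim; rewrite a2 a3 b0 b11; rewrite addn1.
    apply: (hoare_set W_le).
      sim; rewrite a3; split; first by apply: iW; clear -lt; lia.
      apply: iW; have := li_le li1 (iter k c j); rewrite /= /upd; clear; lia.
    split.
    + rewrite trajectSr -rcons_cat.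
      have -> : S ++ nseq k.+1 (size L) = rcons (S ++ nseq k (size L)) (size L).
        by rewrite -cats1 -catA; congr (_ ++ _); rewrite -[k.+1]addn1 nseqD.
      by case: li1 => *; split.
    + by sim; rewrite addnS.
    + by sim; rewrite a3; have := li_c li1 lt.
    + by do 2?[apply: keep_set => //].
- sim; have : m' <= n by rewrite /m'; case: ifP.
  by clear; nia.
- move=> s' [a1 a2 a3 a4]; exists (L ++ traject c j m'), (S ++ nseq m' (size L)); split=> //.
  + rewrite /m'; case: ifP => [_|/negbT jL]; first by rewrite !cats0.
    exact: cycle_list_cat.
  + move=> z; rewrite inE mem_cat => /orP[/eqP ->|->//].
    rewrite /m'; case: ifP => // _; apply/trajectP; exists 0 => //.
  + by rewrite size_cat size_traject.
Qed.

Lemma run_order s0 : reg s0 0 = n -> (forall z, z < n -> mem s0 z = c z) ->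
  (forall a, n <= a -> mem s0 a = 0) ->
  hoare w dr order_prog s0 (200 * (n.+1 * n.+1)) [::] (fun s' =>
    [/\ cycle_order n c (fun z => (mem s' (n + z)).-1) (fun z => mem s' (2 * n + z))
          (fun i => mem s' (3 * n + i)),
      forall z, z < n -> mem s' z = c z, forall a, mem s' a <= n & keep [:: 9; 10; 11; 12] s0 s']).
Proof.
move=> r0 mc m0; have Wl := W_lin W_big.
have iW x : x <= 5 * n + 1 -> x < W by clear -Wl; lia.
have bW (b : bool) : b < W by case: b; clear -Wl; lia.
have c_lt z : z < n -> c z < n by move=> zn; have /= <- := fE (Ordinal zn); apply: ltn_ord.
pose I j s' := exists L S, [/\ cycle_list n c L S, listed L S s', forall z, z < j -> z \in L,
  reg s' 9 = size L /\ reg s' 10 = j & keep [:: 9; 10; 11; 12] s0 s'].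
have size_le L S : cycle_list n c L S -> size L <= n.
  move=> cl; rewrite -(size_iota 0 n); apply: uniq_leq_size; first exact: cl_uniq cl.
  by move=> z /(cl_lt cl); rewrite mem_iota.
apply: hoare_weaken.
  apply: (hoare_set_seq W_le); first by sim; apply: iW.
  apply: (hoare_set_seq W_le); first by sim; apply: iW.
  apply: (hoare_while0 W_le (m := n) (I := I)).
  - exists [::], [::]; split=> //; last by do 2?[apply: keep_set => //].
    split=> //= [z zn|a]; first by rewrite m0 // leq_addr.
    by have [an|na] := ltnP a n; [rewrite mc // ltnW // c_lt|rewrite m0].
  - move=> j s1 jn [L [S [_ _ _ [_ a1] a2]]]; sim; rewrite a1 a2 // r0; split; last by case: (j < n).
    by do ?split; first [exact: bW|apply: iW; move: jn; clear; lia].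
  - move=> j s1 jn [L [S [a1 a2 a3 [a4 a5] a6]]]; have sL := size_le _ _ a1.
    apply: (hoare_set_seq W_le); first by sim; rewrite a4; apply: iW; clear -sL; lia.
    apply: (hoare_set_seq W_le); first by sim; rewrite a5; apply: iW; clear -jn; lia.
    sim; rewrite a4 a5.
    apply: hoare_seq0.
      apply: (run_cycle a1 (j := j)) => //; last by sim; rewrite a6.
      by case: a2.
    move=> s2 [L' [S' [b1 b2 b3 b4 b5]]]; have e10 : reg s2 10 = j by rewrite b5.
    apply: (hoare_set W_le); first by sim; rewrite e10; do ?split; apply: iW; clear -jn; lia.
    exists L', S'; split=> //; first by case: b2.
    + by move=> z; rewrite ltnS leq_eqVlt => /orP[/eqP ->|/a3 zL]; apply: b3;
      rewrite inE ?eqxx // zL orbT.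
    + by sim; rewrite e10 addn1.
    + apply: keep_set => //; apply: (keep_trans (l := [:: 9; 12]) _ _ b5) => //.
      by do 2?[apply: keep_set => //].
- by sim; clear; nia.
- move=> s' [L [S [a1 a2 a3 [a4 a5] a6]]]; split=> //; first 1 last.
  + exact: li_c a2.
  + exact: li_le a2.
  apply: (cycle_list_order fE a1 a3) => [z zn|z zn|i i_n].
  + by rewrite (li_pos a2) // a3.
  + by rewrite (li_cs a2) // a3.
  + rewrite (li_e a2) //; apply: leq_trans i_n _.
    by rewrite -{1}(size_iota 0 n); apply: uniq_leq_size; [exact: iota_uniq|move=> z;
      rewrite mem_iota => /a3].
Qed.
End Order.

(** * The search for an accepted swap *)

Definition sums_prog : com := (
  10 ::= #0 ;; 21 ::= #0 ;; 22 ::= #0 ;;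
  WHILE $10 < $3 DO
    21 ::= $21 + M[$10] ;; 22 ::= $22 + $10 * M[$10] ;; 10 ::= $10 + #1
  END)%prog.

Definition inner_expr : expr :=
  (M[#2 * $0 + M[#3 * $0 + $9 * $6]] == M[#2 * $0 + M[#3 * $0 + ($9 * $6 + ($6 - #1))]])%prog.

(** Conjunction is multiplication of truth values, and all factors are evaluated, including those
    that depend on points outside the range of drawers. *)
Definition sides_expr : expr :=
  (($18 < $0) * (($19 < $0) * ((((M[$0 + $18] - #1) / $6) == $9) *
   ((((M[$0 + $18] - #1) mod $6) < $7) * ((((M[$0 + $19] - #1) / $6) == $9) *
    ((((M[$0 + $19] - #1) mod $6) < ($6 - $7)) == #0))))))%prog.

Definition check_prog : com := (
  27 ::= #1 ;; 9 ::= #0 ;;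
  WHILE $9 < $2 DO
    pair_prog ;;
    IF inner_expr THEN 27 ::= $27 * sides_expr ELSE 27 ::= $27 * ($18 == $19) END ;;
    9 ::= $9 + #1
  END)%prog.

(* Registers 23 and 24 run over the swaps, 25 and 26 keep the last accepted one. *)
Definition try_prog : com := (
  10 ::= ($21 + M[$24] - M[$23]) mod $8 ;;
  11 ::= ($22 + $23 * M[$24] - $23 * M[$23]) mod $3 ;;
  decode_prog ;; check_prog ;;
  IF $27 THEN 25 ::= $23 ;; 26 ::= $24 ELSE CSkip END ;;
  24 ::= $24 + #1)%prog.

(** All pairs [a < s <= b < n] are tried without early exit. Each trial costs time proportional to
    [K + 1], and [s * K <= n] keeps the total quadratic. *)
Definition search_prog : com := (
  25 ::= #0 ;; 26 ::= #0 ;; 23 ::= #0 ;;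
  WHILE $23 < $3 DO
    24 ::= $3 ;; WHILE $24 < $0 DO try_prog END ;; 23 ::= $23 + #1
  END ;;
  0 ::= $25 ;; 1 ::= $26)%prog.

Definition spy_prog N : com := (
  IF $0 < #N THEN 0 ::= #0 ;; 1 ::= #0
  ELSE params_prog N ;; order_prog ;; sums_prog ;; search_prog END)%prog.

Section Spy.
Variables (w W n t N : nat) (c mm : nat -> nat).
Let dr := no_drawer.
Hypothesis (W_le : W <= 2 ^ w) (W_big : 200 * n.+1 ^ 3 <= W) (n_pos : 0 < n).
Hypothesis (t22 : 22 <= t) (tN : 2 ^ (2 ^ t) <= N) (N_lt : N < W) (Nn : N <= n).
Hypothesis (c_lt : forall z, z < n -> c z < n).
Hypothesis (mmc : forall z, z < n -> mm z = c z) (mm_le : forall a, mm a <= n).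

Let K := num_blocks n N.
Let s := num_reads n N.
Let p := field_size n N.
Let d := digit_base n N.
Let h := block_len n N.
Let l := side_len n N.
Let N1 := num_vals n N.
Let bounds := params_bounds n_pos t22 tN.

Let pos_of z := (mm (n + z)).-1.
Let cs_of z := mm (2 * n + z).
Let e_of i := mm (3 * n + i).
Let ok m1 m2 q := cut_ok n h l pos_of cs_of e_of q (left_cut p d m1 m2 q) (right_cut p d m1 m2 q).

Lemma run_sums s0 : reg s0 3 = s -> mem s0 = mm ->
  hoare w dr sums_prog s0 (50 * n.+1) [::] (fun s' =>
    [/\ reg s' 21 = \sum_(0 <= j < s) c j, reg s' 22 = \sum_(0 <= j < s) j * c j,
      keep [:: 10; 21; 22] s0 s' & mem s' = mem s0]).
Proof.
move=> s3 m0; have Wl := W_lin W_big; have [_ _ sn _ _] := bounds; rewrite -/s in sn.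
pose I k s' := [/\ reg s' 10 = k, reg s' 21 = \sum_(0 <= j < k) c j,
  reg s' 22 = \sum_(0 <= j < k) j * c j, keep [:: 10; 21; 22] s0 s' & mem s' = mem s0].
apply: hoare_weaken.
  apply: (hoare_set_seq W_le); first by sim; lia.
  apply: (hoare_set_seq W_le); first by sim; lia.
  apply: (hoare_set_seq W_le); first by sim; lia.
  apply: (hoare_while0 W_le (m := s) (I := I)).
  - by split=> //; sim; rewrite ?big_geq //; do 3?[apply: keep_set].
  - move=> k s1 ks [a1 a2 a3 a4 a5]; sim; rewrite a1 (a4 3) // s3.
    by split; [clear -Wl ks sn; repeat split; lia|case: (k < s)].
  - move=> k s1 ks [a1 a2 a3 a4 a5]; have kn : k < n by apply: leq_trans sn.
    have ck := c_lt kn; have [b1 b2] := sums_le c_lt (ltnW kn); have [b3 b4] := sums_le c_lt kn.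
    have kc : k * c k <= n * n by apply: leq_mul; apply: ltnW.
    rewrite big_nat_recr //= in b3; rewrite big_nat_recr //= in b4.
    have mk : mm k = c k by apply: mmc.
    have W1 x : x <= n -> x < W by clear -Wl; lia.
    have W2 x : x <= n * n -> x < W by clear -Wl; lia.
    have W3 x : x <= n * n * n -> x < W by clear -Wl; lia.
    have ck' := ltnW ck; have kn' := ltnW kn.
    apply: (hoare_set_seq W_le).
      by sim; rewrite a1 a2 a5 m0 mk; do ?split; first [exact: W1|exact: W2].
    apply: (hoare_set_seq W_le).
      by sim; rewrite a1 a3 a5 m0 mk; do ?split; first [exact: W1|exact: W2|exact: W3].
    apply: (hoare_set W_le); first by sim; rewrite a1; clear -Wl kn; repeat split; lia.
    split; sim; rewrite ?a1 ?a2 ?a3 ?a5 ?m0 ?mk ?addn1 ?big_nat_recr //=.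
    by do 3?[apply: keep_set].
- by sim; clear -sn; lia.
- by move=> s' [a1 a2 a3 a4 a5].
Qed.

Lemma run_check s0 m1 m2 : has_params n N s0 -> reg s0 0 = n -> mem s0 = mm -> m1 <= n -> m2 <= n ->
  reg s0 13 = m1 %/ p -> reg s0 14 = m1 %% p -> reg s0 15 = m2 %% p -> reg s0 16 = m2 %/ p ->
  hoare w dr check_prog s0 (300 * K.+1) [::] (fun s' =>
    [/\ reg s' 27 = all (ok m1 m2) (iota 0 K), keep [:: 9; 16; 17; 18; 19; 27] s0 s' & mem s' = mm]).
Proof.
move=> hp r0 m0 m1n m2n s13 s14 s15 s16; have Wl := W_lin W_big.
have [_ _ _ Kn [hn _ Kh ln]] := bounds; rewrite -/K -/h -/l in Kn hn Kh ln.
have [s2 _ _ _ [_ _ _]] := hp.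
have W1 x : x <= 5 * n + 1 -> x < W by clear -Wl; lia.
have W2 x : x <= n * n -> x < W by clear -Wl; lia.
have W3 x : x <= n * n + 5 * n -> x < W by clear -Wl; lia.
have bW (b : bool) : b < W by case: b; clear -Wl; lia.
pose I k s' := [/\ reg s' 9 = k, reg s' 16 = m2 %/ p %/ d ^ k.*2,
  reg s' 27 = all (ok m1 m2) (iota 0 k), keep [:: 9; 16; 17; 18; 19; 27] s0 s' & mem s' = mm].
apply: hoare_weaken.
  apply: (hoare_set_seq W_le); first by sim; apply: W1; clear; lia.
  apply: (hoare_set_seq W_le); first by sim; apply: W1.
  apply: (hoare_while0 W_le (m := K) (I := I)).
  - by split=> //; sim; rewrite ?divn1 //; do 2?[apply: keep_set].
  - move=> k s1 ks [a1 a2 a3 a4 a5]; sim; rewrite a1 (a4 2) // s2.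
    split; last by case: (k < _).
    by do ?split; first [exact: bW|apply: W1; clear -ks Kn; lia].
  - move=> k s1 ks [a1 a2 a3 a4 a5].
    have hp1 : has_params n N s1 by move: hp; rewrite /has_params !a4.
    apply: hoare_seq0.
      by apply: (run_pair dr W_le W_big n_pos t22 tN (q := k) (m1 := m1) (m2 := m2)) => //; rewrite a4.
    move=> s3 [b1 b2 b3 b4 b5].
    have hp3 : has_params n N s3 by move: hp1; rewrite /has_params !b4.
    have [_ _ _ _ [t6 t7 _]] := hp3; rewrite -/h -/l in t6 t7.
    have t9 : reg s3 9 = k by rewrite b4.
    have t0 : reg s3 0 = n by rewrite b4 // a4.
    have t27 : reg s3 27 = all (ok m1 m2) (iota 0 k) by rewrite b4.
    have tm : mem s3 = mm by rewrite b5.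
    have l1 : left_cut p d m1 m2 k <= n * n by apply: (point_le n_pos t22 tN).
    have l2 : right_cut p d m1 m2 k <= n * n by apply: (point_le n_pos t22 tN).
    rewrite -/p -/d in b1 b2; set x := left_cut p d m1 m2 k in b1 l1;
      set y := right_cut p d m1 m2 k in b2 l2.
    have kh : k * h <= n by apply: leq_trans Kh; rewrite leq_mul2r ltnW ?orbT.
    have okE : ok m1 m2 k = cut_ok n h l pos_of cs_of e_of k x y by [].
    pose Q s' := [/\ reg s' 9 = k, reg s' 16 = m2 %/ p %/ d ^ k.+1.*2,
      reg s' 27 = all (ok m1 m2) (iota 0 k.+1), keep [:: 9; 16; 17; 18; 19; 27] s0 s' & mem s' = mm].
    have allE : all (ok m1 m2) (iota 0 k.+1) = all (ok m1 m2) (iota 0 k) && ok m1 m2 k.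
      by rewrite -[k.+1]addn1 iotaD all_cat /= andbT.
    have fq (v : nat) : v = all (ok m1 m2) (iota 0 k) && ok m1 m2 k -> Q (set_reg s3 27 v).
      move=> ->; rewrite -allE; split; sim=> //.
      by apply: keep_set => //; apply: (keep_trans _ a4 b4).
    apply: (hoare_seq0 (T1 := 150) (Q1 := Q)).
      apply: (hoare_weaken (T := (ecost inner_expr + 100).+1) (Q := Q)); [|by []|by []].
      apply: (hoare_if W_le).
        sim; rewrite t0 t9 t6 tm subn1.
        have h1 := mm_le (3 * n + k * h); have h2 := mm_le (3 * n + (k * h + h.-1)).
        have h3 := mm_le (2 * n + mm (3 * n + k * h));
          have h4 := mm_le (2 * n + mm (3 * n + (k * h + h.-1))).
        have kn : k <= n by apply: ltnW; apply: leq_trans Kn.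
        do ?split; first [exact: bW|apply: W1; clear -h1 h2 h3 h4 kh hn kn n_pos; lia].
      have -> : (value s3 inner_expr != 0) = (cs_of (e_of (k * h)) == cs_of (e_of (k * h + h.-1))).
        by sim; rewrite t0 t9 t6 tm subn1 eqb0 negbK.
      rewrite okE /cut_ok in fq; case: ifP fq => _ fq; last first.
        apply: (hoare_weaken (T := 20)); [|by []|by move=> s'; exact: id].
        apply: (hoare_weaken (T := (ecost ($27 * ($18 == $19))%prog).+1)); [|by []|by move=> s';
          exact: id].
        apply: (hoare_set W_le).
          by sim; rewrite t27 b1 b2; do ?split; rewrite ?mulnb; first [exact: bW|exact: W2].
        by sim; apply: fq; rewrite t27 b1 b2 mulnb.
      apply: (hoare_weaken (T := (ecost ($27 * sides_expr)%prog).+1)); [|by []|by move=> s'; exact: id].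
      apply: (hoare_set W_le).
        sim; rewrite t0 t9 t6 t7 t27 b1 b2 tm; rewrite !subn1.
        have h1 : (mm (n + x)).-1 <= n by rewrite (leq_trans (leq_pred _)).
        have h2 : (mm (n + y)).-1 <= n by rewrite (leq_trans (leq_pred _)).
        have h3 := mm_le (n + x); have h4 := mm_le (n + y).
        have kn : k <= n by apply: ltnW; apply: leq_trans Kn.
        have h5 := leq_trans (leq_div _ h) h1; have h6 := leq_trans (leq_div _ h) h2.
        have h7 := leq_trans (leq_mod _ h) h1; have h8 := leq_trans (leq_mod _ h) h2.
        have h9 : h - l <= n by apply: leq_trans hn; apply: leq_subr.
        have h10 : 1 <= n by [].
        have W1' z : z <= n -> z < W by move=> zn; apply: W1; clear -zn; lia.
        have b0 (b : bool) : (nat_of_bool b == 0) = ~~ b by case: b.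
        have W3x : n + x < W by apply: W3; clear -l1; lia.
        have W3y : n + y < W by apply: W3; clear -l2; lia.
        have W0 : 0 < W by apply: W1.
        by do ?split; rewrite ?b0 ?mulnb; first [exact: bW|exact: W1'|exact: W2|exact: W3x|exact:
          W3y|exact: W0].
      sim; apply: fq; rewrite t0 t9 t6 t7 t27 b1 b2 tm !subn1.
      have b0 (b : bool) : (nat_of_bool b == 0) = ~~ b by case: b.
      by rewrite b0 !mulnb -leqNgt.
    move=> s4 [c1 c2 c3 c4 c5]; apply: (hoare_set W_le).
      by sim; rewrite c1; do ?split; apply: W1; clear -ks Kn; lia.
    by split; sim=> //; [rewrite c1 addn1|apply: keep_set].
- by sim; clear; lia.
- by move=> s' [a1 a2 a3 a4 a5].
Qed.

Let S1 := \sum_(0 <= j < s) c j.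
Let S2 := \sum_(0 <= j < s) j * c j.
Let acc a b := all (ok (swapped1 s N1 c a b) (swapped2 s c a b)) (iota 0 K).

Definition search_regs := [:: 9; 10; 11; 13; 14; 15; 16; 17; 18; 19; 24; 25; 26; 27].

Definition searching s0 a := [/\ has_params n N s0, reg s0 0 = n, reg s0 21 = S1, reg s0 22 = S2 &
  reg s0 23 = a /\ mem s0 = mm].

Lemma searching_keep s0 s1 a : searching s0 a -> keep search_regs s0 s1 -> mem s1 = mm -> searching s1
  a.
Proof.
by case=> hp r0 r21 r22 [r23 _] k m1; split; rewrite ?k //; move: hp; rewrite /has_params !k.
Qed.

Lemma run_try s0 a b : searching s0 a -> reg s0 24 = b -> a < s -> b < n ->
  hoare w dr try_prog s0 (500 * K.+1) [::] (fun s' =>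
    [/\ reg s' 24 = b.+1, reg s' 25 = (if acc a b then a else reg s0 25),
      reg s' 26 = (if acc a b then b else reg s0 26), keep search_regs s0 s' & mem s' = mm]).
Proof.
move=> [hp r0 r21 r22 [r23 m0]] r24 a_s bn; have Wl := W_lin W_big.
have [_ _ sn Kn [_ /andP[N1_0 N1n] _ _]] := bounds; rewrite -/s -/K -/N1 in sn Kn N1_0 N1n.
have an : a < n by apply: leq_trans sn.
have [h1 h2] := sums_le c_lt sn; rewrite -/S1 -/S2 in h1 h2.
have ca := c_lt an; have cb := c_lt bn; have mb := mmc bn; have ma := mmc an.
have aca : a * c a <= n * n by apply: leq_mul; apply: ltnW.
have acb : a * c b <= n * n by apply: leq_mul; apply: ltnW.
set m1 := swapped1 s N1 c a b; set m2 := swapped2 s c a b.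
have m1E : (S1 + c b - c a) %% N1 = m1 by [].
have m2E : (S2 + a * c b - a * c a) %% s = m2 by [].
have m1n : m1 <= n by apply: leq_trans N1n; apply/ltnW/ltn_pmod.
have m2n : m2 <= n by apply: leq_trans sn; apply/ltnW/ltn_pmod; apply: leq_ltn_trans a_s.
have [_ r3 _ _ [_ _ r8]] := hp; rewrite -/s -/N1 in r3 r8.
have W1 x : x <= n * n + 5 * n -> x < W by clear -Wl; lia.
have W2 x : x <= n * n * n + n * n -> x < W by clear -Wl; lia.
have le3 : S2 + a * c b - a * c a <= n * n * n + n * n by clear -h2 acb; lia.
set R := fun _ : state => _.
apply: (hoare_weaken (Q := R)); [| |by []].
  apply: (hoare_set_seq W_le).
    sim; rewrite r21 r24 r23 m0 mb ma r8 m1E.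
    by do ?split; apply: W1; clear -h1 ca cb an bn m1n N1n; lia.
  sim; rewrite r21 r24 r23 m0 mb ma r8 m1E.
  apply: (hoare_set_seq W_le).
    sim; rewrite r22 r24 r23 m0 mb ma r3 m2E.
    by do ?split; first [apply: W1; clear -aca acb ca cb an bn m2n sn; lia|
      apply: W2; clear -h2 acb; lia].
  sim; rewrite r22 r24 r23 m0 mb ma r3 m2E.
  apply: hoare_seq0.
    by apply: (run_decode dr W_le W_big n_pos t22 tN (m1 := m1) (m2 := m2)).
  move=> s2 [b1 b2 b3 b4 [b5 b6]].
  apply: hoare_seq0.
    apply: (run_check (m1 := m1) (m2 := m2)) => //.
    - by move: hp; rewrite /has_params !b5.
    - by rewrite b5.
    - by rewrite b6.
  move=> s3 [c1 c2 c3]; rewrite -/(acc a b) in c1.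
  have k3 x : x \notin search_regs -> reg s3 x = reg s0 x.
    rewrite /search_regs !inE !negb_or => /and5P[x9 x10 x11 x13 /and5P[x14 x15 x16 x17 /and5P[x18 x19
      x24 x25 /andP[x26 x27]]]].
    rewrite c2 ?inE ?negb_or ?x9 ?x16 ?x17 ?x18 ?x19 ?x27 //.
    rewrite b5 ?inE ?negb_or ?x13 ?x14 ?x15 ?x16 //; sim.
    by rewrite (negbTE x10) (negbTE x11).
  have k23 : reg s3 23 = a by rewrite k3.
  have k24 : reg s3 24 = b by rewrite c2 // b5.
  have k25 : reg s3 25 = reg s0 25 by rewrite c2 // b5.
  have k26 : reg s3 26 = reg s0 26 by rewrite c2 // b5.
  pose Q s' := [/\ reg s' 24 = b, reg s' 25 = (if acc a b then a else reg s0 25),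
    reg s' 26 = (if acc a b then b else reg s0 26), keep search_regs s0 s' & mem s' = mm].
  apply: (hoare_seq0 (T1 := 20) (Q1 := Q)).
    apply: (hoare_weaken (T := (ecost ($27)%prog + 10).+1) (Q := Q)); [|by []|by []].
    apply: (hoare_if W_le).
      by sim; rewrite c1; case: (acc a b); apply: W1; clear -an; lia.
    rewrite [value _ _]/= c1 /Q; case: (acc a b) => /=.
      apply: (hoare_weaken (T := 6)); [|by []|by move=> s'; exact: id].
      apply: (hoare_weaken (T := ((ecost ($23)%prog).+1 + (ecost ($24)%prog).+1).+1));
        [|by []|by move=> s'; exact: id].
      apply: (hoare_set_seq W_le); first by sim; rewrite k23; apply: W1; clear -an; lia.
      apply: (hoare_set W_le); first by sim; rewrite k24; apply: W1; clear -bn; lia.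
      by split; sim=> //; do 2?[apply: keep_set => //].
    apply: (hoare_weaken (T := 1)); [|by []|by move=> s'; exact: id].
    by apply: hoare_skip.
  move=> s4 [d1 d2 d3 d4 d5]; apply: (hoare_set W_le).
    by sim; rewrite d1; do ?split; apply: W1; clear -bn; lia.
  by rewrite /R; split; sim=> //; [rewrite d1 addn1|apply: keep_set].
by sim; clear; lia.
Qed.

Definition found s' := [/\ reg s' 25 < s, s <= reg s' 26, reg s' 26 < n & acc (reg s' 25) (reg s' 26)].

Lemma run_search s0 : searching s0 (reg s0 23) -> (exists a b, [/\ a < s, s <= b, b < n & acc a b]) ->
  hoare w dr search_prog s0 (2000 * (s.+1 * (n.+1 * K.+1))) [::] (fun s' => exists a b,
    [/\ a < s, s <= b, b < n, acc a b & reg s' 0 = a /\ reg s' 1 = b]).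
Proof.
move=> sr [a0 [b0 [a0s sb0 b0n acc0]]]; have Wl := W_lin W_big.
have [_ _ sn Kn _] := bounds; rewrite -/s -/K in sn Kn.
have W1 x : x <= n + 1 -> x < W by clear -Wl; lia.
have bW (b : bool) : b < W by apply: W1; case: b; rewrite ?addn1.
(* The pairs are compared in the lexicographic order in which the two loops visit them; the current
   pair is [(k, s + j)]. *)
pose none k j := forall a b, a < s -> s <= b -> b < n -> (a < k) || (a == k) && (b < s + j) -> ~~ acc
  a b.
pose I k s' := searching s' k /\ (found s' \/ none k 0).
pose J k j s' := [/\ searching s' k, reg s' 24 = s + j & found s' \/ none k j].
set R := fun _ : state => _.
apply: (hoare_weaken (Q := R)); [| |by []].
  apply: (hoare_set_seq W_le); first by sim; apply: W1.
  apply: (hoare_set_seq W_le); first by sim; apply: W1.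
  apply: (hoare_set_seq W_le); first by sim; apply: W1.
  apply: hoare_seq0.
    apply: (hoare_while0 W_le (m := s) (I := I)).
    - split; first by case: sr => hp ? ? ? [_ ?]; split.
      right=> a b _ sb _; rewrite addn0 ltn0 /= => /andP[_ bs].
      by move: sb; rewrite leqNgt bs.
    - move=> k s1 ks [[hp r0 r21 r22 [r23 m0]] _]; have [_ r3 _ _ _] := hp; rewrite -/s in r3.
      sim; rewrite r23 r3; split; last by case: (k < s).
      by do ?split; first [exact: bW|apply: W1; clear -ks sn; lia].
    - move=> k s1 ks [sr1 inv]; have [hp1 r0 r21 r22 [r23 m0]] := sr1; have [_ r3 _ _ _] := hp1;
      rewrite -/s in r3.
      apply: (hoare_set_seq W_le); first by sim; rewrite r3; apply: W1; clear -sn; lia.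
      apply: (hoare_seq0 (T1 := 600 * (n.+1 * K.+1)) (Q1 := J k (n - s))).
        apply: (hoare_weaken (Q := J k (n - s))).
          apply: (hoare_while0 W_le (m := n - s) (I := J k)).
          + split; [by apply: (searching_keep sr1) => //; apply: keep_set|by sim;
            rewrite addn0|exact: inv].
          + move=> j s2 js [[_ p0 _ _ _] p24 _]; sim; rewrite p0 p24; split.
              by do ?split; first [exact: bW|apply: W1; clear -js sn; lia].
            by rewrite ltn_subRL; case: (_ < n).
          + move=> j s2 js [sr2 p24 inv2]; have bn : s + j < n by rewrite -ltn_subRL.
            apply: hoare_weaken (run_try sr2 p24 ks bn) (leqnn _) _ => s3 [c1 c2 c3 c4 c5].
            split; [exact: searching_keep c4 c5|by rewrite addnS|].
            case: (boolP (acc k (s + j))) c2 c3 => [ac|nac] c2 c3.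
              by left; rewrite /found c2 c3 leq_addr.
            case: inv2 => [fd|no]; [by left; rewrite /found c2 c3|right=> a b a_s sb b_n].
            case/orP => [ak|/andP[/eqP ->]]; first by apply: no; rewrite ?ak.
            rewrite addnS ltnS leq_eqVlt => /orP[/eqP -> //|bs]; apply: no; rewrite ?eqxx ?bs ?orbT //.
        - by sim; clear; nia.
        - by [].
      move=> s2 [sr2 p24 inv2]; have [hp2 p0 p21 p22 [p23 pm]] := sr2.
      apply: (hoare_set W_le); first by sim; rewrite p23; do ?split; apply: W1; clear -ks sn; lia.
      split; first by split; [exact: hp2|exact: p0|exact: p21|exact: p22|sim; rewrite p23 addn1].
      case: inv2 => [fd|no]; [by left|right=> a b a_s sb b_n].
      rewrite ltnS leq_eqVlt addn0 => /orP[/orP[/eqP ->|ak]|/andP[_]]; last by rewrite ltnNge sb.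
        by apply: no; rewrite ?eqxx // subnKC ?b_n ?orbT.
      by apply: no; rewrite ?ak.
  move=> s1 [[hp r0 r21 r22 [r23 m0]] inv].
  have [f1 f2 f3 f4] : found s1.
    by case: inv => // no; move: acc0; rewrite (negbTE (no _ _ a0s sb0 b0n _)) // a0s.
  apply: (hoare_set_seq W_le); first by sim; apply: W1; clear -f1 sn; lia.
  apply: (hoare_set W_le); first by sim; apply: W1; clear -f3; lia.
  by exists (reg s1 25), (reg s1 26).
by sim; clear; nia.
Qed.
End Spy.

(** * The strategy *)

Section Strategy.
Variables (n N : nat).
Implicit Types (sigma tau : {perm 'I_n}) (i : 'I_n).

Let K := num_blocks n N.
Let s := num_reads n N.
Let p := field_size n N.
Let d := digit_base n N.
Let N1 := num_vals n N.

Definition contents tau z := odflt 0 (drawer_of tau z).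

Lemma drawer_contents tau z : z < n -> drawer_of tau z = Some (contents tau z).
Proof. by move=> zn; rewrite /contents /drawer_of; case: insubP => //=; rewrite zn. Qed.

Lemma contents_val tau (z : 'I_n) : contents tau z = tau z.
Proof. by rewrite /contents /drawer_of valK. Qed.

Lemma contents_lt tau z : z < n -> contents tau z < n.
Proof. by move=> zn; have /= -> := contents_val tau (Ordinal zn); apply: ltn_ord. Qed.

Definition decoded (c : nat -> nat) z :=
  swaps K (left_cut p d (msg1 s N1 c) (msg2 s c)) (right_cut p d (msg1 s N1 c) (msg2 s c)) z.

(** The modification depends on the first [s] contents only, and these are what a prisoner's history
    provides. *)
Lemma eq_decoded (c c' : nat -> nat) z : (forall j, j < s -> c j = c' j) -> decoded c z = decoded c' z.
Proof.
move=> cc; have E w : \sum_(0 <= j < s) w j * c j = \sum_(0 <= j < s) w j * c' j.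
  by apply: eq_big_nat => j /andP[_ js]; rewrite cc.
have E1 : \sum_(0 <= j < s) c j = \sum_(0 <= j < s) c' j.
  by apply: eq_big_nat => j /andP[_ js]; rewrite cc.
by rewrite /decoded /msg2 /msg1 (E id) E1.
Qed.

(** The length of the history shows the phase. [z] is the last content seen after the first [s]
    drawers, by default [i] at the beginning of the walk; the test [s < size hist] prevents stopping
    on this default. *)
Definition next_drawer i (hist : seq ('I_n * 'I_n)) : option 'I_n :=
  if size hist < s then insub (size hist) else
  let z := last i (map snd (drop s hist)) in
  if (s < size hist) && (z == i) then None
  else insub (decoded (fun j => nth 0 [seq val x.2 | x <- hist] j) z).

Definition history tau (ds : seq 'I_n) := [seq (j, tau j) | j <- ds].

Lemma size_history tau ds : size (history tau ds) = size ds.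
Proof. exact: size_map. Qed.

Lemma opens_fromP f tau h ds :
  (forall k (j : 'I_n), k < size ds -> f (h ++ history tau (take k ds)) = Some (nth j ds k)) ->
  f (h ++ history tau ds) = None -> opens_from f tau h ds.
Proof.
elim: ds h => [|j ds IH] h fS fN /=; first by rewrite cats0 in fN.
split; first by have := fS 0 j isT; rewrite /= cats0.
apply: IH => [k i ks|]; last by rewrite cat_rcons.
by rewrite cat_rcons; have := fS k.+1 i; apply.
Qed.

Section Run.
Variables (tau : {perm 'I_n}).
Hypothesis (sn : s <= n).
Hypothesis dec_lt : forall z, z < n -> decoded (contents tau) z < n.

Definition dec (z : 'I_n) : 'I_n := Ordinal (dec_lt (ltn_ord z)).
Definition step z := tau (dec z).

Lemma step_inj : injective step.
Proof.
by move=> y z /perm_inj /(congr1 val) /= /swaps_inj /val_inj.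
Qed.

Lemma val_step z : val (step z) = contents tau (decoded (contents tau) z).
Proof. by rewrite -[decoded _ _]/(val (dec z)) contents_val. Qed.

Definition first_drawers : seq 'I_n := [seq widen_ord sn j | j <- enum 'I_s].
Definition cycle_drawers i := [seq dec (iter k step i) | k <- iota 0 (fingraph.order step i)].
Definition opened i := first_drawers ++ cycle_drawers i.

Lemma val_first_drawers : map val first_drawers = iota 0 s.
Proof. by rewrite -map_comp -val_enum_ord; apply: eq_map. Qed.

Lemma size_first_drawers : size first_drawers = s.
Proof. by rewrite size_map size_enum_ord. Qed.

Lemma nth_first_drawers (j : 'I_n) k : k < s -> val (nth j first_drawers k) = k.
Proof.
move=> ks; rewrite -(nth_map j 0 val) ?size_first_drawers // val_first_drawers.
by rewrite nth_iota.
Qed.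

Lemma size_opened i : size (opened i) = s + fingraph.order step i.
Proof. by rewrite size_cat size_first_drawers size_map size_iota. Qed.

Lemma last_cycle i k : last i [seq (tau x) | x <- take k (cycle_drawers i)] =
  iter (minn k (fingraph.order step i)) step i.
Proof.
rewrite /cycle_drawers -map_take -map_comp take_iota.
case: (minn k _) => // m.
by rewrite -[in LHS]addn1 iotaD map_cat last_cat.
Qed.

Lemma iter_step_neq i k : 0 < k < fingraph.order step i -> iter k step i != i.
Proof.
move=> /andP[k0 ko]; apply/eqP => E.
have := findex_iter ko; rewrite E findex0 => k00.
by rewrite -k00 in k0.
Qed.

Lemma next_after_first i k : k <= fingraph.order step i ->
  next_drawer i (history tau first_drawers ++ history tau (take k (cycle_drawers i))) =
  if k == fingraph.order step i then None else Some (dec (iter k step i)).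
Proof.
move=> ko; have m0 := fingraph.order_gt0 step i.
have sk : size (take k (cycle_drawers i)) = k by rewrite size_takel // size_map size_iota.
rewrite /next_drawer size_cat !size_history size_first_drawers ltnNge leq_addr /= sk.
rewrite drop_size_cat ?size_history ?size_first_drawers // -map_comp.
rewrite (eq_map (_ : _ =1 tau)) // last_cycle (minn_idPl ko).
rewrite -[X in X < _]addn0 ltn_add2l.
have [->|k_o] := eqVneq k (fingraph.order step i).
  by rewrite m0 iter_order ?eqxx //; exact: step_inj.
have -> : (0 < k) && (iter k step i == i) = false.
  apply/negP => /andP[k0 /eqP E]; have := @iter_step_neq i k; rewrite k0 E eqxx ltn_neqAle k_o ko.
  by move/(_ isT).
have <- : val (dec (iter k step i)) =
    decoded (fun j => nth 0 [seq val x.2 | x <- history tau first_drawers ++ history tau (take k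
      (cycle_drawers i))] j) (iter k step i).
  apply: eq_decoded => j js; rewrite map_cat nth_cat size_map size_history size_first_drawers js.
  rewrite -map_comp (nth_map (iter k step i)) ?size_first_drawers //=.
  by rewrite -[RHS]contents_val nth_first_drawers.
by rewrite valK.
Qed.

Lemma opens_opened i : opens_from (next_drawer i) tau [::] (opened i).
Proof.
have sc : size (cycle_drawers i) = fingraph.order step i by rewrite size_map size_iota.
apply: opens_fromP => [k j|]; rewrite cat0s.
  rewrite size_opened => ko; case: (ltnP k s) => [ks|sk].
    have kt : size (take k first_drawers) = k by rewrite size_takel // size_first_drawers ltnW.
    rewrite /opened take_cat nth_cat size_first_drawers ks /next_drawer size_history kt ks.
    by rewrite -{1}(nth_first_drawers j ks) valK.
  rewrite /opened take_cat nth_cat size_first_drawers ltnNge sk /= /history map_cat.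
  have k' : k - s < fingraph.order step i by rewrite ltn_subLR.
  rewrite next_after_first ?(ltnW k') // (ltn_eqF k') (nth_map 0) ?size_iota // nth_iota //.
rewrite /opened /history map_cat -[cycle_drawers i]take_size sc next_after_first //.
by rewrite eqxx.
Qed.

Lemma finds_opened i : finds i tau (opened i).
Proof.
have m0 := fingraph.order_gt0 step i.
(* The drawer visited last: its content closes the cycle at [i]. *)
exists (dec (iter (fingraph.order step i).-1 step i)).
  rewrite mem_cat; apply/orP; right; apply/mapP; exists (fingraph.order step i).-1 => //.
  by rewrite mem_iota /= add0n prednK.
by rewrite -[LHS]/(step _) -iterS prednK // iter_order //; exact: step_inj.
Qed.

Lemma val_opened i : map val (opened i) = iota 0 s ++
  [seq decoded (contents tau) (iter k (fun z => contents tau (decoded (contents tau) z)) i) |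
    k <- iota 0 (fingraph.order step i)].
Proof.
rewrite map_cat val_first_drawers; congr (_ ++ _); rewrite -map_comp; apply: eq_map => k /=.
congr (decoded _ _); elim: k => //= k <-; exact: val_step.
Qed.

Lemma iter_val_step k i : iter k (fun z => contents tau (decoded (contents tau) z)) i = iter k step i.
Proof. elim: k => //= k ->; symmetry; exact: val_step. Qed.
End Run.
End Strategy.

(** The first clause allows the walk to be formed on ['I_n]. The second quantifies over every [f]
    with the right values, so it does not depend on how that walk is packaged. *)
Definition cycles_le n N (tau : {perm 'I_n}) B :=
  (forall z, z < n -> decoded n N (contents tau) z < n) /\
  forall f : 'I_n -> 'I_n, (forall z, val (f z) = contents tau (decoded n N (contents tau) z)) ->
  forall i, fingraph.order f i <= B.

Lemma cycles_le_small n N (tau : {perm 'I_n}) : n < N -> cycles_le N tau n.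
Proof.
move=> nN; split=> [z zn|f _ i]; first by rewrite /decoded /num_blocks nN.
by apply: leq_trans (max_card _) _; rewrite card_ord.
Qed.

(** * Cycle lengths in the assignment after the swap *)

Section Large.
Variables (n t N : nat).
Hypothesis (t22 : 22 <= t) (tN : 2 ^ (2 ^ t) <= N) (Nn : N <= n).

Let K := num_blocks n N.
Let s := num_reads n N.
Let p := field_size n N.
Let d := digit_base n N.
Let h := block_len n N.
Let l := side_len n N.
Let N1 := num_vals n N.

Let nl : 2 ^ (2 ^ t) <= n. Proof. exact: leq_trans Nn. Qed.

Let params_large : [/\ K = blocks n, s = 2 ^ reads_log n, p = modulus n, d = 2 ^ delta n &
  [/\ h = n %/ blocks n, l = n %/ blocks n %/ blocks n & N1 = n - n %% 2 ^ reads_log n]].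
Proof.
by rewrite /K /s /p /d /h /l /N1 /num_blocks /num_reads /field_size /digit_base /block_len /side_len
  /num_vals ltnNge Nn.
Qed.

Let side_conditions : [/\ K * h <= n, n < K.+1 * h, K * l <= h, l.*2 <= h & 0 < h].
Proof.
have [-> _ _ _ [-> -> _]] := params_large.
have [h1 h2 h3] := blocks_h t22 nl; have [h4 h5 _] := blocks_l t22 nl.
split=> //; apply: leq_trans h3; apply: ltnW; exact: (blocks_gt1 t22 nl).
Qed.

Lemma contents_swap (sigma : {perm 'I_n}) (a b : 'I_n) z : z < n ->
  contents (tperm a b * sigma)%g z = contents sigma (swp a b z).
Proof.
move=> zn; have /= -> := contents_val (tperm a b * sigma)%g (Ordinal zn).
rewrite permM /swp; case: tpermP => [/(congr1 val)/= ->|/(congr1 val)/= ->|/eqP za /eqP zb].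
- by rewrite eqxx contents_val.
- by rewrite eqxx; case: eqP => [E|_]; rewrite contents_val // (val_inj E).
- rewrite -val_eqE /= in za; rewrite -val_eqE /= in zb; rewrite (negbTE za) (negbTE zb).
  exact: (esym (contents_val sigma (Ordinal zn))).
Qed.

(** The prisoners read, after the swap, exactly the message that the spy predicted from [sigma]. *)
Lemma msgs_swap (sigma : {perm 'I_n}) (a b : 'I_n) : a < s -> s <= b ->
  msg1 s N1 (contents (tperm a b * sigma)%g) = swapped1 s N1 (contents sigma) a b /\
  msg2 s (contents (tperm a b * sigma)%g) = swapped2 s (contents sigma) a b.
Proof.
move=> a_s sb; have sn : s <= n by rewrite (leq_trans sb) // ltnW.
have E w : \sum_(0 <= j < s) w j * contents (tperm a b * sigma)%g j =
    \sum_(0 <= j < s) w j * contents sigma j + w a * contents sigma b - w a * contents sigma a.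
  rewrite -sum_swapped //; apply: eq_big_nat => j /andP[_ js].
  by rewrite contents_swap // (leq_trans js).
split; last by rewrite /msg2 /swapped2 (E id).
rewrite /msg1 /swapped1; congr (_ %% _).
have one c : \sum_(0 <= j < s) 1 * c j = \sum_(0 <= j < s) c j by apply: eq_bigr => j _; rewrite mul1n.
by have := E (fun=> 1); rewrite !one !mul1n.
Qed.

Variables (sigma : {perm 'I_n}) (pos cs e : nat -> nat).
Hypothesis ord : cycle_order n (contents sigma) pos cs e.

Let c := contents sigma.
Definition accepted a b := all (fun q => cut_ok n h l pos cs e q
  (left_cut p d (swapped1 s N1 c a b) (swapped2 s c a b) q)
  (right_cut p d (swapped1 s N1 c a b) (swapped2 s c a b) q)) (iota 0 K).

Lemma accepted_exists : exists a b, [/\ a < s, s <= b, b < n & accepted a b].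
Proof.
have [EK Es Ep Ed [Eh El E1]] := params_large.
have [p_pr p2 np] := modulusP n.
have n0 : 0 < n := n_gt0 nl.
pose cinv v : nat := (sigma^-1)%g (insubd (Ordinal n0) v).
have cinvP v : v < n -> cinv v < n /\ c (cinv v) = v.
  move=> vn; split; first exact: ltn_ord.
  by rewrite /c /cinv contents_val permKV val_insubd vn.
have r0 : 0 < reads_log n by have := lb_b t22 nl; rewrite /reads_log; lia.
have [Kh nKh KK] := blocks_h t22 nl; have [Kl l2 _] := blocks_l t22 nl.
have lh : n %/ blocks n %/ blocks n <= n %/ blocks n by apply: leq_div.
have [a [b [h6 h7 h8 ok]]] := exists_swap p_pr p2 (expn_gt0 2 _ : 0 < 2 ^ delta n) (base_le t22 nl) np
  r0
  (reads_le t22 nl) Kh lh (messages_le t22 nl) (room_for_swap t22 nl) ord cinvP.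
exists a, b; rewrite /accepted EK Es Ep Ed Eh El E1; split=> //.
by apply/allP => q; rewrite mem_iota => /andP[_ qK]; apply: ok.
Qed.

(** The cuts are chosen for the cycles of [sigma], whereas the prisoners walk in [tau]. The two
    walks differ only by exchanging the images of the two drawers that the cuts send to [a] and [b],
    so the bound [4 * h] doubles. *)
Lemma accepted_cycles_le (a b : 'I_n) : a < s -> s <= b -> accepted a b ->
  cycles_le N (tperm a b * sigma)%g (8 * h).
Proof.
move=> a_s sb /allP acc; have [h1 h2 h3 h4 h5] := side_conditions.
set tau := (tperm a b * sigma)%g; have [e1 e2] := msgs_swap sigma a_s sb.
pose px := left_cut p d (swapped1 s N1 c a b) (swapped2 s c a b).
pose py := right_cut p d (swapped1 s N1 c a b) (swapped2 s c a b).
have decE z : decoded n N (contents tau) z = swaps K px py z.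
  by rewrite /decoded -/K -/s -/N1 -/p -/d e1 e2.
have ok q : q < K -> cut_ok n h l pos cs e q (px q) (py q).
  by move=> qK; apply: acc; rewrite mem_iota.
have pi_lt z : z < n -> swaps K px py z < n by move=> zn; apply: (swaps_lt ok).
split=> [z zn|g gE i]; first by rewrite decE pi_lt.
pose pi (z : 'I_n) := Ordinal (pi_lt z (ltn_ord z)).
have pi_inj : injective pi by move=> y z /(congr1 val) /= /swaps_inj /val_inj.
pose f z := sigma (pi z).
have f_inj : injective f by move=> y z /perm_inj /pi_inj.
have fE z : val (f z) = contents sigma (swaps K px py z).
  exact: (esym (contents_val sigma (pi z))).
have gfE z : g z = tau (pi z).
  by apply: val_inj; rewrite gE decE; exact: (contents_val tau (pi z)).
have [pi' piK pi'K] := injF_bij pi_inj.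
have -> : 8 * h = (4 * h).*2 by lia.
apply: (order_transpose (f := f) (u := pi' a) (v := pi' b)) => //.
- by move=> z; apply: (order_cuts ord h5 h4 h1 h2 ok z fE f_inj h3).
- by rewrite gfE /f !pi'K permM tpermL.
- by rewrite gfE /f !pi'K permM tpermR.
- move=> z za zb; rewrite gfE permM tpermD //.
    by apply: contra za => /eqP ->; rewrite piK.
  by apply: contra zb => /eqP ->; rewrite piK.
Qed.
End Large.

Section RunSpy.
Variables (w W n t N : nat) (sigma : {perm 'I_n}).
Hypothesis (W_le : W <= 2 ^ w) (W_big : 200 * n.+1 ^ 3 <= W) (n_pos : 0 < n).
Hypothesis (t22 : 22 <= t) (tN : 2 ^ (2 ^ t) <= N) (N_lt : N < W).

Lemma run_spy_large : N <= n ->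
  hoare w no_drawer (spy_prog N) (spy_input sigma) (100 * (1000 * n ^ 2)) [::]
    (fun s' => exists a b : 'I_n, [/\ reg s' 0 = a, reg s' 1 = b &
      cycles_le N (tperm a b * sigma)%g (8 * block_len n N)]).
Proof.
move=> Nn.
have nl : 2 ^ (2 ^ t) <= n by apply: leq_trans Nn.
set R := fun _ : state => _.
apply: (hoare_weaken (Q := R)); [| |by []].
  apply: (hoare_if W_le); first by rewrite /= (ltnNge n N) Nn; have := W_lin W_big; clear -N_lt;
    repeat split; lia.
  rewrite /= (ltnNge n N) Nn /=.
  apply: hoare_seq0; first by apply: (run_params _ W_le W_big t22 tN N_lt).
  move=> s1 [hp k1 m1].
  apply: hoare_seq0.
    apply: (run_order (c := contents sigma) (f := sigma) _ W_le W_big).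
    - by move=> z; rewrite contents_val.
    - exact: perm_inj.
    - by rewrite k1.
    - by move=> z _; rewrite m1.
    - by move=> a na; rewrite m1 /= /drawer_of insubF // ltnNge na.
  move=> s2 [ord mc m_le k2].
  have hp2 : has_params n N s2 by move: hp; rewrite /has_params !k2.
  apply: hoare_seq0.
    apply: (run_sums (mm := mem s2) (c := contents sigma) _ W_big n_pos t22 tN) => //.
    - exact: contents_lt.
    - by case: hp2.
  move=> s3 [a1 a2 k3 m3].
  have hp3 : has_params n N s3 by move: hp2; rewrite /has_params !k3.
  apply: hoare_weaken.
    apply: (run_search (mm := mem s2) (c := contents sigma) _ W_big n_pos t22 tN) => //.
    - exact: contents_lt.
    - by split=> //; rewrite k3 // k2 // k1.
    - exact: (accepted_exists t22 tN Nn ord).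
  - exact: leqnn.
  move=> s4 [a [b [a_s sb bn acc [r0 r1]]]].
  have an : a < n by apply: ltn_trans (leq_trans a_s sb) bn.
  exists (Ordinal an), (Ordinal bn); split=> //.
  exact: (accepted_cycles_le t22 tN Nn ord).
have [EK Es] : num_blocks n N = blocks n /\ num_reads n N = 2 ^ reads_log n.
  by rewrite /num_blocks /num_reads ltnNge Nn.
have sK := reads_blocks t22 nl; have K1 := blocks_gt1 t22 nl.
have s1 : 0 < 2 ^ reads_log n by rewrite expn_gt0.
(* The search dominates; [s * K <= n] gives [(s + 1) * (K + 1) <= 4 * n]. *)
rewrite EK Es; have bound : (2 ^ reads_log n).+1 * (n.+1 * (blocks n).+1) <= 8 * n ^ 2.
  rewrite -mulnn; move: (2 ^ _) s1 (blocks n) sK K1 n_pos => x x1 k xK k1 n0.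
  have xk : x.+1 * k.+1 <= 4 * n.
    have := leq_pmulr x (ltnW k1); have := leq_pmull k x1.
    by move: xK; clear -n0; lia.
  have n2 : n.+1 <= 2 * n by clear -n0; lia.
  by rewrite mulnCA; apply: leq_trans (leq_mul n2 xk) _; clear; lia.
sim; move: bound; move: (_.+1 * (_.+1 * _.+1)) => X; rewrite -mulnn.
by clear -n_pos; nia.
Qed.

Lemma run_spy_small : n < N -> exists s',
  [/\ exists T, exec w no_drawer (spy_prog N) (spy_input sigma) T [::] s', reg s' 0 = 0 & reg s' 1 = 0].
Proof.
move=> nN; have Wl := W_lin W_big.
suff: exists T, hoare w no_drawer (spy_prog N) (spy_input sigma) T [::]
    (fun s' => reg s' 0 = 0 /\ reg s' 1 = 0).
  by case=> T [T' [s' [ex _ [r0 r1]]]]; exists s'; split=> //; exists T'.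
eexists; apply: (hoare_if W_le); first by rewrite /= nN; clear -N_lt Wl nN; repeat split; lia.
rewrite /= nN /=; apply: (hoare_set_seq W_le); first by sim; clear -Wl; lia.
by apply: (hoare_set W_le); first by sim; clear -Wl; lia.
Qed.
End RunSpy.

Import Order.TTheory GRing.Theory Num.Theory.

(** The literal [N] occurs in the programs and must fit into a word even for small [n], hence [N] in
    the factor. The 13 is 8 + 3 + 2: 8 bits for 200, 3 for the cube, 2 for the increments in the
    exponent. *)
Lemma word_bound n N : 200 * n.+1 ^ 3 + N.+1 <= 2 ^ word_size (N + 13) n.
Proof.
rewrite /word_size; set b := trunc_log 2 n.
have nb : n.+1 <= 2 ^ b.+1.
  case: (posnP n) => [->|n0]; first by rewrite expn_gt0.
  by have /andP[_] := trunc_log_bounds (isT : 1 < 2) n0.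
apply: (@leq_trans (2 ^ (8 + b.+1 * 3) + 2 ^ N.+1)).
  apply: leq_add; last exact/ltnW/ltn_expl.
  by rewrite expnD leq_mul // expnM leq_exp2r.
apply: (@leq_trans (2 ^ (8 + b.+1 * 3 + N.+1).+1)).
  by rewrite [leqRHS]expnS mul2n -addnn leq_add ?leq_exp2l ?leq_addr ?leq_addl.
rewrite leq_exp2l //; nia.
Qed.

Section Main.
Variables (t N : nat).
Hypothesis (t22 : 22 <= t) (tN : 2 ^ (2 ^ t) <= N).

Lemma strategy_exists n : 0 < n -> exists S : strategy n, forall sigma : {perm 'I_n},
  (exists T, spy_runs (N + 13) (spy_prog N) sigma (spy S sigma) T /\
     (N <= n -> T <= 100 * (1000 * n ^ 2))) /\
  (forall i, exists (ds : seq 'I_n) T, [/\ opens S i (after_swap S sigma) ds,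
     finds i (after_swap S sigma) ds,
     prisoner_runs (N + 13) (prisoner_prog N) i (after_swap S sigma) ds T,
     N <= n -> size ds <= num_reads n N + 8 * block_len n N &
     N <= n -> T <= 100 * (1000 * n ^ 2)]).
Proof.
move=> n_pos; set w := word_size (N + 13) n.
pose W := 200 * n.+1 ^ 3 + N.+1.
have W_le : W <= 2 ^ w := word_bound n N.
have W_big : 200 * n.+1 ^ 3 <= W by apply: leq_addr.
have N_lt : N < W by apply: leq_addl.
have spy_ok (sigma : {perm 'I_n}) : exists ab : 'I_n * 'I_n,
    (exists T, spy_runs (N + 13) (spy_prog N) sigma ab T /\ (N <= n -> T <= 100 * (1000 * n ^ 2))) /\
    cycles_le N (tperm ab.1 ab.2 * sigma)%g (if n < N then n else 8 * block_len n N).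
  case: (ltnP n N) => [nN|Nn].
    have [s' [[T ex] r0 r1]] := run_spy_small sigma W_le W_big N_lt nN.
    exists (Ordinal n_pos, Ordinal n_pos); split; last exact: cycles_le_small.
    by exists T; split; [exists s'|].
  have [T [s' [ex Tle [a [b [r0 r1 gd]]]]]] := run_spy_large sigma W_le W_big n_pos t22 tN N_lt Nn.
  by exists (a, b); split=> //; exists T; split=> //; exists s'.
(* The spy's rule is a choice, over the finitely many permutations, of the outputs of the
   program. *)
have [f fP] := fin_all_exists spy_ok.
exists (Strategy f (@next_drawer n N)) => sigma; have [spy_run gd] := fP sigma; split=> // i.
rewrite /after_swap /=; set tau := (tperm _ _ * sigma)%g in gd *.
have [dec_lt ordB] := gd.
have [_ _ sn _ _] := params_bounds n_pos t22 tN.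
have om : fingraph.order (step dec_lt) i <= n.
  by apply: leq_trans (max_card _) _; rewrite card_ord.
have [|||||||T [s' [ex Tle _]]] := @run_prisoner w W n t N (drawer_of tau) (contents tau) W_le W_big
  n_pos
  t22 tN N_lt (@drawer_contents n tau) (@contents_lt n tau) (prisoner_input i) i (fingraph.order (step
    dec_lt) i).
- by [].
- by [].
- exact: ltn_ord.
- exact: dec_lt.
- by rewrite fingraph.order_gt0.
- by rewrite iter_val_step iter_order //; exact: step_inj.
- move=> k ko; rewrite iter_val_step => /val_inj/eqP; apply/negP; exact: iter_step_neq.
exists (opened sn dec_lt i), T; split.
- exact: opens_opened.
- exact: finds_opened.
- by exists s'; rewrite val_opened.
- by move=> Nn; rewrite size_opened leq_add2l; have := ordB _ (val_step dec_lt) i; rewrite ltnNge Nn.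
- by move=> _; apply: leq_trans Tle _; rewrite -mulnn; clear -n_pos; nia.
Qed.
End Main.

(** * From binary to natural logarithms *)

Section Asymptotics.
Local Open Scope ring_scope.
Variable R : realType.

Lemma ln2_bounds : (2%:R^-1 : R) <= ln 2 /\ ln 2 <= (1 : R).
Proof.
split; last by apply: (@le_ln1Dx R 1); lra.
have h : (2%:R^-1 : R) <= expR (- 2%:R^-1).
  by apply: le_trans (expR_ge1Dx _); lra.
rewrite -[leLHS]expRK ler_ln ?posrE ?expR_gt0 //.
by rewrite -[leLHS]invrK -expRN invf_ple ?posrE ?expR_gt0 // invr_gt0.
Qed.

Lemma ln_pow2 m : ln (2 ^ m)%:R = m%:R * ln (2 : R).
Proof. by rewrite natrX lnXn // mulr_natl. Qed.

Lemma ln_bounds n : (0 < n)%N ->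
  (trunc_log 2 n)%:R / 2%:R <= ln (n%:R : R) /\ ln (n%:R : R) <= (trunc_log 2 n).+1%:R.
Proof.
move=> n0; have /andP[bn nb] := trunc_log_bounds (isT : (1 < 2)%N) n0.
have [l2 l1] := ln2_bounds; split.
  apply: (@le_trans _ _ (ln (2 ^ trunc_log 2 n)%:R)).
    by rewrite ln_pow2 ler_wpM2l.
  by rewrite ler_ln ?posrE ?ltr0n ?expn_gt0 // ler_nat.
apply: (@le_trans _ _ (ln (2 ^ (trunc_log 2 n).+1)%:R)).
  by rewrite ler_ln ?posrE ?ltr0n ?expn_gt0 // ler_nat ltnW.
by rewrite ln_pow2 -[leRHS]mulr1 ler_wpM2l.
Qed.

(** The estimates used are [ln n <= 2b] and [ln (ln n) >= ln (b / 2) >= (lb - 1) / 2 >= (lb + 1) /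
    4], the last one by [3 <= lb]. The factor 16 more than covers 2 times 4. *)
Lemma drawers_bound n m : let b := trunc_log 2 n in let lb := trunc_log 2 b in
  (0 < n)%N -> (3 <= lb)%N -> (m * b <= 512 * (n * lb.+1))%N ->
  (m%:R : R) <= 512%:R * 16%:R * (n%:R * ln (ln n%:R) / ln n%:R).
Proof.
move=> b lb n0 lb3 mb; have [h1 h2] := ln_bounds n0; rewrite -/b in h1 h2.
have b0 : (0 < b)%N by move: lb3; rewrite /lb; case: (b).
have /andP[bl _] := trunc_log_bounds (isT : (1 < 2)%N) b0; rewrite -/lb in bl.
have ln0 : 0 < ln (n%:R : R) by apply: lt_le_trans h1; rewrite divr_gt0 // ltr0n.
have b2 : ln (n%:R : R) <= 2%:R * b%:R.
  by apply: le_trans h2 _; rewrite -natrM ler_nat; lia.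
have lnln : (lb.+1%:R : R) / 4%:R <= ln (ln n%:R).
  have [l2 _] := ln2_bounds.
  apply: (@le_trans _ _ (ln (2 ^ lb.-1)%:R)).
    rewrite ln_pow2; apply: (@le_trans _ _ (lb.-1%:R / 2%:R)); last by rewrite ler_wpM2l.
    rewrite ler_pdivrMr // mulrAC ler_pdivlMr // -!natrM ler_nat; lia.
  rewrite ler_ln ?posrE ?ltr0n ?expn_gt0 //; apply: le_trans h1.
  rewrite ler_pdivlMr // -natrM ler_nat; apply: leq_trans bl.
  by rewrite -expnSr prednK //; lia.
apply: (@le_trans _ _ (512%:R * 16%:R * (n%:R * (lb.+1%:R / 4%:R) / (2%:R * b%:R)))).
  have bR : 0 < (b%:R : R) by rewrite ltr0n.
  rewrite mulrA ler_pdivlMr ?mulr_gt0 // !mulrA.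
  rewrite ler_pdivlMr //.
  rewrite -!natrM ler_nat; move: mb; clear; lia.
rewrite ler_wpM2l ?mulr_ge0 //.
apply: ler_pM; rewrite ?mulr_ge0 ?divr_ge0 ?invr_ge0 ?mulr_ge0 //.
  by rewrite ler_wpM2l.
by rewrite lef_pV2 ?posrE ?mulr_gt0 // ltr0n.
Qed.
End Asymptotics.

Local Open Scope ring_scope.

Theorem theorem2 (R : realType) :
  exists (spy_prog prisoner_prog : com) (k : nat) (C : R) (N : nat),
  forall n : nat, (0 < n)%N ->
  exists S : strategy n,
  forall sigma : {perm 'I_n},
    (exists t : nat,
       spy_runs k spy_prog sigma (spy S sigma) t /\
       ((N <= n)%N -> t%:R <= C * n%:R ^+ 2)) /\
    (forall i : 'I_n,
       exists (ds : seq 'I_n) (t : nat),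
         [/\ opens S i (after_swap S sigma) ds,
             finds i (after_swap S sigma) ds,
             prisoner_runs k prisoner_prog i (after_swap S sigma) ds t,
             (N <= n)%N ->
               (size ds)%:R <= C * (n%:R * ln (ln n%:R) / ln n%:R) &
             (N <= n)%N -> t%:R <= C * n%:R ^+ 2]).
Proof.
(* [t] and [N] are abstract so that nothing evaluates [2 ^ (2 ^ 22)]. *)
have [t t22] : exists t : nat, (22 <= t)%N by exists 22.
have [N tN] : exists N : nat, (2 ^ (2 ^ t) <= N)%N by exists (2 ^ (2 ^ t))%N.
(* The 9 comes from [s + 8h <= 9h], the rest of [A] from [drawers_bound], and [B] from the running
   times. The sum of both serves as the single constant. *)
pose A : R := 9%:R * (512%:R * 16%:R); pose B : R := 100%:R * 1000%:R.
have A0 : 0 <= A by rewrite !mulr_ge0.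
have B0 : 0 <= B by rewrite mulr_ge0.
exists (spy_prog N), (prisoner_prog N), (N + 13)%N, (A + B), N => n n0.
have time T : (T <= 100 * (1000 * n ^ 2))%N -> T%:R <= (A + B) * n%:R ^+ 2.
  move=> Tn; apply: (@le_trans _ _ (B * n%:R ^+ 2)).
    by rewrite -natrX /B -mulrA -!natrM ler_nat.
  by rewrite ler_wpM2r ?exprn_ge0 // lerDr.
have [S SP] := strategy_exists t22 tN n0; exists S => sigma; have [[T [run Tn]] pris] := SP sigma.
split; first by exists T; split=> // /Tn/time.
move=> i; have [ds [T' [o f r sz Tn']]] := pris i.
exists ds, T'; split=> // [Nn|/Tn'/time //]; have {}sz := sz Nn.
have nl : (2 ^ (2 ^ t) <= n)%N by apply: leq_trans Nn.
have [Eh Es] : block_len n N = (n %/ blocks n)%N /\ num_reads n N = (2 ^ reads_log n)%N.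
  by rewrite /block_len /num_reads ltnNge Nn.
have K0 : (0 < blocks n)%N by apply: ltnW; exact: (blocks_gt1 t22 nl).
have sh : (2 ^ reads_log n <= n %/ blocks n)%N by rewrite leq_divRL //; exact: (reads_blocks t22 nl).
have lb3 : (3 <= trunc_log 2 (trunc_log 2 n))%N.
  by apply: leq_trans (trunc_log_max (isT : (1 < 2)%N) (b_large nl)); apply: leq_trans t22.
have main := drawers_bound R n0 lb3 (block_size t22 nl).
apply: (@le_trans _ _ (9%:R * (n %/ blocks n)%:R)).
  by rewrite -natrM ler_nat; apply: leq_trans sz _; rewrite Eh Es; move: sh; clear; lia.
apply: (@le_trans _ _ (9%:R * (512%:R * 16%:R * (n%:R * ln (ln n%:R) / ln n%:R)))).
  by rewrite ler_wpM2l.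
(* Enlarging the constant from [A] to [A + B] needs a nonnegative factor; this follows from the
   bound already obtained, whose left side is a natural number. *)
have X0 : 0 <= n%:R * ln (ln n%:R) / ln n%:R :> R.
  have : (0 : R) <= 512%:R * 16%:R * (n%:R * ln (ln n%:R) / ln n%:R) by apply: le_trans main.
  by rewrite pmulr_rge0 // mulr_gt0.
by rewrite mulrA -/A ler_wpM2r // lerDl.
Qed.
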